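(* Type C: for $n\geq 2$ and a nonempty subset $K\subseteq[n]$, the following are equivalent: (1) $\operatorname{SpFl}_{K;2n}^{>0}=\operatorname{SpFl}_{K;2n}^{\Delta>0}$; (2) $\operatorname{SpFl}_{K;2n}^{\geq 0}=\operatorname{SpFl}_{K;2n}^{\Delta\geq 0}$; (3) $K=\{k,k+1,\dots,n\}$ for some $1\leq k\leq n$. Type B: for $n\geq 3$ and a nonempty subset $K\subseteq[n]$, the following are equivalent: (1) $\operatorname{SOFl}_{K;2n+1}^{>0}=\operatorname{SOFl}_{K;2n+1}^{\Delta>0}$; (2) $\operatorname{SOFl}_{K;2n+1}^{\geq 0}=\operatorname{SOFl}_{K;2n+1}^{\Delta\geq 0}$; (3) $K=\{k,k+1,\dots,n\}$ for some $1\leq k\leq n$. In type B, when $n=2$, the equalities $\operatorname{SOFl}_{K;5}^{>0}=\operatorname{SOFl}_{K;5}^{\Delta>0}$ and $\operatorname{SOFl}_{K;5}^{\geq 0}=\operatorname{SOFl}_{K;5}^{\Delta\geq 0}$ hold for all partial flag varieties $\operatorname{SOFl}_{K;5}$ (that is, for all nonempty $K\subseteq[2]$).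
   Context: All groups and varieties are identified with their real points; $[n]=\{1,\dots,n\}$; $E_{a,b}$ denotes a matrix unit. Flag varieties. For $K=\{k_1<\dots<k_j\}\subseteq[N-1]$, $\operatorname{Fl}_{K;N}$ is the set of flags $L_\bullet=(L_1\subseteq\dots\subseteq L_j)$ of subspaces of $\mathbb R^N$ with $\dim L_i=k_i$. A $k$-dimensional subspace is Plücker positive (resp. nonnegative) if it is the row-span of a real $k\times N$ matrix (equivalently the column-span of an $N\times k$ matrix) all of whose maximal minors are positive (resp. nonnegative). $\operatorname{Fl}_{K;N}^{\Delta>0}$ (resp. $\operatorname{Fl}_{K;N}^{\Delta\ge0}$) is the set of flags all of whose subspaces are Plücker positive (resp. nonnegative). Groups. Let $E$ be the antidiagonal $2n\times 2n$ matrix with $E_{i,2n+1-i}=(-1)^{i+1}$ and let $E'$ be the antidiagonal $(2n+1)\times(2n+1)$ matrix with $E'_{i,2n+2-i}=(-1)^i$. Then $\operatorname{Sp}_{2n}=\{A\in SL_{2n}(\mathbb R): A^tEA=E\}$ and $\operatorname{SO}_{2n+1}=\{A\in SL_{2n+1}(\mathbb R): A^tE'A=E'\}$. For $K\subseteq[n]$, $\operatorname{SpFl}_{K;2n}$ is the set of $L_\bullet\in\operatorname{Fl}_{K;2n}$ with every $L_i$ isotropic for the alternating form $E$ (the form restricts to $0$ on $L_i$), and $\operatorname{SOFl}_{K;2n+1}$ is the set of $L_\bullet\in\operatorname{Fl}_{K;2n+1}$ with every $L_i$ isotropic for the symmetric form $E'$. Put $\operatorname{SpFl}_{K;2n}^{\Delta>0}=\operatorname{SpFl}_{K;2n}\cap\operatorname{Fl}_{K;2n}^{\Delta>0}$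 and $\operatorname{SOFl}_{K;2n+1}^{\Delta>0}=\operatorname{SOFl}_{K;2n+1}\cap\operatorname{Fl}_{K;2n+1}^{\Delta>0}$, and likewise with $\Delta\ge0$. Lusztig positivity. One uses the following one-parameter subgroups, $i\in[n]$. For $\operatorname{Sp}_{2n}$: $y_i(m)=(I+mE_{i+1,i})(I+mE_{2n+1-i,2n-i})$ for $i<n$, and $y_n(m)=I+mE_{n+1,n}$. For $\operatorname{SO}_{2n+1}$: $y_i(m)=(I+mE_{i+1,i})(I+mE_{2n+2-i,2n+1-i})$ for $i<n$, and $y_n(m)=I+\sqrt2\,m(E_{n+1,n}+E_{n+2,n+1})+m^2E_{n+2,n}$. In both cases $x_i(m)=y_i(m)^t$. Let $W$ be the Weyl group of type $B_n=C_n$ with simple reflections $s_1,\dots,s_n$ ($s_{n-1}s_n$ of order 4), and let $s_{i_1}\cdots s_{i_\ell}$ be a reduced word for its longest element. Let $U_-^{>0}=\{y_{i_1}(a_1)\cdots y_{i_\ell}(a_\ell): a_j>0\}$ and $U_+^{>0}=\{x_{i_1}(a_1)\cdots x_{i_\ell}(a_\ell): a_j>0\}$ (these do not depend on the reduced word). Let $T^{>0}$ be the group of diagonal matrices in the group ($\operatorname{Sp}_{2n}$ or $\operatorname{SO}_{2n+1}$) with positive diagonal entries. Then $\operatorname{Sp}_{2n}^{>0}$, resp. $\operatorname{SO}_{2n+1}^{>0}$, is $U_-^{>0}T^{>0}U_+^{>0}$. For $K=\{k_1<\dots<k_j\}\subseteq[n]$, $\operatorname{SpFl}_{K;2n}$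 (resp. $\operatorname{SOFl}_{K;2n+1}$) is identified with a quotient $G/P$ of $G=\operatorname{Sp}_{2n}$ (resp. $\operatorname{SO}_{2n+1}$) by sending $A\in G$ to the flag whose $i$-th subspace is the span of the first $k_i$ columns of $A$. The Lusztig positive part $\operatorname{SpFl}_{K;2n}^{>0}$ (resp. $\operatorname{SOFl}_{K;2n+1}^{>0}$) is the image of $G^{>0}$ under this map, and the Lusztig nonnegative part $\operatorname{SpFl}_{K;2n}^{\ge0}$ (resp. $\operatorname{SOFl}_{K;2n+1}^{\ge0}$) is the closure of the positive part in the Euclidean topology. *)

(* Defs.v *)
From HB Require Import structures.
From mathcomp Require Import all_boot all_order all_algebra all_fingroup.
From mathcomp Require Import all_classical all_reals topology normedtype.

Import Order.TTheory GRing.Theory Num.Theory.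
Import numFieldNormedType.Exports.

Local Open Scope classical_set_scope.
Local Open Scope ring_scope.

(* Indexing convention: [n] = {1, ..., n} is represented by 'I_n, with
   i : 'I_n standing for i.+1.  In particular K : {set 'I_n} represents
   {i.+1 | i \in K}, the set of dimensions of the subspaces of a flag. *)

Definition colspan {R : realType} {N k : nat} (A : 'M[R]_(N, k)) :
    {vspace 'cV[R]_N} :=
  <<[seq col j A | j <- enum 'I_k]>>%VS.

(* The disjoint union of the Grassmannians Gr(k, N) for all k. *)
Definition grassmannian (R : realType) (N : nat) : Type := {vspace 'cV[R]_N}.

Section GrassmannianTopology.
Variables (R : realType) (N : nat).

HB.instance Definition _ :=
  Choice.copy (grassmannian R N) {vspace 'cV[R]_N}.

(* The Euclidean topology: on each Gr(k, N), the quotient topology for the map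
   sending an N x k matrix of rank k to its column span. *)
Definition grassmannian_open : set (set (grassmannian R N)) :=
  [set U | forall k : nat,
     open ([set A : subspace [set A : 'M[R]_(N, k) | \rank A = k]
            | U (colspan A)])].

Let grassmannian_openT : grassmannian_open setT.
Proof. by move=> k; exact: openT. Qed.

Let grassmannian_openI : setI_closed grassmannian_open.
Proof. by move=> U V oU oV k; apply: openI; [exact: oU | exact: oV]. Qed.

Let grassmannian_open_bigcup (I : Type) (f : I -> set (grassmannian R N)) :
  (forall i, grassmannian_open (f i)) -> grassmannian_open (\bigcup_i f i).
Proof. by move=> of_ k; apply: bigcup_open => i _; exact: of_. Qed.

HB.instance Definition _ := @isOpenTopological.Build (grassmannian R N)
  grassmannian_open grassmannian_openT grassmannian_openI
  grassmannian_open_bigcup.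

End GrassmannianTopology.

(* Families of subspaces of R^N indexed by K, with the product topology. *)
Definition flag_space (R : realType) (N : nat) {n : nat} (K : {set 'I_n}) :
    topologicalType :=
  {ptws {k : 'I_n | k \in K} -> grassmannian R N}.

Section Flags.
Context {R : realType} {N n : nat}.

Definition Fl (K : {set 'I_n}) : set (flag_space R N K) :=
  [set L : flag_space R N K |
    (forall k : {k | k \in K},
       \dim (L k : {vspace 'cV[R]_N}) = (val k).+1) /\
    (forall k l : {k | k \in K}, (val k <= val l)%N ->
       ((L k : {vspace 'cV[R]_N}) <= L l)%VS)].

Definition plucker_positive (L : {vspace 'cV[R]_N}) : Prop :=
  exists B : 'M[R]_(N, \dim L), colspan B = L /\
    forall f : 'I_(\dim L) -> 'I_N,
      (forall i j : 'I_(\dim L), (i < j)%N -> (f i < f j)%N) -> 0 < \det (rowsub f B).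

Definition plucker_nonneg (L : {vspace 'cV[R]_N}) : Prop :=
  exists B : 'M[R]_(N, \dim L), colspan B = L /\
    forall f : 'I_(\dim L) -> 'I_N,
      (forall i j : 'I_(\dim L), (i < j)%N -> (f i < f j)%N) -> 0 <= \det (rowsub f B).

Definition isotropic (J : 'M[R]_N) (L : {vspace 'cV[R]_N}) : Prop :=
  forall u v, u \in L -> v \in L -> u^T *m J *m v = 0.

Definition isoFl (J : 'M[R]_N) (K : {set 'I_n}) : set (flag_space R N K) :=
  Fl K `&` [set L : flag_space R N K | forall k : {k | k \in K}, isotropic J (L k)].

Definition FlDpos (K : {set 'I_n}) : set (flag_space R N K) :=
  Fl K `&` [set L : flag_space R N K | forall k : {k | k \in K}, plucker_positive (L k)].

Definition FlDnonneg (K : {set 'I_n}) : set (flag_space R N K) :=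
  Fl K `&` [set L : flag_space R N K | forall k : {k | k \in K}, plucker_nonneg (L k)].

Definition flag_of (K : {set 'I_n}) (A : 'M[R]_N) : flag_space R N K :=
  fun k : {k | k \in K} =>
    <<[seq col j A | j : 'I_N <- enum 'I_N & (j < (val k).+1)%N]>>%VS.

End Flags.

Section WeylGroup.
Context {n : nat}.
Local Open Scope group_scope.

(* The Weyl group of type B_n = C_n is realized as the group of signed
   permutations, acting on 'I_n * bool, where (i, true) and (i, false) stand
   for i.+1 and -(i.+1).  For i.+1 < n, ordS i is the successor of i. *)
Definition simple_reflection (i : 'I_n) : {perm ('I_n * bool)%type} :=
  if (i.+1 < n)%N then
    tperm (i, true) (ordS i, true) * tperm (i, false) (ordS i, false)
  else tperm (i, true) (i, false).

Definition weyl_elt (w : seq 'I_n) : {perm ('I_n * bool)%type} :=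
  \prod_(i <- w) simple_reflection i.

Definition reduced_word (w : seq 'I_n) : Prop :=
  forall w' : seq 'I_n, weyl_elt w' = weyl_elt w -> (size w <= size w')%N.

Definition longest_reduced_word (w : seq 'I_n) : Prop :=
  reduced_word w /\
  forall w' : seq 'I_n, reduced_word w' -> (size w' <= size w)%N.

End WeylGroup.

Section LusztigPositivity.
Context {R : realType} {N n : nat}.

Definition isometries (J : 'M[R]_N) : set 'M[R]_N :=
  [set A | \det A = 1 /\ A^T *m J *m A = J].

Definition word_cell (y : 'I_n -> R -> 'M[R]_N) (w : seq 'I_n) :
    set 'M[R]_N :=
  [set \prod_(j < size w) y (tnth (in_tuple w) j) (a j)
     | a in [set a : 'I_(size w) -> R | forall j, 0 < a j]].

Definition torus_pos (G : set 'M[R]_N) : set 'M[R]_N :=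
  G `&` [set t | is_diag_mx t /\ forall i, 0 < t i i].

Definition group_pos (G : set 'M[R]_N) (y : 'I_n -> R -> 'M[R]_N)
    (w : seq 'I_n) : set 'M[R]_N :=
  [set A | exists u t v,
     [/\ word_cell y w u, torus_pos G t,
         word_cell (fun i m => (y i m)^T) w v & A = u *m t *m v]].

End LusztigPositivity.

Section Classical.
Variable R : realType.
Context {n : nat}.
Local Open Scope nat_scope.

(* The matrix unit E_{a,b}, with a and b in {1, ..., N}. *)
Definition munit (N a b : nat) : 'M[R]_N :=
  (\matrix_(i, j) ((i.+1 == a) && (j.+1 == b))%:R)%R.

Definition Sp_form : 'M[R]_(2 * n) :=
  (\sum_(1 <= i < (2 * n).+1)
     (-1) ^+ (i + 1) *: munit (2 * n) i (2 * n + 1 - i))%R.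

Definition SO_form : 'M[R]_(2 * n + 1) :=
  (\sum_(1 <= i < (2 * n + 1).+1)
     (-1) ^+ i *: munit (2 * n + 1) i (2 * n + 2 - i))%R.

Definition Sp : set 'M[R]_(2 * n) := isometries Sp_form.
Definition SO : set 'M[R]_(2 * n + 1) := isometries SO_form.

Definition Sp_y (i0 : 'I_n) (m : R) : 'M[R]_(2 * n) :=
  let i := i0.+1 in let E := munit (2 * n) in
  if i < n then
    ((1%:M + m *: E (i + 1)%N i) *m
     (1%:M + m *: E (2 * n + 1 - i)%N (2 * n - i)%N))%R
  else (1%:M + m *: E (n + 1)%N n)%R.

Definition SO_y (i0 : 'I_n) (m : R) : 'M[R]_(2 * n + 1) :=
  let i := i0.+1 in let E := munit (2 * n + 1) in
  if i < n then
    ((1%:M + m *: E (i + 1)%N i) *m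
     (1%:M + m *: E (2 * n + 2 - i)%N (2 * n + 1 - i)%N))%R
  else
    (1%:M + (Num.sqrt 2 * m) *: (E (n + 1)%N n + E (n + 2)%N (n + 1)%N)
          + m ^+ 2 *: E (n + 2)%N n)%R.

Definition Sp_pos (w : seq 'I_n) := group_pos Sp Sp_y w.
Definition SO_pos (w : seq 'I_n) := group_pos SO SO_y w.

Variable K : {set 'I_n}.

Definition SpFl : set (flag_space R (2 * n) K) := isoFl Sp_form K.
Definition SOFl : set (flag_space R (2 * n + 1) K) := isoFl SO_form K.

Definition SpFlDpos := SpFl `&` FlDpos K.
Definition SpFlDnonneg := SpFl `&` FlDnonneg K.
Definition SOFlDpos := SOFl `&` FlDpos K.
Definition SOFlDnonneg := SOFl `&` FlDnonneg K.

Definition SpFl_pos (w : seq 'I_n) : set (flag_space R (2 * n) K) :=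
  flag_of K @` Sp_pos w.
Definition SOFl_pos (w : seq 'I_n) : set (flag_space R (2 * n + 1) K) :=
  flag_of K @` SO_pos w.

(* SpFl and SOFl are closed in flag_space, so these closures agree with the
   closures inside SpFl and SOFl. *)
Definition SpFl_nonneg (w : seq 'I_n) := closure (SpFl_pos w).
Definition SOFl_nonneg (w : seq 'I_n) := closure (SOFl_pos w).

End Classical.

(* Main.v *)
Require Import Defs.
From mathcomp Require Import all_boot all_order all_algebra all_fingroup.
From mathcomp Require Import all_classical all_reals topology normedtype.
From mathcomp Require Import zify ring lra.

Set Implicit Arguments. Unset Strict Implicit. Unset Printing Implicit Defensive.
Import Order.TTheory GRing.Theory Num.Theory.
Local Open Scope ring_scope.

(**
Both groups are treated at once: N is 2n or 2n+1 and J is the antidiagonal form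
with alternating signs, which is the symplectic form of the statement when N is
even and the opposite of the orthogonal one when N is odd. Elements of the
simple root subgroups of both groups are products of the elementary matrices [Y
i a] = 1 + a E_{i+1,i} of SL_N (rows and columns are numbered from 0), so that a
word in the Weyl group of type B_n unfolds to a word in the symmetric group of N
letters.

The group cell. A reduced word of the longest element unfolds to a reduced word
of the longest permutation ([longest_unfold]). A lower unitriangular matrix
factors along that word, with positive parameters, as soon as its minors on
consecutive rows and initial columns are positive: Neville elimination gives the
factorization for one word ([neville]) and the braid relations transport it to
every other one ([cell_indep]). The factorization is unique ([Ycell_uniq]). If
the matrix is an isometry of J, the involution A |-> J^-1 A^-T J yields a second
factorization, with flipped letters; so the parameters of paired letters agree
and the factors assemble into elements of root subgroups of the group
([fold_cell]). By the complementary minor formula it is enough to look at the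
minors on the first k <= n columns ([Gcell_of_posmat]): the Lusztig positive
flags are the flags of columns of the lower unitriangular isometries whose k
first columns, for each k <= n, have positive maximal minors.

If K is an upper interval, the positive parts agree. A Pluecker positive
isotropic flag extends downwards to a complete one, since a Pluecker positive
subspace contains a Pluecker positive hyperplane ([positive_hyperplane]): move
the subspace slightly backwards along a curve g(t) of totally positive
isometries with g(0) = 1, take the hyperplane where the first coordinate
vanishes, which is Pluecker nonnegative, and move it forwards, which makes it
positive. A complete isotropic flag is the flag of columns of an isometry
([complete_isometry]), and the criterion above applies.

If the positive parts agree, so do the nonnegative parts. Multiplication by g(t)
turns a Pluecker nonnegative isotropic flag into a Pluecker positive one, so the
closure of the Pluecker positive part is the Pluecker nonnegative part
([closure_Dpos]).

If K is not an upper interval, the nonnegative parts differ. Some dimension d =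
k+1 with k = [k0] belongs to K while d+1 does not, and d < n. On the Lusztig
positive part a quadratic form in the minors of the d-dimensional subspace is
nonnegative: when evaluated on the columns of an isometry of the group it
becomes a minor of that isometry, because the entries (k+1,k) and (N-1-k,N-2-k)
of an isometry agree ([subdiag_sym], [quad_gap_ge0], [quad_odd_ge0]). This
inequality survives in the closure, and it fails for an explicit Pluecker
nonnegative isotropic flag ([gap_far], [gap_even], [gap_odd]). The flag must
avoid the dimension d+1; the last case, d = n-1 for the orthogonal group, needs
another quadratic form and exists only if n >= 3.

For the orthogonal group with n = 2 the remaining case is K = {1}: a positive
isotropic line is contained in a positive isotropic plane, given by an explicit
second vector ([isotropic_pair]), and the criterion for complete flags applies.
*)

(** * Words and independence of the reduced word *)

Definition swapn (i r : nat) : nat :=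
  if r == i then i.+1 else if r == i.+1 then i else r.

(** Permutations are functions on the natural numbers, the letter [i] being
the transposition of [i] and [i.+1] and the first letter acting first; no
bound on the letters has to be carried along. *)
Fixpoint wfun (w : seq nat) : nat -> nat :=
  if w is i :: w' then fun r => wfun w' (swapn i r) else id.

(** Reducedness in the form in which it is used: prepending a letter to a
reduced word must create an inversion. *)
Fixpoint red (w : seq nat) : bool :=
  if w is i :: w' then (wfun w' i < wfun w' i.+1)%N && red w' else true.

Lemma swapnl i : swapn i i = i.+1. Proof. by rewrite /swapn eqxx. Qed.
Lemma swapnr i : swapn i i.+1 = i.
Proof. by rewrite /swapn eqxx; case: eqP => //; lia. Qed.
Lemma swapn_id i r : r != i -> r != i.+1 -> swapn i r = r.
Proof. by rewrite /swapn => /negPf-> /negPf->. Qed.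
Lemma swapnK i : involutive (swapn i).
Proof.
move=> r; case: (eqVneq r i) => [->|h]; first by rewrite swapnl swapnr.
case: (eqVneq r i.+1) => [->|h2]; first by rewrite swapnr swapnl.
by rewrite !swapn_id // swapn_id.
Qed.
Lemma swapnC i j r : (i.+1 < j)%N || (j.+1 < i)%N ->
  swapn j (swapn i r) = swapn i (swapn j r).
Proof. by rewrite /swapn => h; do !case: ifPn => //; lia. Qed.
Lemma swapn_braid i j r : (j == i.+1) || (i == j.+1) ->
  swapn i (swapn j (swapn i r)) = swapn j (swapn i (swapn j r)).
Proof. by rewrite /swapn => h; do !case: ifPn => //; lia. Qed.

Section Words.
Variables (R : realType) (X : Type) (T : nat -> R -> X -> X) (x0 : X).

(** The products along a word with positive parameters. The operation [T] is
left abstract: it is instantiated with lower and upper elementary matrices and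
with the generators of the isometry groups. *)
Fixpoint cell (w : seq nat) (x : X) : Prop :=
  if w is i :: w' then exists a x', [/\ 0 < a, cell w' x' & x = T i a x']
  else x = x0.

Hypothesis Tcomm : forall i j a b x, (i.+1 < j)%N ->
  T i a (T j b x) = T j b (T i a x).
Hypothesis Tbraid : forall i j a b c x, (j == i.+1) || (i == j.+1) ->
  0 < a -> 0 < b -> 0 < c ->
  T i a (T j b (T i c x)) =
  T j (b * c / (a + c)) (T i (a + c) (T j (a * b / (a + c)) x)).

(** The exchange condition with parameters. If [j] is a descent then the
letter [j] can be brought to the front: it commutes with the first letter when
they are far apart; otherwise two exchanges in the tail produce a braid i j i,
to which the braid relation applies. The relation keeps parameters positive,
so that the new word describes the same element. *)
Lemma cell_exchange m (w : seq nat) (x : X) (j : nat) : size w = m ->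
  red w -> cell w x -> (wfun w j.+1 < wfun w j)%N ->
  exists w' b x', [/\ (size w').+1 = m, red w',
    forall r, wfun w r = wfun w' (swapn j r), 0 < b & cell w' x' /\ x = T j b x'].
Proof.
elim/ltn_ind: m w x j => m IH [|i w] x j /=; first by lia.
move=> sz /andP[asc rw] [a [y [a0 cy ->]]] des.
case: (eqVneq i j) => [<-|nij].
  by exists w, a, y; split.
have szw : (size w < m)%N by rewrite -sz.
have {sz} sz : m = (size w).+1 by [].
case: (boolP ((i.+1 < j)%N || (j.+1 < i)%N)) => [far|near].
  have des' : (wfun w j.+1 < wfun w j)%N.
    by move: des; rewrite !swapn_id //; lia.
  have [w1 [b [z [sz1 rw1 f1 b0 [cz ->]]]]] := IH _ szw _ _ _ erefl rw cy des'.
  exists (i :: w1), b, (T i a z); split => //=; first by lia.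
  - by rewrite rw1 andbT; move: asc; rewrite !f1 !swapn_id //; lia.
  - by move=> r; rewrite f1 swapnC.
  - split; first by exists a, z.
    by case/orP: far => h; [rewrite Tcomm | rewrite -Tcomm].
have adj : (j == i.+1) || (i == j.+1) by lia.
have des' : (wfun w j.+1 < wfun w j)%N.
  by case/orP: adj => /eqP e; subst; move: des asc; rewrite ?swapnl ?swapnr swapn_id; lia.
have [w1 [b [z [sz1 rw1 f1 b0 [cz ->]]]]] := IH _ szw _ _ _ erefl rw cy des'.
have sw2 k l : (l == k.+1) || (k == l.+1) -> [/\ swapn l (swapn k l) = k,
    swapn l (swapn k l.+1) = k.+1, swapn k l = swapn l k &
    swapn k l.+1 = swapn l k.+1].
  by rewrite /swapn => h; split; do !case: ifPn => //; lia.
have [e1 e2 e3 e4] := sw2 _ _ adj.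
have [e5 e6 _ _] := sw2 j i (etrans (orbC _ _) adj).
have des2 : (wfun w1 i.+1 < wfun w1 i)%N by move: des; rewrite !f1 e1 e2.
have asc1 : (wfun w1 (swapn i j) < wfun w1 (swapn i j.+1))%N.
  by move: asc; rewrite !f1 e3 e4.
have asc2 : (wfun w1 (swapn i (swapn j i)) < wfun w1 (swapn i (swapn j i.+1)))%N.
  by move: des'; rewrite !f1 e5 e6 swapnl swapnr.
have szw1 : (size w1 < m)%N by lia.
have [w2 [c [t [sz2 rw2 f2 c0 [ct ->]]]]] := IH _ szw1 _ _ _ erefl rw1 cz des2.
exists (i :: j :: w2), (b * c / (a + c)), (T i (a + c) (T j (a * b / (a + c)) t)).
have ac0 : 0 < a + c by apply: addr_gt0.
split => //=.
- by lia.
- by move: asc1 asc2; rewrite rw2 !f2 !swapnK => -> ->.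
- by move=> r; rewrite f1 f2 swapn_braid.
- by rewrite divr_gt0 ?mulr_gt0.
- split; last by rewrite Tbraid.
  exists (a + c), (T j (a * b / (a + c)) t); split => //.
  by exists (a * b / (a + c)), t; split => //; rewrite divr_gt0 ?mulr_gt0.
Qed.

(** Matsumoto's theorem for cells: bring the first letter of the second word
to the front of the first one and conclude by induction. *)
Lemma cell_indep (w w' : seq nat) (x : X) : red w -> red w' ->
  wfun w =1 wfun w' -> cell w x -> cell w' x.
Proof.
elim: w' w x => [|j w' IH] w x rw /=.
  case: w rw => [|i w] //= /andP[asc _] _ f _.
  by have := f i; have := f i.+1; move: asc; rewrite swapnl swapnr /=; lia.
move=> /andP[asc rw'] f cx.
have des : (wfun w j.+1 < wfun w j)%N.
  by rewrite !f swapnl swapnr.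
have [w1 [b [z [_ rw1 f1 b0 [cz ->]]]]] := cell_exchange erefl rw cx des.
exists b, z; split => //; apply: (IH w1) => // r.
by have := f1 (swapn j r); rewrite f !swapnK.
Qed.

End Words.

(** * Elementary matrices and the braid relations *)

Section Elementary.
Variables (R : realType) (N : nat).
Local Notation E := (munit R N).

Definition elem (p q : nat) (a : R) : 'M[R]_N := 1%:M + a *: E p.+1 q.+1.
Definition Y (i : nat) : R -> 'M[R]_N := elem i.+1 i.
Definition X (i : nat) : R -> 'M[R]_N := elem i i.+1.

Lemma tr_munit a b : (E a b)^T = E b a.
Proof. by apply/matrixP => r c; rewrite !mxE andbC. Qed.

Lemma tr_elem p q a : (elem p q a)^T = elem q p a.
Proof. by rewrite /elem linearD /= trmx1 linearZ /= tr_munit. Qed.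

(** Rows indexed by natural numbers, zero beyond the size, so that letters of
words can be used as row indices. *)
Definition rw k (B : 'M[R]_(N, k)) (i : nat) (c : 'I_k) : R :=
  if insub i is Some i' then B i' c else 0.

Lemma rwE k (B : 'M[R]_(N, k)) (i : 'I_N) c : rw B i c = B i c.
Proof. by rewrite /rw valK. Qed.

Lemma rw_ge k (B : 'M[R]_(N, k)) i c : (N <= i)%N -> rw B i c = 0.
Proof. by move=> h; rewrite /rw insubN // -leqNgt. Qed.

Lemma elemE k p q a (B : 'M[R]_(N, k)) r c :
  (elem p q a *m B) r c = B r c + (r == p :> nat)%:R * (a * rw B q c).
Proof.
rewrite /elem mulmxDl mul1mx -scalemxAl !mxE; congr (_ + _).
rewrite mulrCA; congr (_ * _).
case: (ltnP q N) => qN; last first.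
  rewrite rw_ge // mulr0 big1 // => j _; rewrite !mxE !eqSS.
  by case: (eqVneq (j : nat) q) => [e|]; [have := ltn_ord j; lia | rewrite andbF mul0r].
rewrite (bigD1 (Ordinal qN)) //= !mxE big1 ?addr0 => [|j /eqP jq].
  by rewrite !eqSS eqxx andbT -(rwE B (Ordinal qN)).
rewrite !mxE !eqSS; case: (eqVneq (j : nat) q) => [e|]; last by rewrite andbF mul0r.
by case: jq; apply: val_inj.
Qed.

Lemma rw_elem k p q a (B : 'M[R]_(N, k)) r c : (r < N)%N ->
  rw (elem p q a *m B) r c = rw B r c + (r == p)%:R * (a * rw B q c).
Proof. by move=> rN; rewrite -[r]/(val (Ordinal rN)) !rwE elemE. Qed.

Lemma rw_elem_ne k p q a (B : 'M[R]_(N, k)) r c : r != p ->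
  rw (elem p q a *m B) r c = rw B r c.
Proof.
move=> /negPf rp; case: (ltnP r N) => rN; last by rewrite !rw_ge.
by rewrite rw_elem // rp mul0r addr0.
Qed.

Lemma elemD k p q a b (B : 'M[R]_(N, k)) : p != q ->
  elem p q a *m (elem p q b *m B) = elem p q (a + b) *m B.
Proof.
move=> pq; apply/matrixP => r s; rewrite !elemE.
case: (eqVneq (r : nat) p) => [e|]; last by rewrite !mul0r !addr0.
case: (ltnP q N) => qN; last by rewrite !(@rw_ge _ _ q) // !mulr0 !addr0.
by rewrite rw_elem // eq_sym (negPf pq) !mul0r; ring.
Qed.

Lemma elem0 p q : elem p q 0 = 1%:M.
Proof. by rewrite /elem scale0r addr0. Qed.

Lemma elemC k p q r s a b (B : 'M[R]_(N, k)) : q != r -> s != p ->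
  elem p q a *m (elem r s b *m B) = elem r s b *m (elem p q a *m B).
Proof.
move=> qr sp; apply/matrixP => i j; rewrite !elemE !rw_elem_ne //; ring.
Qed.

(** The rank two relation of Lusztig, the only computation behind independence
of the reduced word. *)
Lemma Y_braid k i j a b c (B : 'M[R]_(N, k)) : (j == i.+1) || (i == j.+1) ->
  0 < a -> 0 < b -> 0 < c ->
  Y i a *m (Y j b *m (Y i c *m B)) =
  Y j (b * c / (a + c)) *m (Y i (a + c) *m (Y j (a * b / (a + c)) *m B)).
Proof.
move=> ij a0 b0 c0; have ac : a + c != 0 by rewrite gt_eqF ?addr_gt0.
apply/matrixP => r s; rewrite /Y !elemE.
have rN := ltn_ord r.
have e1 (t : nat) : (t == t.+1) = false by lia.
have e2 (t : nat) : (t == t.+2) = false by lia.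
have e3 (t : nat) : (t.+1 == t) = false by lia.
have e4 (t : nat) : (t.+2 == t) = false by lia.
have [rj|rj] := eqVneq (r : nat) j.+1; have [ri|ri] := eqVneq (r : nat) i.+1;
  rewrite ?mul0r ?addr0 //; first by lia.
  by rewrite rj in rN; case/orP: ij => /eqP e; subst;
    rewrite !rw_elem ?e1 ?e2 ?e3 ?e4 ?eqxx; try lia; rewrite ?mul1r ?mul0r ?addr0; field.
by rewrite ri in rN; case/orP: ij => /eqP e; subst;
  rewrite !rw_elem ?e1 ?e2 ?e3 ?e4 ?eqxx; try lia; rewrite ?mul1r ?mul0r ?addr0; field.
Qed.

Lemma X_braid k i j a b c (B : 'M[R]_(N, k)) : (j == i.+1) || (i == j.+1) ->
  0 < a -> 0 < b -> 0 < c ->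
  X i a *m (X j b *m (X i c *m B)) =
  X j (b * c / (a + c)) *m (X i (a + c) *m (X j (a * b / (a + c)) *m B)).
Proof.
move=> ij a0 b0 c0; have := Y_braid 1%:M ij c0 b0 a0.
move/(congr1 trmx); rewrite !mulmx1 !trmx_mul !tr_elem -!mulmxA.
move/(congr1 (fun M => M *m B)); rewrite -!mulmxA.
by rewrite (addrC c) (mulrC b) (mulrC c).
Qed.

Lemma Y_comm k i j a b (B : 'M[R]_(N, k)) : (i.+1 < j)%N ->
  Y i a *m (Y j b *m B) = Y j b *m (Y i a *m B).
Proof. by move=> ij; apply: elemC; lia. Qed.

Lemma X_comm k i j a b (B : 'M[R]_(N, k)) : (i.+1 < j)%N ->
  X i a *m (X j b *m B) = X j b *m (X i a *m B).
Proof. by move=> ij; apply: elemC; lia. Qed.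

End Elementary.

(** * Minors under elementary row operations *)

Section Minors.
Variables (R : realType) (N k : nat).
Implicit Types (B : 'M[R]_(N, k)) (f : 'I_k -> 'I_N).

Definition incr f := forall i j : 'I_k, (i < j)%N -> (f i < f j)%N.
Definition nnmat B := forall f, incr f -> 0 <= \det (rowsub f B).
Definition posmat B := forall f, incr f -> 0 < \det (rowsub f B).
Definition repl f (i0 : 'I_k) (q : 'I_N) : 'I_k -> 'I_N :=
  fun i => if i == i0 then q else f i.

Lemma incr_inj f : incr f -> injective f.
Proof.
move=> fi i j e; apply/val_inj; apply/eqP; rewrite eqn_leq leqNgt.
apply/andP; split; last rewrite leqNgt; apply/negP => /fi; rewrite e ltnn //.
Qed.

Lemma incr_leq f : incr f -> forall i j, (f i <= f j)%N = (i <= j)%N.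
Proof.
move=> fi i j; case: (ltngtP i j) => [/fi/ltnW->//|/fi|/val_inj->]; last by rewrite leqnn.
by rewrite ltnNge => /negPf.
Qed.

Lemma incr_ge f : incr f -> forall i : 'I_k, (i <= f i)%N.
Proof.
move=> fi i.
elim/ltn_ind: {i}(i : nat) {-2}i (erefl (i : nat)) => m IH i im.
case: m im IH => [|m] im IH; first by rewrite im.
have mk : (m < k)%N by have := ltn_ord i; rewrite im; lia.
have := IH m (ltnSn _) (Ordinal mk) erefl => /= h.
have h2 : (f (Ordinal mk) < f i)%N by apply: fi; rewrite im.
by lia.
Qed.

Lemma det_row0 n (A : 'M[R]_n) (i : 'I_n) : row i A = 0 -> \det A = 0.
Proof.
move=> r0; rewrite (expand_det_row A i) big1 // => j _.
by have /rowP/(_ j) := r0; rewrite !mxE => ->; rewrite mul0r.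
Qed.

Lemma rowsub_at f B i j : rowsub f B i j = B (f i) j. Proof. by rewrite mxE. Qed.

Lemma minor_elem_out (p q : nat) a B f : (forall i, f i != p :> nat) ->
  rowsub f (elem N p q a *m B) = rowsub f B.
Proof.
move=> fp; apply/matrixP => i j; rewrite [LHS]mxE elemE [RHS]mxE.
by rewrite (negPf (fp i)) mul0r addr0.
Qed.

(** Linearity of the determinant in the row that receives the multiple of [q]. *)
Lemma minor_elem_in (p : nat) (q : 'I_N) a B f i0 : f i0 = p :> nat -> incr f ->
  \det (rowsub f (elem N p q a *m B)) =
  \det (rowsub f B) + a * \det (rowsub (repl f i0 q) B).
Proof.
move=> fp fi; rewrite (@determinant_multilinear _ _ _ (rowsub f B)
  (rowsub (repl f i0 q) B) i0 1 a) ?mul1r //.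
- apply/rowP => j; rewrite [LHS]mxE rowsub_at elemE fp eqxx !mxE.
  by rewrite /repl eqxx rwE !mul1r.
- apply/matrixP => i j; rewrite [RHS]mxE rowsub_at elemE [LHS]mxE rowsub_at.
  case: eqVneq => [e|]; last by rewrite mul0r addr0.
  by case/eqP: (neq_lift i0 i); apply/(incr_inj fi)/val_inj; rewrite /= e fp.
- apply/matrixP => i j; rewrite [RHS]mxE rowsub_at elemE [LHS]mxE rowsub_at.
  rewrite /repl [lift _ _ == _]eq_sym (negPf (neq_lift i0 i)).
  case: eqVneq => [e|]; last by rewrite mul0r addr0.
  by case/eqP: (neq_lift i0 i); apply/(incr_inj fi)/val_inj; rewrite /= e fp.
Qed.

Lemma minor_repeat B f i j : i != j -> f i = f j -> \det (rowsub f B) = 0.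
Proof.
move=> ij e; apply: (determinant_alternate ij) => c.
by rewrite !mxE e.
Qed.

Definition adj (p q : nat) := (p == q.+1) || (q == p.+1).

Lemma incr_repl f i0 (q : 'I_N) : incr f -> adj (f i0) q -> (forall i, f i != q) ->
  incr (repl f i0 q).
Proof.
move=> fi pq fq i j ij; have := fi _ _ ij; rewrite /repl.
have qne l : (f l != q :> nat) by have := fq l; rewrite -(inj_eq val_inj).
have := qne i; have := qne j; move: pq; rewrite /adj.
case: (eqVneq i i0) => [e|_]; case: (eqVneq j i0) => [e'|_] //; last by subst; lia.
- by move: ij; rewrite e e' ltnn.
- by subst; lia.
Qed.

(** For adjacent [p] and [q], replacing [p] by [q] in a set of rows either
preserves the order of the rows or repeats a row; so the correction term of
[minor_elem_in] is a nonnegative multiple of a minor. *)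
Lemma minor_elem_ge (p q : nat) a B f : 0 <= a -> adj p q -> nnmat B -> incr f ->
  \det (rowsub f B) <= \det (rowsub f (elem N p q a *m B)).
Proof.
move=> a0 pq nB fi.
case: (ltnP q N) => qN; last first.
  rewrite (_ : elem N p q a *m B = B) //; apply/matrixP => i j.
  by rewrite elemE rw_ge // mulr0 mulr0 addr0.
case: (pickP (fun i => (f i : nat) == p)) => [i0 /eqP fp|fp]; last first.
  by rewrite minor_elem_out // => i; rewrite fp.
rewrite (minor_elem_in (Ordinal qN) a B fp fi) lerDl mulr_ge0 //.
case: (pickP (fun i => f i == Ordinal qN)) => [i1 /eqP fq|fq]; last first.
  by apply: nB; apply: incr_repl => //; [rewrite fp | move=> i; rewrite fq].
have ne : i0 != i1.
  by apply/eqP => e; move: pq; rewrite -fp e fq /adj /=; lia.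
rewrite (@minor_repeat _ _ i0 i1) //.
by rewrite /repl eqxx eq_sym (negPf ne).
Qed.

Lemma nnmat_elem (p q : nat) a B : 0 <= a -> adj p q -> nnmat B ->
  nnmat (elem N p q a *m B).
Proof. by move=> a0 pq nB f fi; apply: le_trans (nB f fi) (minor_elem_ge _ _ _ _). Qed.

(** The same correction term shows that positivity propagates from the set of
rows containing [q] to the set containing [p]. *)
Lemma minor_elem_gt (p : nat) (q : 'I_N) a B f i0 : 0 < a -> f i0 = p :> nat ->
  adj p q -> (forall i, f i != q) ->
  nnmat B -> incr f ->
  0 < \det (rowsub (repl f i0 q) (elem N p q a *m B)) ->
  0 < \det (rowsub f (elem N p q a *m B)).
Proof.
move=> a0 fp pq fq nB fi.
rewrite minor_elem_out; last first.
  move=> i; rewrite /repl; case: (i =P i0) => [_|ne]; first by move: pq; rewrite /adj; lia.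
  by apply/eqP => e; apply: ne; apply: (incr_inj fi); apply: val_inj; rewrite /= e fp.
move=> pos; rewrite (minor_elem_in q a B fp fi) ltr_wpDl ?mulr_gt0 //.
exact: nB.
Qed.

End Minors.

(** * Cells of unipotent matrices and positivity of their minors *)

Section Cells.
Variables (R : realType) (N : nat).

Definition Ycell := cell (fun (i : nat) (a : R) (M : 'M[R]_N) => Y N i a *m M) 1%:M.
Definition Xcell := cell (fun (i : nat) (a : R) (M : 'M[R]_N) => X N i a *m M) 1%:M.
(** This characterizes the longest permutation of N letters. *)
Definition alldesc (w : seq nat) := forall j, (j.+1 < N)%N -> (wfun w j.+1 < wfun w j)%N.

Lemma Ycell_indep w w' u : red w -> red w' -> wfun w =1 wfun w' ->
  Ycell w u -> Ycell w' u.
Proof.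
apply: cell_indep => [i j a b x ij|i j a b c x ij a0 b0 c0].
  exact: Y_comm.
exact: Y_braid.
Qed.

Lemma Ycell_desc w u j : red w -> Ycell w u -> (wfun w j.+1 < wfun w j)%N ->
  exists w' b u', [/\ red w', 0 < b, Ycell w' u' & u = Y N j b *m u'].
Proof.
move=> rw cu dj.
have [| |w' [b [u' [_ rw' _ b0 [cu' ->]]]]] := cell_exchange _ _ erefl rw cu dj.
- by move=> *; apply: Y_comm.
- by move=> *; apply: Y_braid.
by exists w', b, u'.
Qed.

Lemma Xcell_desc w u j : red w -> Xcell w u -> (wfun w j.+1 < wfun w j)%N ->
  exists w' b u', [/\ red w', 0 < b, Xcell w' u' & u = X N j b *m u'].
Proof.
move=> rw cu dj.
have [| |w' [b [u' [_ rw' _ b0 [cu' ->]]]]] := cell_exchange _ _ erefl rw cu dj.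
- by move=> *; apply: X_comm.
- by move=> *; apply: X_braid.
by exists w', b, u'.
Qed.

Section Act.
Variable k : nat.
Implicit Types (B : 'M[R]_(N, k)) (f : 'I_k -> 'I_N).

Lemma Ycell_nn w u B : Ycell w u -> nnmat B -> nnmat (u *m B).
Proof.
move=> + nB; elim: w u => [|i w IH] u /=; first by move=> ->; rewrite mul1mx.
case=> a [u' [a0 /IH n' ->]]; rewrite -mulmxA; apply: nnmat_elem => //.
  exact: ltW.
by rewrite /adj eqxx.
Qed.

Lemma Ycell_ge w u B f : Ycell w u -> nnmat B -> incr f ->
  \det (rowsub f B) <= \det (rowsub f (u *m B)).
Proof.
move=> + nB fi; elim: w u => [|i w IH] u /=; first by move=> ->; rewrite mul1mx.
case=> a [u' [a0 cu' ->]]; rewrite -mulmxA; apply: le_trans (IH _ cu') _.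
apply: minor_elem_ge => //; first exact: ltW.
  by rewrite /adj eqxx.
exact: Ycell_nn cu' nB.
Qed.

Lemma Xcell_nn w u B : Xcell w u -> nnmat B -> nnmat (u *m B).
Proof.
move=> + nB; elim: w u => [|i w IH] u /=; first by move=> ->; rewrite mul1mx.
case=> a [u' [a0 /IH n' ->]]; rewrite -mulmxA; apply: nnmat_elem => //.
  exact: ltW.
by rewrite /adj eqxx orbT.
Qed.

Lemma Xcell_ge w u B f : Xcell w u -> nnmat B -> incr f ->
  \det (rowsub f B) <= \det (rowsub f (u *m B)).
Proof.
move=> + nB fi; elim: w u => [|i w IH] u /=; first by move=> ->; rewrite mul1mx.
case=> a [u' [a0 cu' ->]]; rewrite -mulmxA; apply: le_trans (IH _ cu') _.
apply: minor_elem_ge => //; first exact: ltW.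
  by rewrite /adj eqxx orbT.
exact: Xcell_nn cu' nB.
Qed.

(** The induction step for statements about all minors: sets of rows are
ordered by the sum of their elements and the initial one is minimal. *)
Lemma incr_lower f : incr f -> (forall i, f i = i :> nat) \/
  exists i0 (q : 'I_N), [/\ f i0 = q.+1 :> nat, (forall i, f i != q),
   incr (repl f i0 q) & (\sum_i repl f i0 q i < \sum_i f i)%N].
Proof.
move=> fi.
case: (boolP [forall i, f i == i :> nat]) => [/forallP h|].
  by left=> i; apply/eqP.
rewrite negb_forall => /existsP[i1 /= ne1]; right.
have [i0 ne0 min0] := @arg_minnP _ i1 (fun i => f i != i :> nat) (fun i : 'I_k => i : nat) ne1.
have le_f := incr_ge fi.
have gt0 : (i0 < f i0)%N by rewrite ltn_neqAle eq_sym ne0 le_f.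
have qN : ((f i0).-1 < N)%N by have := ltn_ord (f i0); lia.
have adjq : adj (f i0) (Ordinal qN) by rewrite /adj /= prednK ?eqxx //; lia.
have nq i : f i != Ordinal qN.
  apply/eqP => /(congr1 val) /= e.
  have ii0 : (i < i0)%N.
    by rewrite ltnNge; apply/negP; rewrite -(incr_leq fi); lia.
  have : ~~ (f i != i :> nat) by apply/negP => /min0; lia.
  by move/negPn/eqP; lia.
exists i0, (Ordinal qN); split => //=; first by lia.
  exact: incr_repl.
rewrite (bigD1 i0) //= [X in (_ < X)%N](bigD1 i0) //= /repl eqxx /=.
rewrite (eq_bigr (fun i => f i : nat)); first by lia.
by move=> i /negPf->.
Qed.

(** Total positivity on the cell of the longest element. Starting from the
initial minor one goes up: if row [q.+1] can be lowered to [q], then since [q]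
is a descent of the longest element the factor [Y q] can be brought to the
front, and it adds to the minor a positive multiple of the lower one. *)
Lemma Ycell_pos w u B : red w -> alldesc w -> Ycell w u -> nnmat B ->
  (forall f, (forall i, f i = i :> nat) -> 0 < \det (rowsub f B)) -> posmat (u *m B).
Proof.
move=> rw dw cu nB B0 f; move em : (\sum_i f i)%N => m.
elim/ltn_ind: m f em => m IH f fm fi.
case: (incr_lower fi) => [f0|[i0 [q [fq nq fi' lt]]]].
  by apply: lt_le_trans (B0 f f0) (Ycell_ge cu nB fi).
have qN : (q.+1 < N)%N by rewrite -fq.
have [w' [b [u' [_ b0 cu' eu]]]] := Ycell_desc rw cu (dw _ qN).
rewrite eu -mulmxA; apply: (minor_elem_gt b0 fq) => //.
- by rewrite /adj eqxx.
- exact: Ycell_nn cu' nB.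
- by rewrite mulmxA -eu; apply: (IH (\sum_i repl f i0 q i)%N); rewrite -?fm.
Qed.

(** The mirror image: upper elementary matrices push positivity from any minor
down to the initial one. Together with [Ycell_pos], the product of a lower and
an upper totally positive matrix makes all minors of a nonnegative matrix of
full rank positive. *)
Lemma Xcell_pos w u B f : red w -> alldesc w -> Xcell w u -> nnmat B ->
  incr f -> 0 < \det (rowsub f B) ->
  forall g : 'I_k -> 'I_N, (forall i, g i = i :> nat) -> 0 < \det (rowsub g (u *m B)).
Proof.
move=> rw dw cu nB fi Bf g g0.
have {Bf} : 0 < \det (rowsub f (u *m B)) by apply: lt_le_trans Bf (Xcell_ge cu nB fi).
move em : (\sum_i f i)%N => m.
elim/ltn_ind: m f em fi => m IH f fm fi pos.
case: (incr_lower fi) => [f0|[i0 [q [fq nq fi' lt]]]].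
  by rewrite (_ : g = f) //; apply/funext => i; apply: val_inj; rewrite /= g0 f0.
apply: (IH (\sum_i repl f i0 q i)%N _ _ erefl fi'); rewrite -?fm //.
have qN : (q.+1 < N)%N by rewrite -fq.
have [w' [b [u' [_ b0 cu' eu]]]] := Xcell_desc rw cu (dw _ qN).
rewrite eu -mulmxA.
(* the roles of the rows are exchanged with respect to [Ycell_pos]: positivity goes from q + 1 to q *)
have e1 : repl f i0 q i0 = q :> nat by rewrite /repl eqxx.
have eX : X N q b = elem N q (f i0) b by rewrite /X fq.
rewrite eX; apply: (minor_elem_gt b0 e1) => //.
- by rewrite fq /adj eqxx orbT.
- move=> i; rewrite /repl; case: (i =P i0) => [_|ne].
    by rewrite -(inj_eq val_inj) /= fq; lia.
  by apply/eqP => /(incr_inj fi)/ne.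
- exact: Xcell_nn cu' nB.
- rewrite (_ : repl (repl f i0 q) i0 (f i0) = f); last first.
    by apply/funext => i; rewrite /repl; case: (i =P i0) => // ->.
  by rewrite -eX mulmxA -eu.
Qed.
End Act.
End Cells.

(** * Uniqueness of the factorization *)

Section Unique.
Variables (R : realType) (N : nat).
Implicit Types (u : 'M[R]_N) (x y : nat -> R).

Definition vanish x u K := forall c : 'I_N, (c < K)%N -> \sum_(j < N) x j * u j c = 0.
(** The Bruhat cell of [u] seen through row relations: a combination of rows
of [u] whose first nonzero coefficient is at [p] vanishes on the first [K]
columns. For [u] in the cell of a reduced word this happens exactly for [K <=
wfun w p] ([leadvec_cell]), so it tells neighbouring cells apart. *)
Definition leadvec u p K :=
  exists x, [/\ forall j, (j < p)%N -> x j = 0, x p != 0 & vanish x u K].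
(** The action of [Y i a] on the coefficients of a row combination. *)
Definition shear (i : nat) (a : R) x : nat -> R :=
  fun j => x j + (j == i)%:R * (a * x i.+1).

Lemma vanish_lin x y a b u K : vanish x u K -> vanish y u K ->
  vanish (fun j => a * x j + b * y j) u K.
Proof.
move=> vx vy c cK; under eq_bigr do rewrite mulrDl -!mulrA.
by rewrite big_split /= -!mulr_sumr vx // vy // !mulr0 addr0.
Qed.

Lemma vanish_Y i a x u K : (i.+1 < N)%N ->
  vanish x (Y N i a *m u) K <-> vanish (shear i a x) u K.
Proof.
move=> iN.
suff E (c : 'I_N) : \sum_(j < N) x j * (Y N i a *m u) j c =
   \sum_(j < N) shear i a x j * u j c.
  by split=> v c cK; [rewrite -E v | rewrite E v].
under eq_bigr do rewrite elemE mulrDr.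
under [RHS]eq_bigr do rewrite /shear mulrDl.
rewrite !big_split /=; congr (_ + _).
rewrite (bigD1 (Ordinal iN)) //= big1 ?addr0 => [|j /eqP ji]; last first.
  by case: eqP => [e|_]; [case: ji; apply: val_inj | rewrite mul0r mulr0].
rewrite [RHS](bigD1 (Ordinal (ltnW iN))) //= big1 ?addr0 => [|j /eqP ji]; last first.
  by case: eqP => [e|_]; [case: ji; apply: val_inj | rewrite !mul0r].
by rewrite !eqxx !mul1r -(rwE u (Ordinal (ltnW iN))) mulrCA mulrA.
Qed.

Lemma shearK i a x : shear i a (shear i (- a) x) =1 x.
Proof.
move=> j; rewrite /shear.
have -> : (i.+1 == i) = false by lia.
by rewrite mul0r addr0; ring.
Qed.

Lemma vanish_eq x y u K : x =1 y -> vanish x u K -> vanish y u K.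
Proof. by move=> e v c cK; rewrite -[RHS](v c cK); apply: eq_bigr => j _; rewrite e. Qed.

Lemma leadvec_cell w u p K : all (fun i => i.+1 < N)%N w -> red w -> Ycell w u ->
  (p < N)%N -> (K <= N)%N -> leadvec u p K <-> (K <= wfun w p)%N.
Proof.
move=> + + + + KN; elim: w u p => [|i w IH] u p /=.
  move=> _ _ -> pN; split.
    case=> x [x0 xp v]; rewrite leqNgt; apply/negP => pK.
    have := v (Ordinal pN) pK; rewrite (bigD1 (Ordinal pN)) //= mxE eqxx mulr1.
    rewrite big1 ?addr0; first by move/eqP; rewrite (negPf xp).
    by move=> j /negPf jp; rewrite mxE jp mulr0.
  move=> Kp; exists (fun j => (j == p)%:R); split.
  - by move=> j jp; rewrite ltn_eqF.
  - by rewrite eqxx oner_eq0.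
  - move=> c cK; rewrite big1 // => j _; rewrite mxE -natrM mulnb.
    by case: (eqVneq j c) => [->|]; rewrite ?andbF // ltn_eqF // (leq_trans cK).
case/andP=> iN wN /andP[asc rw] [a [u' [a0 cu' ->]]] pN.
have a_neq0 : a != 0 by rewrite gt_eqF.
have IH' q (qN : (q < N)%N) := IH _ q wN rw cu' qN.
have iN' := ltnW iN.
have neqS (j : nat) : (j.+1 == j) = false by lia.
have [epi|npi] := eqVneq p i.
  subst p; rewrite swapnl; split.
    case=> x [x0 xi /(vanish_Y _ _ _ _ iN) v].
    have [yi|yi] := eqVneq (shear i a x i) 0.
      apply/(IH' _ iN); exists (shear i a x); split => //.
        move=> j; rewrite ltnS leq_eqVlt => /orP[/eqP->//|ji].
        by rewrite /shear x0 // ltn_eqF // mul0r addr0.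
      rewrite {1}/shear neqS mul0r addr0.
      apply: contra_neq xi => x1; move: yi.
      by rewrite /shear x1 eqxx mulr0 mulr0 addr0.
    apply: leq_trans (ltnW asc); apply/(IH' _ iN'); exists (shear i a x); split => //.
    by move=> j ji; rewrite /shear x0 // ltn_eqF // mul0r addr0.
  move/(IH' _ iN) => [z [z0 zi v]].
  exists (shear i (- a) z); split.
  - by move=> j ji; rewrite /shear z0 ?ltn_eqF ?mul0r ?addr0 //; lia.
  - by rewrite /shear eqxx z0 // add0r mul1r mulf_neq0 ?oppr_eq0.
  - by apply/vanish_Y => //; apply: vanish_eq v => j; rewrite shearK.
have [epi|npi'] := eqVneq p i.+1.
  subst p; rewrite swapnr; split.
    case=> x [x0 xi /(vanish_Y _ _ _ _ iN) v].
    apply/(IH' _ iN'); exists (shear i a x); split => //.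
      by move=> j ji; rewrite /shear x0 ?ltn_eqF ?mul0r ?addr0 //; lia.
    by rewrite /shear eqxx x0 // add0r mul1r mulf_neq0.
  move=> Kf; have := Kf; move/(IH' _ iN') => [z [z0 zi v]].
  have : (K <= wfun w i.+1)%N by apply: leq_trans Kf (ltnW asc).
  move/(IH' _ iN) => [z' [z0' zi' v']].
  (* the combination of z and z' whose coordinates at i and i+1 have ratio a *)
  pose y j := (a * z' i.+1) * z j + (z i - a * z i.+1) * z' j.
  have y1 : y i.+1 = z i * z' i.+1 by rewrite /y; ring.
  have yi : y i = a * y i.+1 by rewrite y1 /y (z0' i) //; ring.
  exists (shear i (- a) y); split.
  - move=> j; rewrite ltnS leq_eqVlt => /orP[/eqP->|ji].
      by rewrite /shear eqxx yi mul1r; ring.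
    by rewrite /shear /y (z0 j) // (z0' j) ?ltn_eqF ?mul0r ?mulr0 ?addr0 //; lia.
  - by rewrite /shear neqS mul0r addr0 y1 mulf_neq0.
  - apply/vanish_Y => //; apply: (@vanish_eq y) => [j|]; first by rewrite shearK.
    exact: vanish_lin.
rewrite swapn_id //.
have sh b x j : (forall j, (j < p)%N -> x j = 0) -> (j <= p)%N -> shear i b x j = x j.
  rewrite /shear => x0 jp; case: eqP => [ji|_]; last by rewrite mul0r addr0.
  by rewrite (x0 i.+1) ?mulr0 ?addr0 //; lia.
split.
  case=> x [x0 xi /(vanish_Y _ _ _ _ iN) v].
  apply/(IH' _ pN); exists (shear i a x); split => //; last by rewrite sh.
  by move=> j jp; rewrite sh ?x0 //; exact: ltnW.
move/(IH' _ pN) => [z [z0 zi v]].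
exists (shear i (- a) z); split.
- by move=> j jp; rewrite sh ?z0 //; exact: ltnW.
- by rewrite sh.
- by apply/vanish_Y => //; apply: vanish_eq v => j; rewrite shearK.
Qed.

(** If the first parameters differed, then [u2] would be [Y i (a - b) *m u1]
with a - b nonzero, which lies in another Bruhat cell. *)
Lemma Ycell_uniq i w a b u1 u2 : (i.+1 < N)%N -> all (fun i => i.+1 < N)%N w ->
  red (i :: w) -> (wfun w i.+1 <= N)%N -> Ycell w u1 -> Ycell w u2 ->
  Y N i a *m u1 = Y N i b *m u2 -> a = b /\ u1 = u2.
Proof.
move=> iN wN /= /andP[asc rw] fN c1 c2 e.
have YK c (M : 'M[R]_N) : Y N i (- c) *m (Y N i c *m M) = M.
  by rewrite elemD ?addNr ?elem0 ?mul1mx //; lia.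
have [ab|ab] := eqVneq a b.
  by split=> //; rewrite -(YK a u1) e ab YK.
have e2 : Y N i (a - b) *m u1 = u2.
  by rewrite -(YK b u2) -e elemD ?(addrC (- b)) //; lia.
have /(leadvec_cell wN rw c2 iN fN) : (wfun w i.+1 <= wfun w i.+1)%N by [].
rewrite -e2 => -[x [x0 xi /(vanish_Y _ _ _ _ iN) v]].
have : (wfun w i.+1 <= wfun w i)%N.
  apply/(leadvec_cell wN rw c1 (ltnW iN) fN); exists (shear i (a - b) x); split => //.
    by move=> j ji; rewrite /shear x0 ?ltn_eqF ?mul0r ?addr0 //; lia.
  by rewrite /shear eqxx x0 // add0r mul1r mulf_neq0 // subr_eq0.
by rewrite leqNgt asc.
Qed.

End Unique.

(** * Neville elimination *)

(** The reduced word of the longest permutation along which Neville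
elimination proceeds: column [c] is cleared from the bottom up, then column
[c.+1], and so on. *)
Fixpoint nevw (c f : nat) : seq nat :=
  if f is f'.+1 then rev (iota c f) ++ nevw c.+1 f' else [::].

Lemma rev_iotaS c m : rev (iota c m.+1) = (c + m)%N :: rev (iota c m).
Proof. by rewrite -addn1 iotaD rev_cat. Qed.

Lemma nevwP f c : red (nevw c f) /\
  forall r, wfun (nevw c f) r = if (c <= r <= c + f)%N then (c + c + f - r)%N else r.
Proof.
elim: f c => [|f IH] c.
  by split=> // r; rewrite /nevw /=; case: ifP; lia.
have [rg gE] := IH c.+1; rewrite [nevw c f.+1]/=  -/(iota c f.+1).
set g := nevw c.+1 f in rg gE *.
suff H m : (m <= f.+1)%N -> red (rev (iota c m) ++ g) /\
   forall r, wfun (rev (iota c m) ++ g) r = if (r < c)%N then r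
       else if (r < c + m)%N then wfun g r.+1 else if r == (c + m)%N then c else wfun g r.
  have [r1 f1] := H f.+1 (leqnn _); split => // r; rewrite f1 !gE.
  by do ![case: ifP]; lia.
elim: m => [|m IHm] mf.
  split=> // r; rewrite cat0s !gE; do ![case: ifP]; lia.
have [rm fm] := IHm (ltnW mf); rewrite rev_iotaS /=; split.
  by rewrite rm andbT !fm !gE; do ![case: ifP]; lia.
move=> r; rewrite fm !gE; rewrite /swapn.
do ![case: ifP]; lia.
Qed.

Section Neville.
Variables (R : realType) (N : nat).
Implicit Types u : 'M[R]_N.

(** Natural numbers as indices on both sides, so that arithmetic on rows and
columns needs no bounds. *)
Definition ent u (i j : nat) : R := if insub j is Some j' then rw u i j' else 0.
(** The solid minors of the theory of total positivity. *)
Definition solid u (i c k : nat) : R := \det (\matrix_(a < k, b < k) ent u (i + a) (c + b)).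
Definition unilower u :=
  (forall r s : 'I_N, (r < s)%N -> u r s = 0) /\ (forall r, u r r = 1).

Lemma entE u (i j : 'I_N) : ent u i j = u i j.
Proof. by rewrite /ent valK rwE. Qed.

Lemma ent_Ordinal u r s (rN : (r < N)%N) (sN : (s < N)%N) :
  ent u r s = u (Ordinal rN) (Ordinal sN).
Proof. by rewrite -entE. Qed.

Lemma ent_lower u r s : unilower u -> (r < s)%N -> ent u r s = 0.
Proof.
move=> [lo _] rs; case: (ltnP s N) => sN; last by rewrite /ent insubN // -leqNgt.
by rewrite (ent_Ordinal _ (ltn_trans rs sN) sN) lo.
Qed.

Lemma ent_diag u r : unilower u -> (r < N)%N -> ent u r r = 1.
Proof. by move=> [_ di] rN; rewrite (ent_Ordinal _ rN rN) di. Qed.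

(** Each row below [c + m] loses the multiple of the row above it that clears
its entry in column [c]; for [m = 0] the whole column is cleared, and
increasing [m] restores the rows from the top down, one elementary matrix at a
time ([clearS]). *)
Definition clear u (c m : nat) : 'M[R]_N :=
  \matrix_(r, s) (if (c + m < r)%N then
     u r s - ent u r c / ent u r.-1 c * ent u r.-1 s else u r s).

Lemma ent_clear u c m r s : (r < N)%N -> (s < N)%N ->
  ent (clear u c m) r s = if (c + m < r)%N then
     ent u r s - ent u r c / ent u r.-1 c * ent u r.-1 s else ent u r s.
Proof. by move=> rN sN; rewrite !(ent_Ordinal _ rN sN) mxE /=. Qed.

(** Clearing is unipotent on the consecutive rows involved, so it preserves
the minor, whose first column becomes (entry, 0, ..., 0). *)
Lemma solid_clear u c i k : (c <= i)%N -> (i + k < N)%N -> (c + k < N)%N ->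
  (forall j, (c <= j)%N -> (j < N)%N -> ent u j c != 0) ->
  solid u i c k.+1 = ent u i c * solid (clear u c 0) i.+1 c.+1 k.
Proof.
move=> ci ikN ckN nz.
pose A := \matrix_(a < k.+1, b < k.+1) ent u (i + a) (c + b).
(* the matrix of the row operations *)
pose L : 'M[R]_k.+1 := \matrix_(a, b) ((a == b)%:R -
   ((a : nat) == b.+1)%:R * (ent u (i + a) c / ent u (i + a).-1 c)).
have detL : \det L = 1.
  rewrite det_trig; last first.
    apply/is_trig_mxP => a b ab; rewrite mxE.
    have -> : (a == b) = false by apply/eqP => e; move: ab; rewrite e ltnn.
    have -> : ((a : nat) == b.+1) = false by lia.
    by rewrite mul0r subr0.
  by apply: big1 => a _; rewrite mxE eqxx ltn_eqF // mul0r subr0.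
have LA (a b : 'I_k.+1) : (L *m A) a b = ent (clear u c 0) (i + a) (c + b) - (a == ord0)%:R * 0
    + (if a == ord0 then ent u i (c + b) - ent (clear u c 0) i (c + b) else 0).
  rewrite mulr0 subr0 mxE (bigD1 a) //= !mxE eqxx ltn_eqF // mul0r subr0 mul1r.
  have aN : (i + a < N)%N by have := ltn_ord a; lia.
  have bN : (c + b < N)%N by have := ltn_ord b; lia.
  case: (unliftP ord0 a) => [a'|] ea; last first.
    rewrite ea eqxx addn0 big1 ?addr0; first by ring.
    by move=> j j0; rewrite !mxE /= eq_sym (negPf j0) mul0r subr0 mul0r.
  have a'k : (a' < k.+1)%N by have := ltn_ord a'; lia.
  have e1 : a = a'.+1 :> nat by rewrite ea.
  rewrite (bigD1 (Ordinal a'k)) /=; last first.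
    by apply/eqP => e; have := e1; rewrite -e /=; lia.
  rewrite big1 ?addr0; last first.
    move=> j /andP[ja ja']; rewrite !mxE eq_sym (negPf ja).
    have -> : ((a : nat) == j.+1) = false.
      by apply: contra_neqF ja' => /eqP h; apply: ord_inj; apply: succn_inj; rewrite -h e1.
    by rewrite mul0r subr0 mul0r.
  rewrite ifN; last by rewrite ea.
  rewrite addr0 ent_clear // addn0 ifT; last by lia.
  rewrite !mxE /= e1 eqxx.
  have -> : (a == Ordinal a'k) = false by apply/eqP => e; have := e1; rewrite [in LHS]e /=; lia.
  by rewrite addnS /= sub0r mul1r mulNr.
rewrite /solid -/A -[LHS]mul1r -detL -det_mulmx (expand_det_col _ ord0).
rewrite big_ord_recl big1 ?addr0 => [|a _]; last first.
  have ak := ltn_ord a.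
  rewrite LA /= /bump leq0n mulr0 subr0 addr0 addn0 ent_clear; try lia.
  rewrite addn0 ifT; last lia.
  by rewrite divfK ?subrr ?mul0r // nz; lia.
rewrite LA eqxx !addn0 mulr0 subr0 addrC subrK; congr (_ * _).
rewrite /cofactor /= expr0 mul1r; congr (\det _).
apply/matrixP => a b; rewrite mxE mxE LA [RHS]mxE /= mulr0 subr0 addr0.
by rewrite /bump /=; congr (ent _ _ _); lia.
Qed.

Lemma clear_top u c m : (N <= (c + m).+1)%N -> clear u c m = u.
Proof.
move=> h; apply/matrixP => r s; rewrite mxE ifF //.
by have := ltn_ord r; lia.
Qed.

Lemma clearS u c m : ent u (c + m) c != 0 ->
  clear u c m.+1 = Y N (c + m) (ent u (c + m).+1 c / ent u (c + m) c) *m clear u c m.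
Proof.
move=> nz; apply/matrixP => r s; rewrite elemE !mxE.
case: (eqVneq (r : nat) (c + m).+1) => [e|ne]; last first.
  by rewrite mul0r addr0; congr (if _ then _ else _); lia.
have rN := ltn_ord r; rewrite e in rN.
have sE : rw (clear u c m) (c + m) s = ent u (c + m) s.
  have := @ent_clear u c m (c + m) s (ltnW rN) (ltn_ord s).
  by rewrite ltnn /ent valK.
rewrite sE e mul1r addnS ltnn ltnSn /= subrK //.
Qed.

Lemma unilower_clear u c : unilower u ->
  (forall r s : 'I_N, (s < c)%N -> u r s = (r == s)%:R) -> unilower (clear u c 0).
Proof.
move=> uu; have [lo di] := uu; move=> uc; split=> [r s rs|r]; rewrite !mxE.
  case: ifP => _; rewrite lo // (@ent_lower u r.-1 s) ?mulr0 ?subr0 //.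
  by apply: leq_ltn_trans rs; apply: leq_pred.
case: ifP => h; rewrite di // (@ent_lower u r.-1 r) ?mulr0 ?subr0 //.
by case: (r : nat) h => [|r'] /=; lia.
Qed.

(** Clearing column [c] preserves positivity of solid minors by [solid_clear],
and is undone by factors [Y] whose parameters are quotients of entries of
column [c], hence positive. *)
Lemma neville f c u : (c + f).+1 = N -> unilower u ->
  (forall r s : 'I_N, (s < c)%N -> u r s = (r == s)%:R) ->
  (forall i k, (c <= i)%N -> (i + k < N)%N -> 0 < solid u i c k.+1) ->
  Ycell (nevw c f) u.
Proof.
elim: f c u => [|f IH] c u cN uu uc pos.
  apply/matrixP => r s; rewrite mxE.
  have [lo di] := uu.
  case: (ltnP s c) => sc; first by rewrite uc.
  have sE : (s : nat) = c by have := ltn_ord s; lia.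
  case: (eqVneq r s) => [->|ne]; first by rewrite di.
  rewrite lo //; have rN := ltn_ord r.
  have : r != s :> nat by apply: contra_neq ne => /ord_inj.
  by lia.
have u1 i : (c <= i)%N -> (i < N)%N -> 0 < ent u i c.
  move=> ci iN; have := pos i 0%N ci; rewrite addn0 => /(_ iN).
  by rewrite /solid det_mx11 mxE !addn0.
have nz i : (c <= i)%N -> (i < N)%N -> ent u i c != 0.
  by move=> ci iN; rewrite gt_eqF ?u1.
have cell0 : Ycell (nevw c.+1 f) (clear u c 0).
  have uu' := unilower_clear uu uc.
  apply: IH => //; first by lia.
    move=> r s; rewrite ltnS leq_eqVlt => /orP[/eqP sc|sc].
      rewrite mxE addn0 -!entE sc; have rN := ltn_ord r.
      case: ltnP => cr; last first.
        case: (eqVneq r s) => [->|ne]; first by rewrite sc ent_diag // -sc.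
        rewrite (ent_lower uu) // ltn_neqAle cr andbT; apply: contra_neq ne => e.
        by apply: ord_inj; rewrite e sc.
      rewrite divfK ?subrr; last by apply: nz; lia.
      by case: eqVneq => // e; move: cr; rewrite e sc ltnn.
    rewrite mxE addn0; case: ifP => cr; last by rewrite uc.
    have rN' : (r.-1 < N)%N by have := ltn_ord r; lia.
    rewrite uc // -[ent u r.-1 s]/(ent u (Ordinal rN') s) entE uc //.
    have -> : (Ordinal rN' == s) = false.
      by apply/eqP => /(congr1 (@nat_of_ord N)) /=; lia.
    by rewrite mulr0 subr0.
  move=> [|i] k ci ikN; first by lia.
  have kN : (c + k.+1 < N)%N by lia.
  have h : (i + k.+1 < N)%N by lia.
  have := pos i k.+1 ci h; rewrite solid_clear // pmulr_rgt0 //.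
  by apply: u1 => //; lia.
suff H m : (m <= f.+1)%N -> Ycell (rev (iota c m) ++ nevw c.+1 f) (clear u c m).
  by have := H f.+1 (leqnn _); rewrite clear_top //; lia.
elim: m => [|m IHm] mf; first exact: cell0.
rewrite rev_iotaS cat_cons clearS; last by apply: nz; lia.
eexists _, _; split; [|exact: IHm (ltnW mf)|reflexivity].
by apply: divr_gt0; apply: u1; lia.
Qed.

End Neville.

(** * The form and its involution on the cells *)

Lemma wfun_lt M w r : all (fun i => i.+1 < M)%N w -> (r < M)%N -> (wfun w r < M)%N.
Proof.
elim: w r => //= i w IH r /andP[iM wM] rM; apply: IH => //.
by rewrite /swapn; do !case: ifP; lia.
Qed.

Section Form.
Variables (R : realType) (N : nat).

(** The common model of the two forms, the symplectic one for even N and the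
opposite of the orthogonal one for odd N. *)
Definition altform : 'M[R]_N := \matrix_(i, j) ((-1) ^+ i * ((i + j).+1 == N)%:R).
Local Notation J := altform.

Lemma altformE k (B : 'M[R]_(N, k)) (i j : 'I_N) s : (i + j).+1 = N ->
  (J *m B) i s = (-1) ^+ i * B j s.
Proof.
move=> ij; rewrite mxE (bigD1 j) //= mxE ij eqxx mulr1 big1 ?addr0 // => l /eqP lj.
rewrite mxE; case: eqP => [e|]; last by rewrite mulr0 mul0r.
by case: lj; apply: ord_inj; lia.
Qed.

Lemma formE k l (A : 'M[R]_(N, k)) (B : 'M[R]_(N, l)) r s :
  (A^T *m J *m B) r s = \sum_(i < N) (-1) ^+ i * A i r * B (rev_ord i) s.
Proof.
rewrite -mulmxA mxE; apply: eq_bigr => i _.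
rewrite (@altformE _ _ _ (rev_ord i)); last by have := ltn_ord i; rewrite /=; lia.
by rewrite mxE mulrCA mulrA.
Qed.

Lemma altform_sqr : J *m J = (-1) ^+ N.-1 *: 1%:M.
Proof.
apply/matrixP => i j.
rewrite (@altformE _ _ _ (rev_ord i)); last by have := ltn_ord i; rewrite /=; lia.
rewrite !mxE mulrA -exprD; congr (_ ^+ _ * _%:R); first by have := ltn_ord i; rewrite /=; lia.
rewrite -(inj_eq (@ord_inj N)) /=; have := ltn_ord i; have := ltn_ord j; lia.
Qed.

(** [B] is the image of [A] under the involutive automorphism A |-> J^-1 A^-T
J, whose fixed points are the isometries. *)
Definition sigma_rel (A B : 'M[R]_N) := A^T *m J *m B = J.

Lemma sigma_mul A A' B B' : sigma_rel A B -> sigma_rel A' B' ->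
  sigma_rel (A *m A') (B *m B').
Proof.
rewrite /sigma_rel => h h'; rewrite trmx_mul -!mulmxA (mulmxA J) (mulmxA A^T).
by rewrite (mulmxA A^T) h mulmxA.
Qed.

Lemma sigma1 : sigma_rel 1%:M 1%:M.
Proof. by rewrite /sigma_rel trmx1 mul1mx mulmx1. Qed.

Lemma sigma_fun A B B' : sigma_rel A B -> sigma_rel A B' -> B = B'.
Proof.
rewrite /sigma_rel => h h'.
have : (A^T *m J) *m ((-1) ^+ N.-1 *: (B *m J)) = 1%:M.
  by rewrite -scalemxAr mulmxA h altform_sqr scalerA -exprD addnn -muln2 exprM sqrr_sign scale1r.
move/mulmx1C => e; rewrite -[B']mul1mx -e -!mulmxA [A^T *m _]mulmxA h'.
rewrite -scalemxAl -mulmxA altform_sqr -scalemxAr mulmx1 scalerA.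
by rewrite -exprD addnn -muln2 exprM sqrr_sign scale1r.
Qed.

(** The involution acts on elementary matrices as the flip of the Dynkin
diagram of type A. *)
Lemma sigma_Y i a : (i.+1 < N)%N -> sigma_rel (Y N i a) (Y N (N - 2 - i) a).
Proof.
move=> iN; rewrite /sigma_rel tr_elem -mulmxA.
apply/matrixP => r s; rewrite elemE.
have rN := ltn_ord r.
have qE : rw (J *m Y N (N - 2 - i) a) i.+1 s =
   (-1) ^+ i.+1 * ((s : nat) == (N - 2 - i)%N)%:R.
  rewrite -[i.+1]/(nat_of_ord (Ordinal iN)) rwE.
  rewrite (@altformE _ _ _ (rev_ord (Ordinal iN))) /=; last lia.
  rewrite /Y /elem !mxE -(inj_eq (@ord_inj N)) /= !eqSS.
  have -> : ((N - i.+2)%N == (N - 2 - i).+1) = false by lia.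
  by rewrite mulr0 addr0; congr (_ * _%:R); lia.
rewrite qE (@altformE _ _ _ (rev_ord r)) /=; last lia.
rewrite /Y /elem !mxE -(inj_eq (@ord_inj N)) /= !eqSS mulrDr.
rewrite (_ : ((N - r.+1)%N == s) = ((r + s).+1 == N)); last by have := ltn_ord s; lia.
rewrite -addrA [X in _ + X](_ : _ = 0) ?addr0 //.
rewrite (_ : ((N - r.+1)%N == (N - 2 - i).+1) = ((r : nat) == i)); last by lia.
case: eqP => [->|_]; last by rewrite mul0r /= mulr0 mulr0 addr0.
by rewrite exprS /= mul1r; ring.
Qed.

End Form.

Section Fold.
Variables (R : realType) (N n : nat).
Hypothesis Nn : N = (2 * n)%N \/ N = (2 * n + 1)%N.
Local Notation sq2 := (Num.sqrt 2 : R).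

(** The generators of the group. For the short root of the odd orthogonal
group the exponential factors through three elementary matrices of the middle
SL_3; the square root of 2 makes this factorization invariant under the braid
relation combined with the flip. *)
Definition Gy (i : nat) (a : R) : 'M[R]_N :=
  if (i.+1 < n)%N then Y N i a *m Y N (N - 2 - i) a
  else if N == (2 * n)%N then Y N i a
  else Y N i (a / sq2) *m (Y N i.+1 (sq2 * a) *m Y N i (a / sq2)).

Definition uletter (i : nat) : seq nat :=
  if (i.+1 < n)%N then [:: i; (N - 2 - i)%N]
  else if N == (2 * n)%N then [:: i] else [:: i; i.+1; i].

(** The word of type A underlying a word of type B. *)
Definition unfold (w : seq nat) := flatten (map uletter w).

Definition Gcell := cell (fun i a M => Gy i a *m M) 1%:M.

Lemma sq2_gt0 : 0 < sq2. Proof. by rewrite sqrtr_gt0. Qed.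
Lemma sq2_sqr : sq2 * sq2 = 2. Proof. by rewrite -expr2 sqr_sqrtr. Qed.

Lemma unfold_lt w : all (fun i => i < n)%N w -> all (fun i => i.+1 < N)%N (unfold w).
Proof.
elim: w => //= i w IH /andP[ilt wlt]; rewrite /unfold /= all_cat IH // andbT.
by rewrite /uletter; case: ltnP => h; [|case: eqP => h2] => /=; rewrite ?andbT; lia.
Qed.

Lemma unfold_cons i w : unfold (i :: w) = uletter i ++ unfold w. Proof. by []. Qed.

Lemma sigma_Y_pair i j (a : R) : (i + j).+2 = N -> sigma_rel (Y N i a) (Y N j a).
Proof. by move=> ij; rewrite (_ : j = N - 2 - i)%N; [apply: sigma_Y|]; lia. Qed.

(** The involution preserves the cell of an unfolded word: it exchanges two
commuting letters, fixes a middle letter, or turns i j i into j i j, which the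
braid relation turns back. *)
Lemma cell_flip w (u : 'M[R]_N) : all (fun i => i < n)%N w -> Ycell (unfold w) u ->
  exists u', Ycell (unfold w) u' /\ sigma_rel u u'.
Proof.
elim: w u => [|i w IH] u /=; first by move=> _ ->; exists 1%:M; split => //; exact: sigma1.
move=> /andP[ilt wlt]; rewrite unfold_cons /uletter.
case: ltnP => h; [|case: eqP => h2] => /=.
- case=> a [_ [a0 [b [u1 [b0 /(IH _ wlt)[u2 [c2 s2]] ->]]] ->]].
  exists (Y N i b *m (Y N (N - 2 - i) a *m u2)); split.
    by exists b, (Y N (N - 2 - i) a *m u2); split => //; exists a, u2.
  rewrite Y_comm; last lia.
  by apply: sigma_mul; [|apply: sigma_mul] => //; apply: sigma_Y_pair; lia.
- case=> a [u1 [a0 /(IH _ wlt)[u2 [c2 s2]] ->]].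
  exists (Y N i a *m u2); split; first by exists a, u2.
  by apply: sigma_mul => //; apply: sigma_Y_pair; lia.
case=> a [_ [a0 [b [_ [b0 [c [u1 [c0 /(IH _ wlt)[u2 [c2 s2]] ->]]] ->]]] ->]].
exists (Y N i.+1 a *m (Y N i b *m (Y N i.+1 c *m u2))); split; last first.
  by do 3?[apply: sigma_mul] => //; apply: sigma_Y_pair; lia.
rewrite Y_braid ?eqxx ?orbT //.
eexists _, _; split; [| |reflexivity]; first by rewrite divr_gt0 ?mulr_gt0 ?addr_gt0.
eexists _, _; split; [| |reflexivity]; first by rewrite addr_gt0.
eexists _, _; split; [| |reflexivity]; first by rewrite divr_gt0 ?mulr_gt0 ?addr_gt0.
by [].
Qed.

(** An isometry of the cell has two factorizations, its own and the image of
it under the involution. Uniqueness identifies their parameters, so the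
letters arising from one letter of [w] carry the parameters of a generator of
the group. *)
Lemma fold_cell w (u : 'M[R]_N) : all (fun i => i < n)%N w -> red (unfold w) ->
  Ycell (unfold w) u -> sigma_rel u u -> Gcell w u.
Proof.
elim: w u => [|i w IH] u //=.
move=> /andP[ilt wlt]; have Ult := unfold_lt wlt.
have iN : (i.+1 < N)%N by lia.
rewrite unfold_cons /uletter.
have wb j w' : all (fun i => i.+1 < N)%N w' -> (j < N)%N -> (wfun w' j <= N)%N.
  by move=> wl jN; apply/ltnW/wfun_lt.
case: (ltnP i.+1 n) => h; [|case: eqP => h2] => rU.
- have i'N : ((N - 2 - i).+1 < N)%N by lia.
  case=> a [_ [a0 [b [u1 [b0 c1 ->]]] ->]] ss.
  have [u2 [c2 s2]] := cell_flip wlt c1.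
  have e : Y N i a *m (Y N (N - 2 - i) b *m u1) = Y N i b *m (Y N (N - 2 - i) a *m u2).
    apply: (sigma_fun ss); rewrite Y_comm; last lia.
    by apply: sigma_mul; [|apply: sigma_mul] => //; apply: sigma_Y_pair; lia.
  have [||||ab e2] := Ycell_uniq iN _ rU _ _ _ e.
  + by rewrite /= i'N.
  + by apply: wb => //=; rewrite i'N.
  + by exists b, u1.
  + by exists a, u2.
  have rU' : red ((N - 2 - i)%N :: unfold w) by case/andP: rU.
  have [|_ e3] := Ycell_uniq i'N Ult rU' _ c1 c2 e2; first by apply: wb.
  exists a, u1; split => //; last by rewrite /Gy h ab mulmxA.
  apply: IH => //; last by rewrite {2}e3.
  by case/andP: rU'.
- case=> a [u1 [a0 c1 eu]] ss.
  have [u2 [c2 s2]] := cell_flip wlt c1.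
  have e : Y N i a *m u1 = Y N i a *m u2.
    rewrite -eu; apply: (sigma_fun ss); rewrite eu.
    by apply: sigma_mul => //; apply: sigma_Y_pair; lia.
  have [|_ e3] := Ycell_uniq iN Ult rU _ c1 c2 e; first by apply: wb.
  exists a, u1; split => //; last by rewrite /Gy ltnNge h /= (introT eqP h2).
  apply: IH => //; last by rewrite {2}e3.
  by case/andP: rU.
have i'N : (i.+2 < N)%N by lia.
case=> a [_ [a0 [b [_ [b0 [c [u1 [c0 c1 ->]]] ->]]] eu]] ss.
have [u2 [c2 s2]] := cell_flip wlt c1.
have : u = Y N i.+1 a *m (Y N i b *m (Y N i.+1 c *m u2)).
  apply: (sigma_fun ss); rewrite {1}eu.
  by do 3?[apply: sigma_mul] => //; apply: sigma_Y_pair; lia.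
rewrite Y_braid ?eqxx ?orbT // {1}eu => e.
have p0 : 0 < b * c / (a + c) by rewrite divr_gt0 ?mulr_gt0 ?addr_gt0.
have q0 : 0 < a + c by rewrite addr_gt0.
have r0 : 0 < a * b / (a + c) by rewrite divr_gt0 ?mulr_gt0 ?addr_gt0.
have [||||e1 {}e] := Ycell_uniq iN _ rU _ _ _ e.
+ by rewrite /= i'N iN.
+ by apply: wb => //=; rewrite i'N iN.
+ by eexists _, _; split; [exact: b0| |reflexivity]; exists c, u1.
+ by eexists _, _; split; [exact: q0| |reflexivity]; eexists _, _; split; [exact: r0|exact: c2|].
have rU' : red [:: i.+1, i & unfold w] by case/andP: rU.
have [||||e2 {}e] := Ycell_uniq i'N _ rU' _ _ _ e.
+ by rewrite /= iN.
+ by apply: wb => //=; rewrite iN.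
+ by exists c, u1.
+ by eexists _, _; split; [exact: r0|exact: c2|].
have rU'' : red [:: i & unfold w] by case/andP: rU'.
have [|_ e3] := Ycell_uniq iN Ult rU'' _ c1 c2 e; first by apply: wb => //; exact: ltnW.
have ac : a = c by move: e1; rewrite e2 mulrAC divff ?mul1r // gt_eqF.
exists (sq2 * a), u1; split => //.
- by rewrite mulr_gt0 ?sq2_gt0.
- apply: IH => //; last by rewrite {2}e3.
  by case/andP: rU''.
rewrite /Gy ltnNge h /= (negPf (introN eqP h2)) eu.
have s0 : sq2 != 0 by rewrite gt_eqF ?sq2_gt0.
rewrite [sq2 * a / _]mulrAC divff // mul1r mulrA sq2_sqr mulr_natl mulr2n.
by rewrite (_ : a + a = b) ?e2 -?ac // -!mulmxA.
Qed.

End Fold.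

(** * Signed permutations and unfolded words *)

Section Weyl.
Variable n : nat.
Local Notation T := ('I_n * bool)%type.
Implicit Types (p q : T) (w : seq 'I_n).

(** Signed indices placed on a line of N points symmetric under r |-> N - 1 -
r; for odd N the middle point is left out. *)
Definition pos (N : nat) p : nat := if p.2 then p.1 : nat else (N - 1 - p.1)%N.
Definition neg p : T := (p.1, ~~ p.2).
(** The reflection exchanging [p] with [q], hence also their opposites. *)
Definition refl p q : {perm T} :=
  (if q == neg p then tperm p q else tperm p q * tperm (neg p) (neg q))%g.
(** The simple reflection [i] exchanges [(i, true)] with [next i], its
successor on the line. *)
Definition next (i : 'I_n) : T := if (i.+1 < n)%N then (ordS i, true) else (i, false).

Lemma negK : involutive neg. Proof. by case=> i []. Qed.

Lemma simple_refl i : simple_reflection i = refl (i, true) (next i).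
Proof.
rewrite /simple_reflection /refl /next; case: ifP => iN; last by rewrite eqxx.
by rewrite ifN // xpair_eqE andbF.
Qed.

Lemma neg_neq p : neg p != p.
Proof. by case: p => i []; rewrite /neg xpair_eqE andbF. Qed.

Lemma refl_swap p q : refl (neg q) (neg p) = refl p q.
Proof.
rewrite /refl !negK (eq_sym (neg p)) (_ : (q == neg p) = (p == neg q)); last first.
  by rewrite -[q == _](inj_eq (can_inj negK)) negK eq_sym.
case: eqVneq => [->|npq]; first by rewrite negK tpermC.
rewrite (tpermC (neg q)) (tpermC q).
have e : (tperm (neg p) (neg q) ^ tperm p q)%g = tperm (neg p) (neg q).
  rewrite tpermJ; case: (eqVneq p q) => [->|ne]; first by rewrite !tperm1.
  have npq' : q != neg p by rewrite -(inj_eq (can_inj negK)) negK eq_sym.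
  by rewrite !tpermD // eq_sym neg_neq.
by rewrite -{1}e conjgE tpermV -!mulgA tperm2 mulg1.
Qed.

Lemma simple_pos (N : nat) (i : 'I_n) p : N = (2 * n)%N ->
  pos N (simple_reflection i p) =
  if (i.+1 < n)%N then swapn (N - 2 - i) (swapn i (pos N p)) else swapn i (pos N p).
Proof.
move=> Nn; rewrite /simple_reflection; case: p => j b.
have jn := ltn_ord j; have iltn := ltn_ord i.
case: ifP => h.

  rewrite permM; case: (tpermP (i, true)) => [[-> ->]|[-> ->]|/eqP n1 /eqP n2].
  - rewrite tpermD ?xpair_eqE ?andbF // /pos /= modn_small // swapnl swapn_id //; lia.
  - rewrite tpermD ?xpair_eqE ?andbF // /pos /= modn_small // swapnr swapn_id //; lia.
  case: tpermP => [[-> ->]|[-> ->]|/eqP n3 /eqP n4].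
  - rewrite /pos /= modn_small // (@swapn_id i); try lia.
    by rewrite /swapn; do ![case: ifP]; lia.
  - rewrite /pos /= modn_small // (@swapn_id i); try lia.
    by rewrite /swapn; do ![case: ifP]; lia.
  move: n1 n2 n3 n4; rewrite !xpair_eqE -!(inj_eq (@ord_inj n)) /= modn_small // /pos /=.
  by case: b => /=; rewrite ?andbT ?andbF => *; rewrite /swapn; do ![case: ifP]; lia.
case: tpermP => [[-> ->]|[-> ->]|/eqP n1 /eqP n2].
- by rewrite /pos /= /swapn; do ![case: ifP]; lia.
- by rewrite /pos /= /swapn; do ![case: ifP]; lia.
move: n1 n2; rewrite !xpair_eqE -!(inj_eq (@ord_inj n)) /= /pos /=.
by case: b => /=; rewrite ?andbT ?andbF => *; rewrite /swapn; do ![case: ifP]; lia.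
Qed.

Lemma pos_inj N : (2 * n <= N)%N -> injective (pos N).
Proof.
move=> Nn [i b] [j c]; have := ltn_ord i; have := ltn_ord j; rewrite /pos /=.
case: b; case: c => jn iltn h; try (by lia); by congr (_, _); apply: ord_inj; lia.
Qed.

Lemma simple_invol (i : 'I_n) : (simple_reflection i * simple_reflection i = 1)%g.
Proof.
apply/permP => p; rewrite permM perm1; apply: (@pos_inj (2 * n)%N) => //.
have E := fun q => @simple_pos (2 * n)%N i q erefl; rewrite E E.
case h: (i.+1 < n)%N; last by rewrite swapnK.
by rewrite swapnC ?swapnK ?swapnK //; lia.
Qed.

Lemma neg_pos N p : N = (2 * n)%N -> pos N (neg p) = (N - 1 - pos N p)%N.
Proof. by move=> Nn; case: p => i b; have := ltn_ord i; case: b; rewrite /pos /=; lia. Qed.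

Lemma simple_neg (i : 'I_n) p : simple_reflection i (neg p) = neg (simple_reflection i p).
Proof.
apply: (@pos_inj (2 * n)%N) => //.
rewrite neg_pos // !simple_pos // neg_pos //.
have : (pos (2 * n) p < 2 * n)%N.
  by case: p => j b; have := ltn_ord j; case: b; rewrite /pos /=; lia.
move: (pos _ p) => r; have := ltn_ord i.
by case: ifP => h h2 h3; rewrite /swapn; do ![case: ifP]; lia.
Qed.

Lemma weyl_cons i w : weyl_elt (i :: w) = (simple_reflection i * weyl_elt w)%g.
Proof. by rewrite /weyl_elt big_cons. Qed.

Lemma weyl_neg w p : weyl_elt w (neg p) = neg (weyl_elt w p).
Proof.
elim: w p => [|i w IH] p; first by rewrite /weyl_elt big_nil !perm1.
by rewrite weyl_cons !permM simple_neg IH.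
Qed.

Lemma reflJ (s : {perm T}) p q : (forall r, s (neg r) = neg (s r)) ->
  (refl p q ^ s = refl (s p) (s q))%g.
Proof.
move=> sn; rewrite /refl -sn (inj_eq perm_inj); case: eqP => _.
  exact: tpermJ.
by rewrite conjMg !tpermJ !sn.
Qed.

Local Notation po := (pos (2 * n)).

(** A simple reflection reverses the order of a single pair, up to signs. *)
Lemma simple_flip i p q : (po p < po q)%N ->
  (po (simple_reflection i q) < po (simple_reflection i p))%N ->
  refl p q = simple_reflection i.
Proof.
rewrite !simple_pos // simple_refl => lt1.
have hn : (po (next i) = i.+1 /\ po (i, true) = i)%N.
  split=> //; rewrite /next; have := ltn_ord i.
  by case: ifP => h; rewrite /pos /= ?modn_small //; lia.
have [hn1 hn2] := hn.
(* the reversed pair is (i, next i) or its opposite *)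
suff H : (po p = i /\ po q = i.+1) \/ (po p = 2 * n - 2 - i /\ po q = 2 * n - 1 - i)%N ->
   refl p q = refl (i, true) (next i).
  case: ifP => h lt2; apply: H; have := ltn_ord i; move: lt2; rewrite /swapn;
  do ![case: ifP]; lia.
case=> -[hp hq].
  by congr (refl _ _); apply: (@pos_inj (2 * n)%N) => //; rewrite ?hn1 ?hn2.
rewrite -refl_swap; congr (refl _ _); apply: (@pos_inj (2 * n)%N) => //;
  rewrite neg_pos // ?hn1 ?hn2; have := ltn_ord i; lia.
Qed.

(** Follow the pair [p], [q] along the word: at the letter that reverses it,
the conjugated reflection is that simple reflection, and the letter cancels. *)
Lemma deletion w p q : (po p < po q)%N -> (po (weyl_elt w q) < po (weyl_elt w p))%N ->
  exists x, (size x).+1 = size w /\ weyl_elt x = (refl p q * weyl_elt w)%g.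
Proof.
elim: w p q => [|i w IH] p q lt1; first by rewrite /weyl_elt big_nil !perm1; lia.
rewrite weyl_cons !permM => lt2.
case: (ltngtP (po (simple_reflection i p)) (po (simple_reflection i q))) => h.
- have [x [sx ex]] := IH _ _ h lt2.
  exists (i :: x); split; first by rewrite /= sx.
  rewrite weyl_cons ex -reflJ; last exact: simple_neg.
  rewrite conjgE !mulgA; congr (_ * _)%g.
  have -> : ((simple_reflection i)^-1 = simple_reflection i)%g.
    by apply/eqP; rewrite eq_sym eq_mulgV1 invgK simple_invol.
  by rewrite simple_invol mul1g.
- exists w; split => //.
  by rewrite (simple_flip lt1 h) mulgA simple_invol mul1g.
- move/(@pos_inj (2 * n)%N (leqnn _))/perm_inj: h => e.
  by move: lt1; rewrite e ltnn.
Qed.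

Lemma po_next i : (po (i, true) < po (next i))%N.
Proof.
rewrite /next; have := ltn_ord i.
by case: ifP => h; rewrite /pos /= ?modn_small //; lia.
Qed.

Lemma deletion_simple w i : (po (weyl_elt w (next i)) < po (weyl_elt w (i, true)))%N ->
  exists x, (size x).+1 = size w /\ weyl_elt x = weyl_elt (i :: w).
Proof. by move/(deletion (po_next i)); rewrite -simple_refl -weyl_cons. Qed.

Lemma reduced_cons i w : reduced_word (i :: w) -> reduced_word w /\
  (po (weyl_elt w (i, true)) < po (weyl_elt w (next i)))%N.
Proof.
move=> ri; split=> [w' e|].
  by have := ri (i :: w'); rewrite !weyl_cons e => /(_ erefl).
case: ltngtP => //.
  case/deletion_simple => x [sx ex]; have := ri x ex; rewrite /= -sx; lia.
move/(@pos_inj (2 * n)%N (leqnn _))/perm_inj/(congr1 po) => e.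
by have := po_next i; rewrite e ltnn.
Qed.

(** Otherwise prepending [i] would give a longer reduced word. *)
Lemma longest_desc w i : longest_reduced_word w ->
  (po (weyl_elt w (next i)) < po (weyl_elt w (i, true)))%N.
Proof.
case=> rw mw; case: ltngtP => //; last first.
  move/(@pos_inj (2 * n)%N (leqnn _))/perm_inj/(congr1 po) => e.
  by have := po_next i; rewrite e ltnn.
move=> asc; suff /mw : reduced_word (i :: w) by rewrite /= ltnn.
have sn : simple_reflection i (next i) = (i, true) /\ simple_reflection i (i, true) = next i.
  rewrite simple_refl /refl; case: eqP => h; first by rewrite tpermR tpermL.
  rewrite !permM tpermR tpermL /next; case: ifP => iN.
    by rewrite !tpermD ?xpair_eqE ?andbF.
  by case: h; rewrite /next iN.
move=> w' e.
have : (po (weyl_elt w' (next i)) < po (weyl_elt w' (i, true)))%N.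
  by rewrite e weyl_cons !permM; have [-> ->] := sn.
case/deletion_simple => x [sx]; rewrite weyl_cons e weyl_cons mulgA simple_invol mul1g.
by move/rw; rewrite /= -sx.
Qed.

Variable N : nat.
Hypothesis Nn : N = (2 * n)%N \/ N = (2 * n + 1)%N.
Local Notation unf w := (unfold N n (map (@nat_of_ord n) w)).

Lemma wfun_cat u v r : wfun (u ++ v) r = wfun v (wfun u r).
Proof. by elim: u r => //= i u IH r; rewrite IH. Qed.

(** Unfolding is compatible with the placement of signed indices on the line. *)
Lemma wfun_unfold w p : wfun (unf w) (pos N p) = pos N (weyl_elt w p).
Proof.
elim: w p => [|i w IH] p; first by rewrite /weyl_elt big_nil perm1.
rewrite /= unfold_cons wfun_cat weyl_cons permM -IH; congr (wfun _ _).
have iltn := ltn_ord i.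
have pE q : pos N q = if (po q < n)%N then po q else (po q + (N - 2 * n))%N.
  by case: q => j [] /=; have := ltn_ord j; rewrite /pos /=; case: ifP; lia.
have plt : (po p < 2 * n)%N.
  by case: p => j b; have := ltn_ord j; case: b; rewrite /pos /=; lia.
rewrite !pE simple_pos // /uletter; move: (po p) plt => r rlt.
case: (ltnP i.+1 n) => h; last case: eqP => h2.
- by rewrite /= /swapn; do ![case: ifP]; lia.
- by rewrite /= /swapn; do ![case: ifP]; lia.
have e : (N = 2 * n + 1 /\ i.+1 = n)%N by lia.
case: e => -> e.
by rewrite /= /swapn; do ![case: ifP]; lia.
Qed.

(** For odd N the middle point, which carries no signed index, is fixed. *)
Lemma wfun_mid w : N = (2 * n + 1)%N -> wfun (unf w) n = n.
Proof.
move=> N1; elim: w => //= i w IH; rewrite unfold_cons wfun_cat.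
rewrite (_ : wfun _ n = n) // /uletter; have := ltn_ord i.
case: (ltnP i.+1 n) => h; last case: eqP => h2; rewrite /= ?/swapn; last by do ![case: ifP]; lia.
  by do ![case: ifP]; lia.
by do ![case: ifP]; lia.
Qed.

Lemma po_le p q : (po p < po q)%N = (pos N p < pos N q)%N.
Proof.
by case: p q => i b [j c]; have := ltn_ord i; have := ltn_ord j;
  case: b; case: c; rewrite /pos /=; lia.
Qed.

Lemma pos_sum w p : (pos N (weyl_elt w (neg p)) = N - 1 - pos N (weyl_elt w p))%N.
Proof.
rewrite weyl_neg; case: (weyl_elt w p) => i b; have := ltn_ord i.
by case: b; rewrite /pos /=; lia.
Qed.

Lemma pos_lt p : (pos N p < N)%N.
Proof. by case: p => j b; have := ltn_ord j; case: b; rewrite /pos /=; lia. Qed.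

Lemma wfun_sum w r : (r < N)%N -> wfun (unf w) (N - 1 - r) = (N - 1 - wfun (unf w) r)%N.
Proof.
move=> rN; case: (ltnP r n) => h.
  have -> : r = pos N (Ordinal h, true) by [].
  rewrite (_ : (_ - _)%N = pos N (neg (Ordinal h, true))) //.
  by rewrite !wfun_unfold pos_sum.
case: (ltnP (N - 1 - r) n) => h2.
  have -> : r = pos N (Ordinal h2, false) by rewrite /pos /=; lia.
  rewrite (_ : (_ - _)%N = pos N (neg (Ordinal h2, false))); last by rewrite /pos /=; lia.
  by rewrite !wfun_unfold pos_sum.
have N1 : N = (2 * n + 1)%N by lia.
have -> : r = n by lia.
by rewrite (_ : N - 1 - n = n)%N ?wfun_mid //; lia.
Qed.

(** Each letter of a reduced word creates inversions; after unfolding it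
creates them one at a time: a symmetric pair of them, or for the last letter
one or three around the middle, according to the parity of N. *)
Lemma reduced_unfold w : reduced_word w -> red (unf w).
Proof.
elim: w => //= i w IH /reduced_cons[/IH r1]; rewrite po_le -!wfun_unfold.
rewrite unfold_cons /uletter /next; have iltn := ltn_ord i.
case: (ltnP i.+1 n) => h; last case: eqP => h2.
- rewrite {1 2}/pos /= modn_small // => asc.
  rewrite r1 andbT.
  have e : (N - 2 - i = N - 1 - i.+1)%N by lia.
  have e' : ((N - 2 - i).+1 = N - 1 - i)%N by lia.
  rewrite !swapn_id; try lia.
  rewrite asc e' e !wfun_sum; try lia.
  have := pos_lt (weyl_elt w (ordS i, true)); rewrite -wfun_unfold /pos /= modn_small //; lia.
- rewrite {1 2}/pos /= r1 andbT.
  by rewrite (_ : N - 1 - i = i.+1)%N //; lia.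
have N1 : N = (2 * n + 1)%N by lia.
have iE : i.+1 = n by lia.
rewrite {1 2}/pos /= r1 andbT => asc.
have e : (N - 1 - i = i.+2)%N by lia.
rewrite e in asc.
have := @wfun_sum w i; rewrite e.
have m1 : wfun (unf w) i.+1 = n by rewrite iE wfun_mid.
move: asc m1 => + m1 m2.
have := pos_lt (weyl_elt w (i, true)); rewrite -wfun_unfold /pos /= => m3.
rewrite (@swapn_id i.+1 i); try lia.
rewrite !swapnl swapnr (@swapn_id i i.+2); try lia.
Qed.

(** All simple reflections are descents of the longest element, and symmetry
of the line gives the descents on its second half. *)
Lemma longest_unfold w : longest_reduced_word w ->
  red (unf w) /\ alldesc N (unf w).
Proof.
move=> lw; split; first by apply: reduced_unfold; case: lw.
suff H j : (j.+1 < N)%N -> (j.+1 + j < N)%N -> (wfun (unf w) j.+1 < wfun (unf w) j)%N.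
  move=> j jN; case: (ltnP (j.+1 + j) N) => h; first exact: H.
  have := H (N - 1 - j.+1)%N; rewrite (_ : (N - 1 - j.+1).+1 = N - 1 - j)%N; last lia.
  have a1 : (N - 1 - j < N)%N by lia.
  have a2 : (N - 1 - j + (N - 1 - j.+1) < N)%N by lia.
  move/(_ a1 a2); rewrite !wfun_sum; try lia.
move=> jN jj.
have jn : (j < n)%N by lia.
have := longest_desc (Ordinal jn) lw; rewrite po_le -!wfun_unfold /next /=.
case: (ltnP j.+1 n) => h.
  by rewrite /pos /= modn_small.
rewrite /pos /=; case: Nn => N1; first by rewrite (_ : N - 1 - j = j.+1)%N //; lia.
have := @wfun_sum w j.
rewrite (_ : N - 1 - j = j.+2)%N; last lia.
have m1 : wfun (unf w) j.+1 = n by rewrite (_ : j.+1 = n) ?wfun_mid //; lia.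
by rewrite m1; lia.
Qed.

End Weyl.

(** * Initial columns of matrices in the longest cell *)

Lemma incr_id (k : nat) (h : 'I_k -> 'I_k) : incr h -> h =1 id.
Proof.
move=> hi i; apply: ord_inj; apply/eqP; rewrite eqn_leq incr_ge // andbT.
have hi' : incr (fun j => rev_ord (h (rev_ord j))).
  move=> a b ab /=; have := hi (rev_ord b) (rev_ord a) => /=.
  have := ltn_ord a; have := ltn_ord b; have := ltn_ord (h (rev_ord a)).
  have := ltn_ord (h (rev_ord b)); lia.
have := incr_ge hi' (rev_ord i); rewrite rev_ordK /=.
by have := ltn_ord i; have := ltn_ord (h i); lia.
Qed.

Section UnitCols.
Variables (R : realType) (N k : nat).

(** Columns of the identity matrix, used to select columns by multiplication. *)
Definition ucols (g : 'I_k -> 'I_N) : 'M[R]_(N, k) := \matrix_(i, j) (i == g j)%:R.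

Lemma ucols_nn g : incr g -> nnmat (ucols g).
Proof.
move=> gi f fi.
case: (boolP [forall i, exists j, f i == g j]) => [/forallP fg|]; last first.
  rewrite negb_forall => /existsP[i]; rewrite negb_exists => /forallP ni.
  rewrite (@det_row0 _ _ _ i) ?lexx //; apply/rowP => j.
  by rewrite !mxE (negPf (ni j)).
have h_ex i : {j | f i == g j} by apply/sigW/existsP/fg.
pose h i := sval (h_ex i); have hE i : f i = g (h i) by apply/eqP; exact: (svalP (h_ex i)).
have hi : incr h.
  by move=> i j /fi; rewrite !hE ltnNge (incr_leq gi) -ltnNge.
suff -> : rowsub f (ucols g) = 1%:M by rewrite det1 ler01.
apply/matrixP => i j; rewrite !mxE hE (incr_id hi).
by rewrite (inj_eq (incr_inj gi)).
Qed.

Lemma ucols_diag g : injective g -> \det (rowsub g (ucols g)) = 1.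
Proof.
move=> gi; suff -> : rowsub g (ucols g) = 1%:M by rewrite det1.
by apply/matrixP => i j; rewrite !mxE (inj_eq gi).
Qed.

End UnitCols.

Section Unilower.
Variables (R : realType) (N : nat).

Lemma unilower_mul (A B : 'M[R]_N) : unilower A -> unilower B -> unilower (A *m B).
Proof.
move=> [la da] [lb db]; split=> [r s rs|r]; rewrite mxE.
  rewrite big1 // => j _; case: (ltnP r j) => rj; first by rewrite la ?mul0r.
  by rewrite lb ?mulr0 //; apply: leq_ltn_trans rj rs.
rewrite (bigD1 r) //= da db mulr1 big1 ?addr0 // => j jr.
case: (ltngtP r j) => rj; [by rewrite la ?mul0r|by rewrite lb ?mulr0|].
by case/eqP: jr; apply: ord_inj.
Qed.

Lemma unilower1 : unilower (1%:M : 'M[R]_N).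
Proof.
split=> [r s rs|r]; rewrite mxE ?eqxx //.
by case: eqP => // e; move: rs; rewrite e ltnn.
Qed.

Lemma unilower_Y i a : unilower (Y N i a : 'M[R]_N).
Proof.
split=> [r s rs|r]; rewrite !mxE.
  rewrite (_ : (r == s) = false); last by apply/eqP => e; move: rs; rewrite e ltnn.
  by rewrite (_ : _ && _ = false) ?mulr0 ?addr0 //; apply/negP => /andP[/eqP ? /eqP ?]; lia.
by rewrite eqxx (_ : _ && _ = false) ?mulr0 ?addr0 //; apply/negP => /andP[/eqP ? /eqP ?]; lia.
Qed.

Lemma Ycell_unilower v (u : 'M[R]_N) : Ycell v u -> unilower u.
Proof.
elim: v u => [|i v IH] u /=; first by move=> ->; exact: unilower1.
by move=> [a [u' [_ /IH c ->]]]; apply: unilower_mul => //; exact: unilower_Y.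
Qed.

Definition lcols k (u : 'M[R]_N) : 'M[R]_(N, k) := \matrix_(i, j) ent u i j.

Lemma lcolsE k (kN : (k <= N)%N) u : lcols k u = u *m ucols R (widen_ord kN).
Proof.
apply/matrixP => i j; rewrite !mxE (bigD1 (widen_ord kN j)) //= !mxE eqxx mulr1.
rewrite big1 ?addr0; last by move=> l /negPf lj; rewrite mxE lj mulr0.
by rewrite -entE.
Qed.

Lemma widen_incr k (kN : (k <= N)%N) : incr (widen_ord kN). Proof. by []. Qed.

End Unilower.

Section LongestCell.
Variables (R : realType) (N n : nat).
Hypothesis Nn : N = (2 * n)%N \/ N = (2 * n + 1)%N.

(** Descents force w(r) + r <= N - 1 when read from the left and the opposite
inequality when read from the right. *)
Lemma alldesc_rev w : all (fun i => i.+1 < N)%N w -> alldesc N w ->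
  forall r, wfun w r = if (r < N)%N then (N - 1 - r)%N else r.
Proof.
move=> wN dw r; case: ifP => rN; last first.
  elim: w wN {dw} r rN => //= i w IH /andP[iN wN] r rN.
  by rewrite swapn_id ?IH //; lia.
have up : forall r, (r < N)%N -> (wfun w r + r <= N - 1)%N.
  elim=> [|s IH] sN; first by have := wfun_lt wN sN; lia.
  by have := IH (ltnW sN); have := dw s sN; lia.
have down : forall m, (m < N)%N -> (m <= wfun w (N - 1 - m))%N.
  elim=> // m IH mN; have := IH (ltnW mN).
  have := dw (N - 1 - m.+1)%N; rewrite (_ : (N - 1 - m.+1).+1 = N - 1 - m)%N; last lia.
  by lia.
have := up r rN; have := down (N - 1 - r)%N.
by rewrite (_ : N - 1 - (N - 1 - r) = r)%N; lia.
Qed.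

Lemma Gcell_Ycell v (u : 'M[R]_N) : all (fun i => i < n)%N v -> Gcell n v u ->
  Ycell (unfold N n v) u.
Proof.
elim: v u => //= i v IH u /andP[iltn vlt] [a [u' [a0 /(IH _ vlt) c ->]]].
rewrite unfold_cons /uletter /Gy.
case: (ltnP i.+1 n) => h; [|case: eqP => h2].
- exists a, (Y N (N - 2 - i) a *m u'); split=> //; last by rewrite mulmxA.
  by exists a, u'.
- by exists a, u'.
have s0 : 0 < Num.sqrt 2 :> R := sq2_gt0 R.
exists (a / Num.sqrt 2), (Y N i.+1 (Num.sqrt 2 * a) *m (Y N i (a / Num.sqrt 2) *m u')).
split; rewrite ?divr_gt0 -?mulmxA //.
exists (Num.sqrt 2 * a), (Y N i (a / Num.sqrt 2) *m u').
split; rewrite ?mulr_gt0 //.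
by exists (a / Num.sqrt 2), u'; split; rewrite ?divr_gt0.
Qed.

(** In the three-factor case the braid relation applied to the symmetric
parameters gives the flipped product. *)
Lemma sigma_Gy i (a : R) : (i < n)%N -> 0 < a ->
  sigma_rel (Gy N n i a) (Gy N n i a).
Proof.
move=> ilt a0; rewrite /Gy; case: (ltnP i.+1 n) => h; [|case: eqP => h2].
- have e : Y N i a *m Y N (N - 2 - i) a = Y N (N - 2 - i) a *m Y N i a.
    by have := @Y_comm R N N i (N - 2 - i)%N a a 1%:M; rewrite !mulmx1; apply; lia.
  rewrite {2}e; apply: sigma_mul; apply: (sigma_Y_pair Nn); lia.
- by apply: (sigma_Y_pair Nn); lia.
have s0 := sq2_gt0 R; have ss := sq2_sqr R.
set s := Num.sqrt 2 in s0 ss *.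
have sn0 : s != 0 by rewrite gt_eqF.
have as0 : 0 < a / s by rewrite divr_gt0.
have ps : a / s + a / s = s * a.
  by apply: (mulIf sn0); rewrite mulrDl divfK // mulrAC ss mulr_natl mulr2n.
have q : s * a * (a / s) / (a / s + a / s) = a / s.
  by rewrite ps mulrAC divff ?mul1r // mulf_neq0 // gt_eqF.
have q' : a / s * (s * a) / (a / s + a / s) = a / s by rewrite [a / s * _]mulrC.
have := @Y_braid R N N i i.+1 (a / s) (s * a) (a / s) 1%:M.
rewrite q q' ps !mulmx1 eqxx => /(_ isT as0 (mulr_gt0 s0 a0) as0) e.
rewrite {2}e; apply: sigma_mul; last apply: sigma_mul; apply: (sigma_Y_pair Nn); lia.
Qed.

Lemma Gcell_sigma v (u : 'M[R]_N) : all (fun i => i < n)%N v -> Gcell n v u ->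
  sigma_rel u u.
Proof.
elim: v u => [|i v IH] u /=; first by move=> _ ->; exact: sigma1.
move=> /andP[iltn vlt] [a [u' [a0 /(IH _ vlt) c ->]]].
by apply: sigma_mul => //; apply: sigma_Gy.
Qed.

Variable w : seq 'I_n.
Hypothesis lw : longest_reduced_word w.
Let wn := map (@nat_of_ord n) w.
Let U := unfold N n wn.

Lemma wn_lt : all (fun i => i < n)%N wn.
Proof. by apply/allP => x /mapP[i _ ->]. Qed.

Lemma red_longest : red U. Proof. by case: (longest_unfold Nn lw). Qed.
Lemma desc_longest : alldesc N U. Proof. by case: (longest_unfold Nn lw). Qed.

Lemma nev_wfun : wfun (nevw 0 N.-1) =1 wfun U.
Proof.
move=> r; rewrite (alldesc_rev (unfold_lt Nn wn_lt) desc_longest).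
have [_ ->] := nevwP N.-1 0; do ![case: ifP]; lia.
Qed.

Lemma Ycell_lcols_pos k (u : 'M[R]_N) : (k <= N)%N -> Ycell U u -> posmat (lcols k u).
Proof.
move=> kN cu; rewrite (lcolsE kN); apply: (Ycell_pos red_longest desc_longest cu).
  by apply: ucols_nn; exact: widen_incr.
move=> f f0; rewrite (_ : f = widen_ord kN).
  by rewrite ucols_diag ?ltr01 //; apply: incr_inj; exact: widen_incr.
by apply/funext => i; apply: ord_inj; rewrite f0.
Qed.

(** Neville elimination yields a factorization along one reduced word of the
longest permutation, which is transported to the unfolding of [w] and then
folded. *)
Lemma Gcell_of_solid (u : 'M[R]_N) : (0 < n)%N -> unilower u -> sigma_rel u u ->
  (forall i k, (i + k < N)%N -> 0 < solid u i 0 k.+1) -> Gcell n wn u.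
Proof.
move=> n0 uu su pos; apply: fold_cell => //; first exact: wn_lt.
  exact: red_longest.
have c : Ycell (nevw 0 N.-1) u.
  by apply: neville => //; [lia | move=> i k _; exact: pos].
apply: (Ycell_indep _ red_longest nev_wfun c).
by case: (nevwP N.-1 0).
Qed.

End LongestCell.

(** * Complementary minors and the cell of the isometry group *)

Lemma unilower_det (R : realType) N (u : 'M[R]_N) : unilower u -> \det u = 1.
Proof.
move=> [lo di]; rewrite det_trig; first by apply: big1 => i _; rewrite di.
by apply/is_trig_mxP => i j; exact: lo.
Qed.

Section Jacobi.
Variables (R : realType) (k l : nat).
Local Notation N := (k + l)%N.
Local Notation J := (altform R N).

(** Jacobi's complementary minor theorem: up to sign, a minor of a matrix of
determinant 1 is the complementary minor of its inverse, and the inverse of an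
isometry is its transpose conjugated by J. The sign is not computed: what
matters is that the constant is the same for all isometries. *)
Lemma jacobi (p : 'I_N -> 'I_N) (f : 'I_k -> 'I_N) (g : 'I_l -> 'I_N) :
  injective p -> (forall a, p (lshift l a) = f a) ->
  (forall b, p (rshift k b) = rev_ord (g (rev_ord b))) ->
  exists c : R, forall u : 'M[R]_N, unilower u -> sigma_rel u u ->
    \det (rowsub f (lcols k u)) = c * \det (rowsub g (lcols l u)).
Proof.
move=> pinj pf pg.
pose P : 'M[R]_N := rowsub p 1%:M.
pose S : 'M[R]_l := rowsub (@rev_ord l) 1%:M.
pose e : R := (-1) ^+ N.-1.
pose al : 'rV[R]_l := \row_a (e * (-1) ^+ (rshift k a)).
pose be : 'rV[R]_l := \row_b ((-1) ^+ (rev_ord (p (rshift k b)))).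
exists (\det P * (\det (diag_mx be) * \det S * \det S * \det (diag_mx al))) => u uu su.
(* the inverse of u *)
pose v := e *: (J *m u^T *m J).
have uv : u *m v = 1%:M.
  apply: mulmx1C; rewrite /v -scalemxAl -!mulmxA (mulmxA u^T) su altform_sqr.
  by rewrite scalerA -exprD addnn -muln2 exprM sqrr_sign scale1r.
have PE m (X : 'M[R]_(N, m)) : P *m X = rowsub p X.
  apply/matrixP => i j; rewrite !mxE (bigD1 (p i)) //= !mxE eqxx mul1r.
  by rewrite big1 ?addr0 // => s /negPf si; rewrite !mxE eq_sym si mul0r.
have PPT : P *m P^T = 1%:M.
  by apply/matrixP => i j; rewrite PE !mxE eq_sym (inj_eq pinj).
pose M := P *m u; pose V := v *m P^T.
have MV : M *m V = 1%:M by rewrite /M /V mulmxA -(mulmxA P) uv mulmx1 PPT.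
have blk : M *m block_mx 1%:M (ursubmx V) 0 (drsubmx V) =
           block_mx (ulsubmx M) 0 (dlsubmx M) 1%:M.
  have := MV; rewrite -{1}[M]submxK -{1}[V]submxK mulmx_block scalar_mx_block.
  move=> /eq_block_mx[_ ur _ dr].
  rewrite -{1}[M]submxK mulmx_block !mulmx1 !mulmx0 !addr0.
  by rewrite ur dr.
have detM : \det M = \det P by rewrite /M det_mulmx (unilower_det uu) mulr1.
have -> : rowsub f (lcols k u) = ulsubmx M.
  apply/matrixP => a b; rewrite /M PE !mxE pf -entE; congr (ent _ _ _).
have -> : \det (ulsubmx M) = \det P * \det (drsubmx V).
  have := congr1 determinant blk.
  by rewrite det_mulmx det_ublock det_lblock !det1 mul1r mulr1 detM => ->.
rewrite -[RHS]mulrA; congr (_ * _).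
have SE m (X : 'M[R]_(l, m)) : S *m X = rowsub (@rev_ord l) X.
  apply/matrixP => i j; rewrite !mxE (bigD1 (rev_ord i)) //= !mxE eqxx mul1r.
  by rewrite big1 ?addr0 // => s /negPf si; rewrite !mxE eq_sym si mul0r.
have XS (X : 'M[R]_l) i j : (X *m S) i j = X i (rev_ord j).
  rewrite mxE (bigD1 (rev_ord j)) //= !mxE rev_ordK eqxx mulr1.
  rewrite big1 ?addr0 // => s sj; rewrite !mxE (_ : (rev_ord s == j) = false) ?mulr0 //.
  by apply: contra_neqF sj => /eqP <-; rewrite rev_ordK.
suff -> : drsubmx V = (diag_mx be *m (S *m rowsub g (lcols l u) *m S) *m diag_mx al)^T.
  by rewrite det_tr !det_mulmx; ring.
have VE r c : V r c = v r (p c).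
  rewrite mxE (bigD1 (p c)) //= big1 ?addr0; last first.
    by move=> s /negPf sb; rewrite !mxE eq_sym sb mulr0.
  by rewrite !mxE eqxx mulr1.
have eJ (A : 'M[R]_N) (i j : 'I_N) : (A *m J) i j = A i (rev_ord j) * (-1) ^+ (rev_ord j).
  have e1 : (rev_ord j + j).+1 = N by have := ltn_ord j; rewrite /=; lia.
  rewrite mxE (bigD1 (rev_ord j)) //= mxE e1 eqxx mulr1.
  rewrite big1 ?addr0 // => s sj; rewrite mxE (_ : ((s + j).+1 == N) = false) ?mulr0 //.
  by apply: contra_neqF sj => /eqP sj; apply: ord_inj => /=; lia.
have vE r c : v r c = e * ((-1) ^+ r * (u (rev_ord c) (rev_ord r) * (-1) ^+ (rev_ord c))).
  rewrite /v -mulmxA mxE (@altformE _ _ _ _ _ (rev_ord r)); last first.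
    by have := ltn_ord r; rewrite /=; lia.
  by rewrite eJ mxE.
apply/matrixP => a b; transitivity (V (rshift k a) (rshift k b)).
  by rewrite mxE mxE.
rewrite VE vE [RHS]mxE mul_mx_diag mxE mul_diag_mx mxE XS SE !mxE !pg !rev_ordK -entE /=.
have -> : (k + l - (k + a).+1 = l - a.+1)%N by lia.
by ring.
Qed.
End Jacobi.

Lemma solid_rowsub (R : realType) N k i (u : 'M[R]_N) (f : 'I_k -> 'I_N) :
  (forall a, f a = (i + a)%N :> nat) -> solid u i 0 k = \det (rowsub f (lcols k u)).
Proof.
move=> fE; congr (\det _); apply/matrixP => a b; rewrite !mxE.
by rewrite add0n -fE.
Qed.

Lemma jacobi_solid (R : realType) N k l i : N = (k + l)%N -> (i + k <= N)%N ->
  exists (g : 'I_l -> 'I_N) (c : R), incr g /\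
    forall u : 'M[R]_N, unilower u -> sigma_rel u u ->
    solid u i 0 k = c * \det (rowsub g (lcols l u)).
Proof.
move=> -> ik.
pose pn x := (if x < k then i + x else if x - k < i then x - k else x)%N.
have pn_lt (x : 'I_(k + l)) : (pn x < k + l)%N.
  by have := ltn_ord x; rewrite /pn; do ![case: ifP]; lia.
pose p x := Ordinal (pn_lt x).
have pinj : injective p.
  move=> x y /(congr1 (@nat_of_ord _)) /=; rewrite /pn => e; apply: ord_inj.
  by move: e; do ![case: ifP]; lia.
pose g (b : 'I_l) := rev_ord (p (rshift k (rev_ord b))).
have gi : incr g.
  move=> a b ab /=; have := ltn_ord a; have := ltn_ord b.
  by rewrite /pn; do ![case: ifP]; lia.
have [||c cE] := @jacobi R k l p (fun a => p (lshift l a)) g pinj.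
- by [].
- by move=> b; rewrite /g rev_ordK rev_ordK.
exists g, c; split => // u uu su; rewrite -cE //.
by apply: solid_rowsub => a; rewrite /= /pn ltn_ord.
Qed.

Section PositiveColumns.
Variables (R : realType) (N n : nat).
Hypothesis Nn : N = (2 * n)%N \/ N = (2 * n + 1)%N.
Hypothesis n0 : (0 < n)%N.
Variable w : seq 'I_n.
Hypothesis lw : longest_reduced_word w.
Let wn := map (@nat_of_ord n) w.

Lemma Gcell_exists v : all (fun i => i < n)%N v -> exists u : 'M[R]_N, Gcell n v u.
Proof.
elim: v => [|i v IH] /=; first by exists 1%:M.
by case/andP=> _ /IH[u cu]; exists (Gy N n i 1 *m u), 1, u.
Qed.

Lemma Gcell_pos k (u : 'M[R]_N) : (k <= N)%N -> Gcell n wn u -> posmat (lcols k u).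
Proof.
move=> kN cu; apply: (Ycell_lcols_pos Nn lw) => //.
by apply: Gcell_Ycell => //; exact: wn_lt.
Qed.

Lemma Gcell_unilower (u : 'M[R]_N) : Gcell n wn u -> unilower u.
Proof. by move/(Gcell_Ycell (wn_lt w)); exact: Ycell_unilower. Qed.

Lemma solid_pos_lcols k i (u : 'M[R]_N) : (i + k <= N)%N -> posmat (lcols k u) ->
  0 < solid u i 0 k.
Proof.
move=> ik pu.
have fN (a : 'I_k) : (i + a < N)%N by have := ltn_ord a; lia.
rewrite (@solid_rowsub _ _ _ _ _ (fun a => Ordinal (fN a))) //.
by apply: pu => a b ab /=; lia.
Qed.

(** Solid minors of size larger than n are, by [jacobi_solid], a constant
multiple of minors on at most n columns. The constant is positive since both
minors are positive for an element of the cell itself. *)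
Lemma Gcell_of_posmat (u : 'M[R]_N) : unilower u -> sigma_rel u u ->
  (forall k, (0 < k <= n)%N -> posmat (lcols k u)) -> Gcell n wn u.
Proof.
move=> uu su pos; apply: (Gcell_of_solid Nn lw n0) => // i k ik.
case: (leqP k.+1 n) => kn; first by apply: solid_pos_lcols; [lia | exact: pos].
have [| |g [c [gi cE]]] := @jacobi_solid R N k.+1 (N - k.+1) i; try lia.
have [u0 c0] := Gcell_exists (wn_lt w).
have c_gt0 : 0 < c.
  have := cE u0 (Gcell_unilower c0) (Gcell_sigma Nn (wn_lt w) c0).
  have p1 : 0 < solid u0 i 0 k.+1 by apply: solid_pos_lcols; [lia | apply: Gcell_pos => //; lia].
  have p2 : 0 < \det (rowsub g (lcols (N - k.+1) u0)) by apply: Gcell_pos => //; lia.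
  by move=> e; move: p1; rewrite e pmulr_lgt0.
rewrite cE // mulr_gt0 //; case: (posnP (N - k.+1)) => [e|l0].
  by move: g gi {cE}; rewrite e => g _; rewrite det_mx00 ltr01.
by apply: pos => //; lia.
Qed.
End PositiveColumns.

(** * Column spans *)

Section Colspan.
Variables (R : realType) (N : nat).

Lemma mulmx_sum_col k (A : 'M[R]_(N, k)) (c : 'cV[R]_k) :
  A *m c = \sum_j c j 0 *: col j A.
Proof.
apply/matrixP => i j; rewrite summxE mxE; apply: eq_bigr => l _.
by rewrite !mxE ord1 mulrC.
Qed.

Definition coltuple k (A : 'M[R]_(N, k)) : k.-tuple 'cV[R]_N := [tuple col j A | j < k].

Lemma coltupleE k (A : 'M[R]_(N, k)) : <<coltuple A>>%VS = colspan A.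
Proof. by []. Qed.

Lemma colspanP k (A : 'M[R]_(N, k)) (v : 'cV[R]_N) :
  (v \in colspan A) <-> exists c : 'cV[R]_k, v = A *m c.
Proof.
split=> [|[c ->]]; last first.
  rewrite mulmx_sum_col; apply: rpred_sum => j _; apply: rpredZ; apply: memv_span.
  by apply/mapP; exists j; rewrite ?mem_enum.
move=> vA; have : v \in <<coltuple A>>%VS by rewrite coltupleE.
move/coord_span => ->; exists (\col_i coord (coltuple A) i v).
rewrite mulmx_sum_col; apply: eq_bigr => i _.
by rewrite !mxE -tnth_nth tnth_mktuple.
Qed.

Lemma colspan_free k (A : 'M[R]_(N, k)) : free (coltuple A) <->
  forall c : 'cV[R]_k, A *m c = 0 -> c = 0.
Proof.
have E (c : 'I_k -> R) : \sum_(i < k) c i *: (coltuple A)`_i = A *m \col_i c i.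
  by rewrite mulmx_sum_col; apply: eq_bigr => i _; rewrite !mxE -tnth_nth tnth_mktuple.
split=> [/freeP fr c Ac|inj].
  apply/colP => i; rewrite mxE; apply: (fr (fun i => c i 0)).
  by rewrite E -Ac; congr (_ *m _); apply/colP => j; rewrite mxE.
apply/freeP => c; rewrite E => /inj /colP ci i.
by have := ci i; rewrite !mxE.
Qed.

Lemma rank_inj k (A : 'M[R]_(N, k)) : \rank A = k <->
  forall c : 'cV[R]_k, A *m c = 0 -> c = 0.
Proof.
rewrite -mxrank_tr; split=> [rA c Ac|inj].
  apply: trmx_inj; apply/eqP; rewrite trmx0.
  have rf : row_free A^T by apply/eqP.
  by rewrite -(mulmx_free_eq0 _ rf) -trmx_mul Ac trmx0.
apply/eqP; apply: inj_row_free => v vA; apply: trmx_inj; rewrite trmx0; apply: inj.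
by apply: trmx_inj; rewrite trmx_mul trmxK vA trmx0.
Qed.

Lemma dim_colspan k (A : 'M[R]_(N, k)) : \rank A = k <-> \dim (colspan A) = k.
Proof.
rewrite rank_inj -colspan_free /free size_tuple.
by split=> [/eqP e|e]; [exact: e | apply/eqP; exact: e].
Qed.

Lemma colspan_sub k l (A : 'M[R]_(N, k)) (B : 'M[R]_(N, l)) :
  (colspan A <= colspan B)%VS <-> exists C, A = B *m C.
Proof.
split=> [AB|[C ->]]; last first.
  apply/subvP => v /colspanP[c ->]; apply/colspanP; exists (C *m c).
  by rewrite mulmxA.
have ex j : exists c : 'cV[R]_l, col j A = B *m c.
  apply/colspanP; apply: (subvP AB); apply/colspanP; exists (delta_mx j 0).
  by rewrite colE.
have [c cE] := choice ex.
exists (\matrix_(i, j) c j i 0); apply/matrixP => i j.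
have /colP/(_ i) := cE j; rewrite !mxE => ->; apply: eq_bigr => s _.
by rewrite mxE.
Qed.

Lemma colspan_mul k l (A : 'M[R]_(N, k)) (C : 'M[R]_(k, l)) :
  (colspan (A *m C) <= colspan A)%VS.
Proof. by apply/colspan_sub; exists C. Qed.

Lemma colspan_unit k (A : 'M[R]_(N, k)) (C : 'M[R]_k) : C \in unitmx ->
  colspan (A *m C) = colspan A.
Proof.
move=> uC; apply/eqP; rewrite eqEsubv colspan_mul /=.
by apply/colspan_sub; exists (invmx C); rewrite mulmxK.
Qed.

Lemma colspan_eq k (A B : 'M[R]_(N, k)) : \rank A = k -> colspan A = colspan B ->
  exists2 C, C \in unitmx & A = B *m C.
Proof.
move=> rA eAB; have : (colspan A <= colspan B)%VS by rewrite eAB.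
case/colspan_sub => C AE; exists C => //.
rewrite -row_full_unit /row_full eqn_leq rank_leq_col /=.
by rewrite -{1}rA AE mxrankM_maxr.
Qed.

Lemma colspan_ex (L : {vspace 'cV[R]_N}) k : \dim L = k ->
  exists B : 'M[R]_(N, k), colspan B = L.
Proof.
move=> <-; exists (\matrix_(i, j) (tnth (vbasis L) j) i 0).
rewrite -[RHS](span_basis (vbasisP L)) -coltupleE; congr (span _); congr tval.
apply: eq_from_tnth => j; rewrite tnth_mktuple.
by apply/colP => i; rewrite !mxE.
Qed.

Lemma colspan_dim_rank k (A : 'M[R]_(N, k)) (L : {vspace 'cV[R]_N}) :
  colspan A = L -> \dim L = k -> \rank A = k.
Proof. by move=> <- /dim_colspan. Qed.

Lemma plucker_positiveP (L : {vspace 'cV[R]_N}) k : \dim L = k ->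
  plucker_positive L <-> exists B : 'M[R]_(N, k), colspan B = L /\ posmat B.
Proof. by move=> <-. Qed.

Lemma plucker_nonnegP (L : {vspace 'cV[R]_N}) k : \dim L = k ->
  plucker_nonneg L <-> exists B : 'M[R]_(N, k), colspan B = L /\ nnmat B.
Proof. by move=> <-. Qed.

Lemma isotropic_colspan k (J : 'M[R]_N) (A : 'M[R]_(N, k)) :
  isotropic J (colspan A) <-> A^T *m J *m A = 0.
Proof.
split=> [iso|h u v /colspanP[c ->] /colspanP[d ->]]; last first.
  by rewrite trmx_mul -!mulmxA (mulmxA J) (mulmxA A^T) (mulmxA A^T) h mul0mx mulmx0.
apply/matrixP => i j.
have ci l : col l A \in colspan A by apply/colspanP; exists (delta_mx l 0); rewrite colE.
have := iso _ _ (ci i) (ci j); rewrite !colE trmx_mul trmx_delta !mulmxA.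
rewrite -(mulmxA _ A^T) -(mulmxA _ (_ *m J)) -rowE -colE => /matrixP/(_ 0 0).
by move: (A^T *m J *m A) => M; rewrite !mxE.
Qed.

Lemma isotropicN (J : 'M[R]_N) L : isotropic (- J) L <-> isotropic J L.
Proof.
have H J' : isotropic J' L -> isotropic (- J') L.
  by move=> h u v uL vL; rewrite mulmxN mulNmx h ?oppr0.
by split=> /H //; rewrite opprK.
Qed.

Lemma flag_colspan n (K : {set 'I_n}) (A : 'M[R]_N) (k : {k | k \in K}) :
  (n <= N)%N -> flag_of K A k = colspan (lcols (val k).+1 A) :> {vspace _}.
Proof.
move=> le_rank_dim; apply: eq_span => v.
apply/mapP/mapP => [[j]|[j _ ->]].
  rewrite mem_filter => /andP[jk _] ->; exists (Ordinal jk); rewrite ?mem_enum //.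
  by apply/colP => i; rewrite !mxE /= entE.
have jN : (j < N)%N by have := ltn_ord j; have := ltn_ord (val k); lia.
exists (Ordinal jN); first by rewrite mem_filter mem_enum /= ltn_ord.
by apply/colP => i; rewrite !mxE -entE.
Qed.

Lemma minor_rank k (B : 'M[R]_(N, k)) (f : 'I_k -> 'I_N) :
  \det (rowsub f B) != 0 -> \rank B = k.
Proof.
move=> d0; apply/rank_inj => c Bc.
have u : rowsub f B \in unitmx by rewrite unitmxE unitfE.
rewrite -(mulKmx u c) (_ : rowsub f B *m c = 0) ?mulmx0 //.
rewrite (_ : rowsub f B *m c = rowsub f (B *m c)).
  by rewrite Bc; apply/matrixP => i j; rewrite !mxE.
by apply/matrixP => i j; rewrite !mxE; apply: eq_bigr => s _; rewrite !mxE.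
Qed.

Lemma posmat_rank k (B : 'M[R]_(N, k)) (f : 'I_k -> 'I_N) :
  0 < \det (rowsub f B) -> \rank B = k.
Proof. by move=> d0; apply: (minor_rank (f := f)); rewrite gt_eqF. Qed.

Lemma minor_mulr k (B : 'M[R]_(N, k)) (C : 'M[R]_k) (f : 'I_k -> 'I_N) :
  \det (rowsub f (B *m C)) = \det (rowsub f B) * \det C.
Proof.
rewrite -det_mulmx; congr (\det _); apply/matrixP => i j; rewrite !mxE.
by apply: eq_bigr => s _; rewrite !mxE.
Qed.

End Colspan.

(** * From positive isotropic flags to the cell *)

Section Complete.
Variables (R : realType) (N n : nat).
Hypothesis Nn : N = (2 * n)%N \/ N = (2 * n + 1)%N.
Local Notation J := (altform R N).

Lemma altform_tr : J^T = (-1) ^+ N.-1 *: J.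
Proof.
apply/matrixP => i j; rewrite !mxE addnC; case: eqP => [e|_]; last by rewrite !mulr0.
rewrite !mulr1 (_ : N.-1 = i + j)%N; last lia.
by rewrite exprD mulrAC -exprD addnn -muln2 exprM sqrr_sign mul1r.
Qed.

(** Each remaining column [c >= n] must start with zeros up to a 1 in position
[c], and be orthogonal to the given columns [j] with j + c < N - 1. Both
conditions together form a triangular linear system with unit diagonal up to
signs. *)
Lemma complete_isometry (b : nat -> 'cV[R]_N) :
  (forall i j, (i < n)%N -> (j < n)%N -> (b i)^T *m J *m b j = 0) ->
  (forall j (r : 'I_N), (j < n)%N -> (r <= j)%N -> b j r 0 = (r == j :> nat)%:R) ->
  exists u : 'M[R]_N, [/\ unilower u, sigma_rel u u &
    forall (r s : 'I_N), (s < n)%N -> u r s = b s r 0].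
Proof.
move=> iso bl.
have formN (x y : 'cV[R]_N) : x^T *m J *m y = 0 -> y^T *m J *m x = 0.
  move/(congr1 trmx); rewrite !trmx_mul trmxK trmx0 altform_tr -scalemxAl -scalemxAr mulmxA.
  by move/eqP; rewrite scaler_eq0 signr_eq0 => /eqP.
have bJ j (t : 'I_N) : ((b j)^T *m J) 0 t = (-1) ^+ (rev_ord t) * b j (rev_ord t) 0.
  have e1 : (rev_ord t + t).+1 = N by have := ltn_ord t; rewrite /=; lia.
  rewrite mxE (bigD1 (rev_ord t)) //= !mxE e1 eqxx mulr1 mulrC.
  rewrite big1 ?addr0 // => s sj; rewrite !mxE (_ : ((s + t).+1 == N) = false) ?mulr0 //.
  by apply: contra_neqF sj => /eqP sj; apply: ord_inj => /=; lia.
have sol (c : 'I_N) : (n <= c)%N -> exists x : 'cV[R]_N,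
    (forall r : 'I_N, (r <= c)%N -> x r 0 = (r == c)%:R) /\
    (forall j, ((j + c).+1 < N)%N -> (b j)^T *m J *m x = 0).
  move=> nc.
  pose Q : 'M[R]_N := \matrix_(s, t)
    (if (s <= c)%N then (s == t)%:R else ((b (N - 1 - s)%N)^T *m J) 0 t).
  have uQ : Q \in unitmx.
    rewrite unitmxE unitfE det_trig; last first.
      apply/is_trig_mxP => s t st; rewrite mxE; case: ifP => sc.
        by case: eqP => // e; move: st; rewrite e ltnn.
      rewrite bJ bl /=; last 2 first.
      - by have := ltn_ord s; lia.
      - by have := ltn_ord s; have := ltn_ord t; lia.
      rewrite (_ : (_ == _) = false) ?mulr0 //.
      by have := ltn_ord s; have := ltn_ord t; lia.
    apply/prodf_neq0 => s _; rewrite mxE; case: ifP => sc; first by rewrite eqxx oner_eq0.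
    rewrite bJ bl /=; last 2 first.
    - by have := ltn_ord s; lia.
    - by have := ltn_ord s; lia.
    rewrite (_ : (N - s.+1 == N - 1 - s)%N = true) ?mulr1 ?signr_eq0 //.
    by have := ltn_ord s; lia.
  exists (invmx Q *m (delta_mx c 0 : 'cV[R]_N)).
  have Qx : Q *m (invmx Q *m (delta_mx c 0 : 'cV[R]_N)) = (delta_mx c 0 : 'cV[R]_N) by rewrite mulKVmx.
  move: (invmx Q *m _) Qx => x Qx; split=> [r rc|j jc].
    have /colP/(_ r) := Qx; rewrite [RHS]mxE eqxx andbT => <-.
    rewrite mxE (bigD1 r) //= mxE rc eqxx mul1r big1 ?addr0 // => s sr.
    by rewrite mxE rc eq_sym (negPf sr) mul0r.
  have sN : (N - 1 - j < N)%N by lia.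
  have /colP/(_ (Ordinal sN)) := Qx; rewrite [RHS]mxE -(inj_eq (@ord_inj N)) /=.
  rewrite (_ : (_ == _) = false); last by lia.
  rewrite mulr0n => e; apply/matrixP => i1 i2; rewrite !ord1 [RHS]mxE -[RHS]e.
  rewrite [LHS]mxE [RHS]mxE; apply: eq_bigr => t _; congr (_ * _).
  rewrite [RHS]mxE /= ifF; last by lia.
  by rewrite (_ : N - 1 - (N - 1 - j) = j)%N; last by lia.
have solx (c : 'I_N) : exists x : 'cV[R]_N, (n <= c)%N ->
    (forall r : 'I_N, (r <= c)%N -> x r 0 = (r == c)%:R) /\
    (forall j, ((j + c).+1 < N)%N -> (b j)^T *m J *m x = 0).
  case: (leqP n c) => nc; last by exists 0; lia.
  by have [y yP] := sol c nc; exists y.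
have [x xP] := choice solx.
pose col_ (s : 'I_N) := if (s < n)%N then b s else x s.
pose u : 'M[R]_N := \matrix_(r, s) col_ s r 0.
have ul (r s : 'I_N) : (r <= s)%N -> u r s = (r == s)%:R.
  move=> rs; rewrite mxE /col_; case: ltnP => sn; first by rewrite bl.
  by case: (xP s sn) => ->.
exists u; split.
- split=> [r s rs|r]; rewrite ul ?eqxx //; last exact: ltnW.
  by case: eqP => // e; move: rs; rewrite e ltnn.
- have uF i j : (u^T *m J *m u) i j = ((col_ i)^T *m J *m col_ j) 0 0.
    rewrite !formE; apply: eq_bigr => s _; by rewrite !mxE.
  apply/matrixP => i j; case: (ltnP (i + j).+1 N) => ij.
    rewrite [RHS]mxE ltn_eqF // mulr0 uF.
    suff -> : (col_ i)^T *m J *m col_ j = 0 by rewrite mxE.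
    rewrite /col_; case: ltnP => inn; case: ltnP => jn.
    - exact: iso.
    - by case: (xP j jn) => _ ->.
    - by apply: formN; case: (xP i inn) => _ -> //; rewrite addnC.
    - by lia.
  rewrite formE mxE (bigD1 i) //= ul // eqxx mulr1 big1 ?addr0.
    rewrite ul /=; last by have := ltn_ord i; lia.
    congr (_ * _%:R); rewrite -(inj_eq (@ord_inj N)) /=.
    by have := ltn_ord i; have := ltn_ord j; lia.
  move=> l li; have lN := ltn_ord l; case: (ltnP l i) => h.
    by rewrite ul ?(ltnW h) // (negPf li) mulr0 mul0r.
  have li' : l != i :> nat by apply: contra_neq li => /ord_inj.
  rewrite (@ul (rev_ord l)) /=; last by lia.
  rewrite (_ : (_ == _) = false) ?mulr0 // -(inj_eq (@ord_inj N)) /=; lia.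
- by move=> r s sn; rewrite mxE /col_ sn.
Qed.

Hypothesis n0 : (0 < n)%N.
Variable w : seq 'I_n.
Hypothesis lw : longest_reduced_word w.
Let wn := map (@nat_of_ord n) w.

(** Echelon bases of the subspaces give unitriangular columns, the initial
minors being nonzero; they extend to an isometry, to which the criterion for
the cell applies. *)
Lemma flag_to_cell (B : forall k, 'M[R]_(N, k)) :
  (forall k, (0 < k <= n)%N -> posmat (B k)) ->
  (forall k, (0 < k < n)%N -> (colspan (B k) <= colspan (B k.+1))%VS) ->
  (B n)^T *m J *m B n = 0 ->
  exists2 u, Gcell n wn u & forall k, (0 < k <= n)%N -> colspan (lcols k u) = colspan (B k).
Proof.
move=> posB incB isoB.
have le_rank_dim : (n <= N)%N by lia.
have ex (j : nat) : exists v : 'cV[R]_N, (j < n)%N ->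
    v \in colspan (B j.+1) /\ forall r : 'I_N, (r <= j)%N -> v r 0 = (r == j :> nat)%:R.
  case: (ltnP j n) => jn; last by exists 0.
  have jN : (j.+1 <= N)%N by lia.
  pose W := rowsub (widen_ord jN) (B j.+1).
  have uW : W \in unitmx.
    rewrite unitmxE unitfE gt_eqF //; apply: posB; first by lia.
    exact: widen_incr.
  exists (B j.+1 *m (invmx W *m delta_mx ord_max 0)) => _; split.
    by apply/colspanP; eexists.
  move=> r rj; have rj' : (r < j.+1)%N by [].
  have : W *m (invmx W *m delta_mx ord_max 0) = delta_mx ord_max 0 :> 'cV_ _ by rewrite mulKVmx.
  move/colP/(_ (Ordinal rj')); rewrite [RHS]mxE eqxx andbT.
  rewrite -(inj_eq (@ord_inj _)) /= => <-.
  rewrite [LHS]mxE [RHS]mxE; apply: eq_bigr => t _; congr (_ * _).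
  by rewrite [RHS]mxE; congr (B _ _ _); apply: ord_inj.
have [b bP] := choice ex.
have sub j k : (0 < j)%N -> (j <= k <= n)%N -> (colspan (B j) <= colspan (B k))%VS.
  move=> j0; elim: k => [|k IH] jk; first by lia.
  case: (eqVneq j k.+1) => [->|ne]; first exact: subvv.
  by apply: subv_trans (IH _) (incB _ _); lia.
have bB j : (j < n)%N -> b j \in colspan (B n).
  by move=> jn; apply: (subvP (sub j.+1 n _ _)); [lia|lia|case: (bP j jn)].
have [u [uu su ub]] : exists u : 'M[R]_N, [/\ unilower u, sigma_rel u u &
    forall (r s : 'I_N), (s < n)%N -> u r s = b s r 0].
  apply: complete_isometry => [i j inn jn|j r jn rj]; last by case: (bP j jn) => _ ->.
  by have /isotropic_colspan := isoB; apply; apply: bB.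
have spanE k : (0 < k <= n)%N -> colspan (lcols k u) = colspan (B k) /\ posmat (lcols k u).
  move=> /andP[k0 kn]; have kN : (k <= N)%N by lia.
  have : (colspan (lcols k u) <= colspan (B k))%VS.
    apply/span_subvP => v /mapP[j _ ->].
    have jN : (j < N)%N by have := ltn_ord j; lia.
    have jn : (j < n)%N by have := ltn_ord j; lia.
    have -> : col j (lcols k u) = b j.
      by apply/colP => r; rewrite !mxE -[ent u r j]/(ent u r (Ordinal jN)) entE ub.
    apply: (subvP (sub j.+1 k _ _)) => //; first by have := ltn_ord j; lia.
    by case: (bP j jn).
  case/colspan_sub => C CE.
  have d1 : \det (rowsub (widen_ord kN) (lcols k u)) = 1.
    rewrite -(solid_rowsub (i := 0)) // /solid det_trig; last first.
      by apply/is_trig_mxP => r s rs; rewrite mxE !add0n ent_lower.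
    by apply: big1 => r _; rewrite mxE !add0n ent_diag //; have := ltn_ord r; lia.
  have dB : 0 < \det (rowsub (widen_ord kN) (B k)) by apply: posB; rewrite ?k0.
  have dC : 0 < \det C.
    by rewrite -(pmulr_rgt0 _ dB) -minor_mulr -CE d1 ltr01.
  rewrite CE; split.
    by apply: colspan_unit; rewrite unitmxE unitfE gt_eqF.
  by move=> f fi; rewrite minor_mulr mulr_gt0 //; apply: posB; rewrite ?k0.
exists u; last by move=> k /spanE[].
by apply: (Gcell_of_posmat Nn n0 lw uu su) => k /spanE[].
Qed.

End Complete.

(** * A curve of totally positive isometries *)

Import numFieldNormedType.Exports.
Local Open Scope classical_set_scope.
Local Open Scope ring_scope.

Section Tends.
Variables (R : realType) (T : Type) (Fl : set_system T).
Context {FF : Filter Fl}.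

(** Convergence entry by entry along a filter, convenient because products,
minors and transposes are polynomial in the entries. *)
Definition tends m k (F : T -> 'M[R]_(m, k)) (L : 'M[R]_(m, k)) :=
  forall i j, F x i j @[x --> Fl] --> L i j.

Lemma tends_cst m k (L : 'M[R]_(m, k)) : tends (fun=> L) L.
Proof. by move=> i j; exact: cvg_cst. Qed.

Lemma cvg_sumr (I : Type) (r : seq I) (F : I -> T -> R) (l : I -> R) :
  (forall i, F i x @[x --> Fl] --> l i) ->
  \sum_(i <- r) F i x @[x --> Fl] --> \sum_(i <- r) l i.
Proof.
move=> Fi; elim: r => [|i r IH].
  rewrite big_nil; under eq_fun do rewrite big_nil; exact: cvg_cst.
rewrite big_cons; under eq_fun do rewrite big_cons.
exact: cvgD.
Qed.

Lemma cvg_prodr (I : Type) (r : seq I) (F : I -> T -> R) (l : I -> R) :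
  (forall i, F i x @[x --> Fl] --> l i) ->
  \prod_(i <- r) F i x @[x --> Fl] --> \prod_(i <- r) l i.
Proof.
move=> Fi; elim: r => [|i r IH].
  rewrite big_nil; under eq_fun do rewrite big_nil; exact: cvg_cst.
rewrite big_cons; under eq_fun do rewrite big_cons.
exact: cvgM.
Qed.

Lemma tends_mul m k l (F : T -> 'M[R]_(m, k)) (G : T -> 'M[R]_(k, l)) L M :
  tends F L -> tends G M -> tends (fun x => F x *m G x) (L *m M).
Proof.
move=> FL GM i j; rewrite mxE; under eq_fun do rewrite mxE.
by apply: cvg_sumr => s; apply: cvgM; [exact: FL | exact: GM].
Qed.

Lemma tends_tr m k (F : T -> 'M[R]_(m, k)) L :
  tends F L -> tends (fun x => (F x)^T) L^T.
Proof. by move=> FL i j; rewrite mxE; under eq_fun do rewrite mxE; exact: FL. Qed.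

Lemma tends_scale m k (F : T -> 'M[R]_(m, k)) c L :
  tends F L -> tends (fun x => c *: F x) (c *: L).
Proof.
move=> FL i j; rewrite mxE; under eq_fun do rewrite mxE.
by apply: cvgM; [exact: cvg_cst | exact: FL].
Qed.

Lemma tends_det k (F : T -> 'M[R]_k) L : tends F L -> \det (F x) @[x --> Fl] --> \det L.
Proof.
move=> FL; apply: cvg_sumr => s; apply: cvgM; first exact: cvg_cst.
by apply: cvg_prodr => i; exact: FL.
Qed.

Lemma tends_rowsub m k l (f : 'I_l -> 'I_m) (F : T -> 'M[R]_(m, k)) L :
  tends F L -> tends (fun x => rowsub f (F x)) (rowsub f L).
Proof. by move=> FL i j; rewrite mxE; under eq_fun do rewrite mxE; exact: FL. Qed.

Lemma tends_minor m k (f : 'I_k -> 'I_m) (F : T -> 'M[R]_(m, k)) L :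
  tends F L -> \det (rowsub f (F x)) @[x --> Fl] --> \det (rowsub f L).
Proof. by move=> FL; apply: tends_det; apply: tends_rowsub. Qed.

Lemma tends_posmat m k (F : T -> 'M[R]_(m, k)) L :
  tends F L -> posmat L -> \forall x \near Fl, posmat (F x).
Proof.
move=> FL posL.
have : \forall x \near Fl, forall f : {ffun 'I_k -> 'I_m}, incr f -> 0 < \det (rowsub f (F x)).
  apply: filter_forall => f; case: (pselect (incr f)) => fi; last by near=> x.
  have H := cvgr_gt _ (tends_minor (f := f) FL) _ (posL f fi).
  by apply: (@filterS T Fl FF _ _ _ (H FF)) => x Hx _.
apply: (@filterS T Fl FF) => x Px f fi; have := Px [ffun i => f i].
rewrite (_ : [ffun i => f i] = f :> (_ -> _)) //; first by apply.
by apply/funext => i; rewrite ffunE.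
Unshelve. all: by end_near. Qed.

End Tends.

(** A matrix of full column rank has a nonzero maximal minor; sorting its rows
makes their choice increasing. *)
Lemma rank_minor (R : realType) N k (A : 'M[R]_(N, k)) : \rank A = k ->
  exists f : 'I_k -> 'I_N, incr f /\ \det (rowsub f A) != 0.
Proof.
move=> /eqP rA.
have := fullrowsub_unit (rA : row_full A); set f0 := fullrankfun _.
rewrite unitmxE unitfE => fu.
have f0inj : injective f0 by exact: fullrankfun_inj.
pose t := [tuple f0 i | i < k].
pose le (a b : 'I_N) := (a <= b)%N.
pose s := sort_tuple le t.
have /tuple_permP[p sE] : perm_eq s t by rewrite perm_sort.
exists (fun i => f0 (p i)); split.
  move=> i j ij.
  have tnE l : f0 (p l) = tnth s l.
    by rewrite (tnth_nth (f0 (p l))) sE -tnth_nth !tnth_mktuple.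
  have szs (l : 'I_k) : (l < size s)%N by rewrite size_tuple.
  have sorted_s : sorted le s by apply: sort_sorted => a b; exact: leq_total.
  have : le (tnth s i) (tnth s j).
    have tr : transitive le by move=> a b c; exact: leq_trans.
    have rf : reflexive le by move=> a; exact: leqnn.
    rewrite !(tnth_nth (f0 i)).
    exact: (sorted_leq_nth tr rf (f0 i) sorted_s _ _ (szs i) (szs j) (ltnW ij)).
  rewrite -!tnE /le leq_eqVlt => /orP[/eqP/ord_inj/f0inj/perm_inj e|//].
  by move: ij; rewrite e ltnn.
have -> : rowsub (fun i => f0 (p i)) A = row_perm p (rowsub f0 A).
  by apply/matrixP => i j; rewrite !mxE.
by rewrite row_permE det_mulmx mulf_neq0 // det_perm signr_eq0.
Qed.

Section TendsRank.
Variables (R : realType) (T : Type) (Fl : set_system T).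
Context {FF : Filter Fl}.

Lemma tends_rank m k (F : T -> 'M[R]_(m, k)) L :
  tends Fl F L -> \rank L = k -> \forall x \near Fl, \rank (F x) = k.
Proof.
move=> FL /rank_minor[f [_ fu]].
have : \forall x \near Fl, \det (rowsub f (F x)) != 0.
  exact: cvgr_neq0 (tends_minor (f := f) FL) fu.
by apply: (@filterS T Fl FF) => x; exact: minor_rank.
Qed.
End TendsRank.

Section Curve.
Variables (R : realType) (N n : nat).
Hypothesis Nn : N = (2 * n)%N \/ N = (2 * n + 1)%N.
Local Notation J := (altform R N).

Definition gY (v : seq nat) (t : R) : 'M[R]_N :=
  foldr (fun i M => Gy N n i t *m M) 1%:M v.
Definition gX (v : seq nat) (t : R) : 'M[R]_N :=
  foldr (fun i M => (Gy N n i t)^T *m M) 1%:M v.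
(** A curve of isometries, equal to 1 at t = 0 and totally positive for t > 0. *)
Definition gcurve v t := gY v t *m gX v t.

Lemma gY_cell v t : 0 < t -> Gcell n v (gY v t).
Proof. by move=> t0; elim: v => //= i v IH; exists t, (gY v t). Qed.

Lemma gX_cell v t : 0 < t -> all (fun i => i < n)%N v -> Xcell (unfold N n v) (gX v t).
Proof.
move=> t0; elim: v => //= i v IH /andP[iltn /IH c].
rewrite unfold_cons /uletter /Gy.
case: (ltnP i.+1 n) => h; [|case: eqP => h2].
- exists t, (X N (N - 2 - i) t *m gX v t); split=> //; first by exists t, (gX v t).
  by rewrite trmx_mul !tr_elem -mulmxA [RHS]X_comm //; lia.
- by exists t, (gX v t); rewrite tr_elem.
have s0 : 0 < Num.sqrt 2 :> R := sq2_gt0 R.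
exists (t / Num.sqrt 2), (X N i.+1 (Num.sqrt 2 * t) *m (X N i (t / Num.sqrt 2) *m gX v t)).
split; rewrite ?divr_gt0 // ?trmx_mul ?tr_elem -?mulmxA //.
exists (Num.sqrt 2 * t), (X N i (t / Num.sqrt 2) *m gX v t).
split; rewrite ?mulr_gt0 //.
by exists (t / Num.sqrt 2), (gX v t); split; rewrite ?divr_gt0.
Qed.

Lemma sigma_tr (A : 'M[R]_N) : sigma_rel A A -> sigma_rel A^T A^T.
Proof.
rewrite /sigma_rel trmxK => h.
have : (A^T *m J) *m ((-1) ^+ N.-1 *: (A *m J)) = 1%:M.
  by rewrite -scalemxAr mulmxA h altform_sqr scalerA -exprD addnn -muln2 exprM sqrr_sign scale1r.
move/mulmx1C; rewrite -scalemxAl => e.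
have : (-1) ^+ N.-1 *: ((A *m J *m A^T) *m (J *m J)) = J.
  by rewrite mulmxA scalemxAl -[A *m J *m A^T *m J]mulmxA e mul1mx.
rewrite altform_sqr -scalemxAr mulmx1 scalerA -exprD addnn -muln2 exprM sqrr_sign.
by rewrite scale1r.
Qed.

Lemma gcurve_sigma v t : 0 < t -> all (fun i => i < n)%N v ->
  sigma_rel (gcurve v t) (gcurve v t).
Proof.
move=> t0 vn; apply: sigma_mul; first by apply: (Gcell_sigma Nn vn); exact: gY_cell.
elim: v vn => [|i v IH] /=; first by move=> _; exact: sigma1.
by case/andP=> iltn /IH c; apply: sigma_mul => //; apply/sigma_tr/sigma_Gy.
Qed.

Lemma tends_elem p q (c : R) (f : R -> R) : f t @[t --> (0:R)] --> c ->
  tends (nbhs (0:R)) (fun t => elem N p q (f t)) (elem N p q c).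
Proof.
move=> fc i j; rewrite !mxE; under eq_fun do rewrite !mxE.
apply: cvgD; first exact: cvg_cst.
by apply: cvgM => //; exact: cvg_cst.
Qed.

Lemma tends_Gy i : tends (nbhs (0:R)) (Gy N n i) 1%:M.
Proof.
have e (c : R) p q : tends (nbhs (0:R)) (fun t => elem N p q (c * t)) 1%:M.
  have h : (fun t : R => c * t) t @[t --> (0:R)] --> c * 0.
    by apply: cvgM; [exact: cvg_cst | exact: cvg_id].
  by have := @tends_elem p q _ _ h; rewrite mulr0 elem0.
have e1 p : tends (nbhs (0:R)) (Y N p) 1%:M.
  have := e 1 p.+1 p; rewrite (_ : (fun t => _) = Y N p) //.
  by apply/funext => t; rewrite mul1r.
have e2 (c : R) p q : tends (nbhs (0:R)) (fun t => elem N p q (t * c)) 1%:M.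
  by under eq_fun do rewrite mulrC; exact: e.
have [h|h] := boolP (i.+1 < n)%N.
  rewrite (_ : Gy N n i = fun t => Y N i t *m Y N (N - 2 - i) t); last first.
    by apply/funext => t; rewrite /Gy h.
  by rewrite -[1%:M]mul1mx; apply: tends_mul.
have [h2|h2] := boolP (N == 2 * n)%N.
  rewrite (_ : Gy N n i = Y N i) //.
  by apply/funext => t; rewrite /Gy (negPf h) h2.
rewrite (_ : Gy N n i = fun t => Y N i (t / Num.sqrt 2) *m
   (Y N i.+1 (Num.sqrt 2 * t) *m Y N i (t / Num.sqrt 2))); last first.
  by apply/funext => t; rewrite /Gy (negPf h) (negPf h2).
rewrite -[1%:M]mul1mx; apply: tends_mul; first exact: e2.
by rewrite -[1%:M]mul1mx; apply: tends_mul; [exact: e | exact: e2].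
Qed.

Lemma tends_gcurve v : tends (nbhs (0:R)) (gcurve v) 1%:M.
Proof.
rewrite -[1%:M]mul1mx; apply: tends_mul.
  elim: v => [|i v IH]; first exact: tends_cst.
  by rewrite -[1%:M]mul1mx; apply: tends_mul => //; exact: tends_Gy.
elim: v => [|i v IH]; first exact: tends_cst.
rewrite -[1%:M]mul1mx; apply: tends_mul => //.
by rewrite -trmx1; apply: tends_tr; exact: tends_Gy.
Qed.

Variable w : seq 'I_n.
Hypothesis lw : longest_reduced_word w.
Let wn := map (@nat_of_ord n) w.

(** A nonnegative matrix of full rank has some positive maximal minor. The
upper factor pushes it to the initial one and the lower factor spreads it to
all. *)
Lemma gcurve_pos t k (B : 'M[R]_(N, k)) : 0 < t -> nnmat B -> \rank B = k ->
  posmat (gcurve wn t *m B).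
Proof.
move=> t0 nB rB; have [f [fi fB]] := rank_minor rB.
have fpos : 0 < \det (rowsub f B) by rewrite lt_neqAle eq_sym fB nB.
have cX := gX_cell t0 (wn_lt w).
have cY : Ycell (unfold N n wn) (gY wn t).
  by apply: Gcell_Ycell (gY_cell _ _) => //; exact: wn_lt.
rewrite /gcurve -mulmxA.
apply: (Ycell_pos (red_longest Nn lw) (desc_longest Nn lw) cY); first exact: Xcell_nn cX nB.
exact: (Xcell_pos (red_longest Nn lw) (desc_longest Nn lw) cX nB fi fpos).
Qed.

(** The inverse of an isometry, as a polynomial in its entries so that
continuity is immediate. *)
Definition sigma_inv (A : 'M[R]_N) : 'M[R]_N := (-1) ^+ N.-1 *: (J *m A^T *m J).

Lemma sigma_invP A : sigma_rel A A -> A *m sigma_inv A = 1%:M.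
Proof.
move=> su; apply: mulmx1C; rewrite /sigma_inv -scalemxAl -!mulmxA (mulmxA A^T) su altform_sqr.
by rewrite scalerA -exprD addnn -muln2 exprM sqrr_sign scale1r.
Qed.

Lemma sigma_inv1 : sigma_inv 1%:M = 1%:M.
Proof.
rewrite /sigma_inv trmx1 mulmx1 altform_sqr scalerA -exprD addnn -muln2 exprM sqrr_sign.
by rewrite scale1r.
Qed.

Lemma tends_sigma_inv v : tends (nbhs (0:R)) (fun t => sigma_inv (gcurve v t)) 1%:M.
Proof.
rewrite -sigma_inv1; apply: tends_scale; apply: tends_mul; last exact: tends_cst.
by apply: tends_mul; [exact: tends_cst | apply: tends_tr; exact: tends_gcurve].
Qed.

(** The hyperplane where the first coordinate vanishes: bordering with the
first row, its minors away from that row are minors of the whole space up to a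
common constant, and the other ones vanish. *)
Lemma nonneg_hyperplane k (D : 'M[R]_(N, k.+2)) : (k.+2 <= N)%N -> posmat D ->
  exists C : 'M[R]_(k.+2, k.+1), nnmat (D *m C) /\ \rank (D *m C) = k.+1.
Proof.
move=> kN pD.
have N0 : (0 < N)%N by lia.
pose o0 : 'I_N := Ordinal N0.
pose r := row o0 D; pose U := row_ebase r; pose h := invmx U.
pose l := (r *m h) 0 ord0.
have rh (j : 'I_k.+1) : (r *m h) 0 (lift ord0 j) = 0.
  rewrite -{1}(mulmx_ebase r) /h mulmxK ?row_ebase_unit // mxE big1 // => i _.
  rewrite mxE (_ : _ && _ = false) ?mulr0 //.
  by apply/negP => /andP[/eqP e ie]; move: ie; rewrite e /= /bump /= => h1; have := rank_leq_row r; lia.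
have detF (f : 'I_k.+1 -> 'I_N) (F : 'I_k.+2 -> 'I_N) : F ord0 = o0 ->
    (forall i, F (lift ord0 i) = f i) ->
    \det (rowsub F D) * \det h = l * \det (rowsub f (col' ord0 (D *m h))).
  move=> F0 Ff; rewrite -minor_mulr (expand_det_row _ ord0) big_ord_recl big1 ?addr0.
    have -> : rowsub F (D *m h) ord0 ord0 = l.
      by rewrite rowsub_at F0 /l /r -row_mul [RHS]mxE.
    congr (_ * _); rewrite /cofactor /= expr0 mul1r; congr (\det _).
    by apply/matrixP => i j; rewrite !mxE Ff.
  move=> j _; rewrite (_ : rowsub F (D *m h) ord0 _ = 0) ?mul0r //.
  by rewrite rowsub_at F0 -[RHS](rh j) /r -row_mul [RHS]mxE.
have l0 : l != 0.
  pose f (i : 'I_k.+1) : 'I_N := widen_ord kN (lift ord0 i).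
  have := detF f (widen_ord kN) (ord_inj _) (fun=> erefl) => /=.
  move/(_ erefl) => e; apply: contraTneq (pD _ (@widen_incr N _ kN)) => l0.
  have hu : \det h != 0 by rewrite -unitfE -unitmxE unitmx_inv row_ebase_unit.
  by move/eqP: e; rewrite l0 mul0r mulf_eq0 (negPf hu) orbF => /eqP->; rewrite ltxx.
have hu : \det h != 0 by rewrite -unitfE -unitmxE unitmx_inv row_ebase_unit.
(* a rescaling of one column that makes the constant a square *)
pose d : 'rV[R]_k.+1 := \row_j if j == ord0 then \det h / l else 1.
pose P : 'M[R]_(k.+2, k.+1) := col' ord0 1%:M.
have DP (A : 'M[R]_(N, k.+2)) : A *m P = col' ord0 A.
  apply/matrixP => i j; rewrite !mxE (bigD1 (lift ord0 j)) //= !mxE eqxx mulr1.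
  by rewrite big1 ?addr0 // => s /negPf sj; rewrite !mxE sj mulr0.
have detd : \det (diag_mx d) = \det h / l.
  rewrite det_diag (bigD1 ord0) //= !mxE eqxx big1 ?mulr1 // => i /negPf i0.
  by rewrite mxE i0.
exists (h *m P *m diag_mx d).
have minorE (f : 'I_k.+1 -> 'I_N) : incr f -> (0 < f ord0)%N ->
    0 < \det (rowsub f (D *m (h *m P *m diag_mx d))).
  move=> fi f0; rewrite !mulmxA DP minor_mulr detd.
  pose F (i : 'I_k.+2) : 'I_N := if unlift ord0 i is Some j then f j else o0.
  have Fi : incr F.
    move=> i j; rewrite /F; case: (unliftP ord0 i) => [i'|] ->; case: (unliftP ord0 j) => [j'|] -> //=.
      by rewrite /bump /= => ij; apply: fi.
    by move=> _; apply: leq_trans f0 _; rewrite (incr_leq fi).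
  have e : \det (rowsub F D) * \det h = l * \det (rowsub f (col' ord0 (D *m h))).
    by apply: detF => [|i]; rewrite /F ?unlift_none // liftK.
  have -> : \det (rowsub f (col' ord0 (D *m h))) = \det (rowsub F D) * \det h / l.
    by rewrite e mulrC mulKf.
  rewrite mulrA -mulrA -(mulrA (\det (rowsub F D))) -!mulrA pmulr_rgt0; last exact: pD.
  rewrite (_ : \det h * _ = (\det h / l) ^+ 2); last by rewrite expr2; ring.
  by rewrite exprn_even_gt0 //= mulf_neq0 ?invr_eq0.
split=> [f fi|].
  case: (posnP (f ord0)) => f0; last exact/ltW/minorE.
  rewrite (@det_row0 _ _ _ ord0) //; apply/rowP => j.
  rewrite mxE rowsub_at (_ : f ord0 = o0); last exact: ord_inj.
  rewrite !mulmxA DP mul_mx_diag mxE [X in X * _]mxE [RHS]mxE.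
  have <- : (r *m h) 0 (lift ord0 j) = (D *m h) o0 (lift ord0 j).
    by rewrite /r -row_mul [LHS]mxE.
  by rewrite rh mul0r.
pose f (i : 'I_k.+1) : 'I_N := widen_ord kN (lift ord0 i).
apply: (posmat_rank (f := f)); apply: minorE => //.
Qed.

Hypothesis n0 : (0 < n)%N.

(** Moving the space slightly backwards along the curve keeps it positive; the
forward image of the nonnegative hyperplane of the moved space is positive. *)
Lemma positive_hyperplane k (B : 'M[R]_(N, k.+2)) : (k.+2 <= N)%N -> posmat B ->
  exists C : 'M[R]_(N, k.+1), posmat C /\ (colspan C <= colspan B)%VS.
Proof.
move=> kN pB.
have tB : tends (nbhs (0:R)) (fun t => sigma_inv (gcurve wn t) *m B) B.
  by rewrite -[X in tends _ _ X]mul1mx; apply: tends_mul; [exact: tends_sigma_inv|exact: tends_cst].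
have near_pos := tends_posmat tB pB.
have [t [t0 pD]] : exists t : R, 0 < t /\ posmat (sigma_inv (gcurve wn t) *m B).
  have [e /= e0 be] := proj1 (nbhs_ballP _ _) (near_pos _).
  exists (e / 2); split; first by rewrite divr_gt0.
  apply: be; rewrite /ball /= sub0r normrN gtr0_norm ?divr_gt0 //.
  by rewrite ltr_pdivrMr // ltr_pMr // ltr1n.
have [C [nC rC]] := nonneg_hyperplane kN pD.
exists (gcurve wn t *m (sigma_inv (gcurve wn t) *m B *m C)); split.
  exact: gcurve_pos.
rewrite !mulmxA sigma_invP; last by apply: gcurve_sigma => //; exact: wn_lt.
by rewrite mul1mx; exact: colspan_mul.
Qed.

End Curve.

(** * Topology of Grassmannians and flags *)

Section Grass.
Variables (R : realType) (N : nat).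

Lemma tends_id k (A : 'M[R]_(N, k)) : tends (nbhs A) id A.
Proof. by move=> i j; exact: coord_continuous. Qed.

Lemma tends_cvg k (T : Type) (F : set_system T) (FF : Filter F) (f : T -> 'M[R]_(N, k)) A :
  tends F f A -> f @ F --> A.
Proof.
move=> fA U [P nP PU]; rewrite /= /nbhs /=.
have H : \forall x \near F, forall i : 'I_N, forall j : 'I_k, P i j (f x i j).
  apply: filter_forall => i; apply: filter_forall => j.
  exact: fA (nP i j).
by apply: (@filterS _ F FF _ _ _ H) => x; exact: PU.
Qed.

(** One half of the description of the topology of Grassmannians by matrices;
the other half is [grass_nbhs]. *)
Lemma nbhs_grass k (A : 'M[R]_(N, k)) (U : set (grassmannian R N)) : \rank A = k ->
  nbhs (colspan A : grassmannian R N) U ->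
  \forall A' \near A, \rank A' = k -> U (colspan A').
Proof.
move=> rA /nbhs_interior; rewrite nbhsE => -[V [oV VA] VU].
have [W oW WV'] := proj1 (open_subspaceP _ _) (oV k).
have WA : W A.
  have : (W `&` [set A | \rank A = k]) A by rewrite WV'; split.
  by case.
have nW : nbhs A W by apply: open_nbhs_nbhs.
apply: filterS nW => A' WA' rA'.
apply: (@interior_subset _ U); apply: VU.
have : (W `&` [set A | \rank A = k]) A' by split.
by rewrite WV' => -[].
Qed.

Lemma cvg_grass k (T : Type) (F : set_system T) (FF : Filter F) (f : T -> 'M[R]_(N, k)) A :
  \rank A = k -> tends F f A ->
  (fun x => colspan (f x) : grassmannian R N) @ F --> (colspan A : grassmannian R N).
Proof.
move=> rA fA U /(nbhs_grass rA) nU.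
have H1 := tends_rank fA rA.
have H2 := tends_cvg FF fA nU.
have H := @filterI _ F FF _ _ (H1 FF) H2.
by apply: (@filterS _ F FF _ _ _ H) => x [h1 h2]; exact: h2.
Qed.

(** Taking column spans is open on matrices of full rank, because two bases
differ by right multiplication by an invertible matrix, which is continuous. *)
Lemma grass_nbhs k (A : 'M[R]_(N, k)) (P : set 'M[R]_(N, k)) : \rank A = k -> nbhs A P ->
  nbhs (colspan A : grassmannian R N)
    [set L : grassmannian R N | exists A', [/\ P A', \rank A' = k & colspan A' = L]].
Proof.
move=> rA /nbhs_interior nP.
pose V : set (grassmannian R N) :=
  [set L | exists A', [/\ P^° A', \rank A' = k & colspan A' = L]].
have VA : V (colspan A) by exists A; split => //; exact: nbhs_singleton nP.
suff oV : open V.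
  have : nbhs (colspan A : grassmannian R N) V by apply: open_nbhs_nbhs.
  apply: filterS => L [A' [h1 h2 h3]]; exists A'; split => //.
  exact: interior_subset.
move=> l; apply/open_subspaceP; have [lk|lk] := eqVneq l k; last first.
  exists set0; first exact: open0.
  rewrite set0I; apply/seteqP; split=> B // [[A' [_ rA' eA']] rB].
  case/eqP: lk; have dA := proj1 (dim_colspan A') rA'.
  by have := proj1 (dim_colspan B) rB; rewrite -eA' dA.
subst l; exists [set B | exists2 C, C \in unitmx & P^° (B *m C)].
  rewrite openE => B [C uC PC]; rewrite /interior.
  have tC : tends (nbhs B) (fun B' => B' *m C) (B *m C).
    by apply: tends_mul; [exact: tends_id | exact: tends_cst].
  have : \forall B' \near B, P^° (B' *m C).
    apply: (tends_cvg _ tC).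
    by apply: open_nbhs_nbhs; split => //; exact: open_interior.
  by apply: filterS => B' PB'; exists C.
apply/seteqP; split=> B [].
  move=> [C uC PC] rB; split => //; exists (B *m C); split => //.
    by rewrite mxrankMfree // row_free_unit.
  exact: colspan_unit.
move=> [A' [PA' rA' eA']] rB; split => //.
by have [C uC AE] := colspan_eq rA' eA'; exists C; rewrite -?AE.
Qed.

End Grass.

Section FlagSpace.
Variables (R : realType) (N n : nat) (K : {set 'I_n}).
Local Notation I := {k : 'I_n | k \in K}.

Lemma cvg_flag (T : Type) (F : set_system T) (FF : Filter F)
  (f : T -> flag_space R N K) (L : flag_space R N K) :
  (forall k, (fun x => f x k) @ F --> (L k : grassmannian R N)) -> f @ F --> L.
Proof.
move=> fk; apply/cvg_sup => k U.
rewrite (@nbhsE (initial_topology (@proj I (fun=> grassmannian R N) k))) => -[V [[W oW WV] VL] VU].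
have nW : nbhs (L k) W by apply: open_nbhs_nbhs; split => //; rewrite -WV in VL.
apply: (@filterS _ F FF _ _ _ (fk k W nW)) => x Wx; apply: VU; rewrite -WV; exact: Wx.
Qed.

Lemma nbhs_flag (L : flag_space R N K) (k : I) (U : set (grassmannian R N)) :
  nbhs (L k : grassmannian R N) U -> nbhs L [set L' : flag_space R N K | U (L' k)].
Proof. by move=> nU; apply: (@proj_continuous I (fun=> grassmannian R N) k L U nU). Qed.

(** Points of a closure are approximated through bases. Two components are
handled at once in order to compare members of a flag. *)
Lemma closure_lift (X : set (flag_space R N K)) (L : flag_space R N K) (k l : I)
  a b (A : 'M[R]_(N, a)) (B : 'M[R]_(N, b)) P Q :
  closure X L -> colspan A = L k -> colspan B = L l -> \rank A = a -> \rank B = b ->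
  nbhs A P -> nbhs B Q ->
  exists L' A' B', [/\ X L', P A' /\ Q B', colspan A' = L' k, colspan B' = L' l &
     \rank A' = a /\ \rank B' = b].
Proof.
move=> cX eA eB rA rB nP nQ.
have n1 := grass_nbhs rA nP; have n2 := grass_nbhs rB nQ.
rewrite eA in n1; rewrite eB in n2.
have := cX _ (filterI (nbhs_flag n1) (nbhs_flag n2)).
case=> L' [XL' [[A' [PA rA' eA']] [B' [QB rB' eB']]]].
by exists L', A', B'.
Qed.

End FlagSpace.

(** * The closure of the Pluecker positive part *)

Section TendsPair.
Variables (R : realType) (N : nat).

Lemma tends_row_col a b (A : 'M[R]_(N, a)) (B : 'M[R]_(N, b)) j :
  tends (filter_prod (nbhs A) (nbhs B))
    (fun x : 'M[R]_(N, a) * 'M[R]_(N, b) => row_mx (col j x.1) x.2) (row_mx (col j A) B).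
Proof.
move=> r s; case: (split_ordP s) => s' ->.
  rewrite row_mxEl mxE.
  rewrite (_ : (fun x => _) = (fun M : 'M[R]_(N, a) => M r j) \o fst); last first.
    by apply/funext => x /=; rewrite row_mxEl mxE.
  exact: (cvg_comp _ _ cvg_fst (@tends_id _ _ _ A r j)).
rewrite row_mxEr.
rewrite (_ : (fun x => _) = (fun M : 'M[R]_(N, b) => M r s') \o snd); last first.
  by apply/funext => x /=; rewrite row_mxEr.
exact: (cvg_comp _ _ cvg_snd (@tends_id _ _ _ B r s')).
Qed.
End TendsPair.

Section ClosureDpos.
Variables (R : realType) (N n : nat).
Hypothesis Nn : N = (2 * n)%N \/ N = (2 * n + 1)%N.
Local Notation J := (altform R N).
Variable K : {set 'I_n}.
Variable X : set (flag_space R N K).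
Hypothesis XD : X `<=` isoFl J K `&` FlDpos K.

Local Notation I := {k : 'I_n | k \in K}.

Lemma closure_dim (L : flag_space R N K) (k : I) : closure X L ->
  \dim (L k : {vspace 'cV[R]_N}) = (val k).+1.
Proof.
move=> cX; have [A eA] := colspan_ex (erefl (\dim (L k : {vspace _}))).
have rA := colspan_dim_rank eA erefl.
have [L' [A' [_ [XL' _ eA' _ [rA' _]]]]] :=
   closure_lift cX eA eA rA rA (@filterT _ _ _) (@filterT _ _ _).
have [[[dL' _] _] _] := XD XL'.
by rewrite -(dL' k) -eA' (proj1 (dim_colspan _) rA').
Qed.

Lemma closure_basis (L : flag_space R N K) (k : I) : closure X L ->
  exists A : 'M[R]_(N, (val k).+1), colspan A = L k /\ \rank A = (val k).+1.
Proof.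
move=> cX; have dk := closure_dim k cX; have [A eA] := colspan_ex dk.
by exists A; split => //; exact: colspan_dim_rank eA dk.
Qed.

(** Inclusion of subspaces is detected by a rank, and a rank that is too large
is an open condition. *)
Lemma rank_row_mx_notin b (v : 'cV[R]_N) (B : 'M[R]_(N, b)) : \rank B = b ->
  v \notin colspan B -> \rank (row_mx v B) = (1 + b)%N.
Proof.
move=> rB vB; apply/rank_inj => c; rewrite -[c]vsubmxK mul_row_col => e.
have u0 : usubmx c = 0.
  apply/colP => i; rewrite !ord1 [RHS]mxE; apply: contraNeq vB => c0.
  apply/colspanP; exists (- (usubmx c 0 0)^-1 *: dsubmx c).
  have cv : v *m usubmx c = usubmx c 0 0 *: v.
    by apply/colP => j; rewrite [LHS]mxE big_ord1 [RHS]mxE mulrC !ord1.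
  rewrite -{1}[v](scalerK c0) -cv.
  move/eqP: e; rewrite addr_eq0 => /eqP->.
  by rewrite -scalemxAr scalerN scaleNr.
move: e; rewrite u0 mulmx0 add0r => /(proj1 (rank_inj _) rB) ->.
by rewrite -[RHS]vsubmxK !linear0.
Qed.

Lemma closure_incl (L : flag_space R N K) (k l : I) : closure X L ->
  (val k <= val l)%N -> ((L k : {vspace 'cV[R]_N}) <= L l)%VS.
Proof.
move=> cX kl.
have [A [eA rA]] := closure_basis k cX; have [B [eB rB]] := closure_basis l cX.
rewrite -eA -eB; apply/span_subvP => v /mapP[j _ ->].
apply/negPn/negP => nB.
have rM := rank_row_mx_notin rB nB.
have tM := @tends_row_col R N _ _ A B j.
have := tends_rank tM rM => /(_ _)[[P Q] /= [nP nQ] PQ].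
have [L' [A' [B' [XL' [PA' QB'] eA' eB' [rA' rB']]]]] :=
  closure_lift cX eA eB rA rB nP nQ.
have [[[_ iL'] _] _] := XD XL'.
have := PQ (A', B') (conj PA' QB') => /=.
have := iL' k l kl; rewrite -eA' -eB' => /colspan_sub[C AC].
have -> : row_mx (col j A') B' = B' *m row_mx (col j C) 1%:M.
  by rewrite mul_mx_row mulmx1 AC !colE mulmxA.
move=> rk; have := mxrankM_maxl B' (row_mx (col j C) 1%:M).
by rewrite rk rB' add1n ltnn.
Qed.

Lemma closure_iso (L : flag_space R N K) (k : I) J' : closure X L ->
  (forall L', X L' -> isotropic J' (L' k)) -> isotropic J' (L k).
Proof.
move=> cX iso; have [A [eA rA]] := closure_basis k cX.
rewrite -eA; apply/isotropic_colspan/matrixP => i j; rewrite [RHS]mxE.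
apply/eqP/negPn/negP => n0.
have tQ : tends (nbhs A) (fun A' : 'M[R]_(N, (val k).+1) => A'^T *m J' *m A') (A^T *m J' *m A).
  apply: tends_mul; last exact: tends_id.
  by apply: tends_mul; [apply: tends_tr; exact: tends_id | exact: tends_cst].
have nP : \forall A' \near A, (A'^T *m J' *m A') i j != 0.
  exact: (cvgr_neq0 _ (tQ i j) n0).
have [L' [A' [_ [XL' [PA' _] eA' _ _]]]] :=
   closure_lift cX eA eA rA rA nP (@filterT _ _ _).
have := iso _ XL'; rewrite -eA' => /isotropic_colspan e.
by move: PA' => /=; rewrite e mxE eqxx.
Qed.

(** Minors all of the same sign can be made nonnegative by changing the sign
of a column. *)
Lemma nnmat_sign k (A : 'M[R]_(N, k.+1)) :
  (forall f, incr f -> 0 <= \det (rowsub f A)) \/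
  (forall f, incr f -> \det (rowsub f A) <= 0) ->
  exists C, C \in unitmx /\ nnmat (A *m C).
Proof.
case=> h; first by exists 1%:M; rewrite unitmx1 mulmx1.
pose d : 'rV[R]_k.+1 := \row_j if j == ord0 then -1 else 1.
have dd : \det (diag_mx d) = -1.
  rewrite det_diag (bigD1 ord0) //= !mxE eqxx big1 ?mulr1 // => i /negPf i0.
  by rewrite mxE i0.
exists (diag_mx d); split; first by rewrite unitmxE dd unitrN1.
by move=> f /h fi; rewrite minor_mulr dd mulrN1 oppr_ge0.
Qed.

(** Signs of minors of a basis are only defined up to a common sign; a minor
of each sign would persist in nearby positive subspaces. *)
Lemma closure_nonneg (L : flag_space R N K) (k : I) : closure X L ->
  plucker_nonneg (L k).
Proof.
move=> cX; have [A [eA rA]] := closure_basis k cX.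
have dk := closure_dim k cX.
apply/(plucker_nonnegP dk).
suff /nnmat_sign[C [uC nC]] : (forall f, incr f -> 0 <= \det (rowsub f A)) \/
  (forall f, incr f -> \det (rowsub f A) <= 0).
  by exists (A *m C); rewrite colspan_unit.
apply: contrapT => /not_orP[/existsNP[f /not_implyP[fi fneg]] /existsNP[g /not_implyP[gi gpos]]].
move/negP: fneg; rewrite -ltNge => fneg; move/negP: gpos; rewrite -ltNge => gpos.
have nP : \forall A' \near A, \det (rowsub f A') < 0.
  exact: (cvgr_lt _ (tends_minor (f := f) (@tends_id _ _ _ A)) _ fneg).
have nQ : \forall A' \near A, 0 < \det (rowsub g A').
  exact: (cvgr_gt _ (tends_minor (f := g) (@tends_id _ _ _ A)) _ gpos).
have [L' [A' [_ [XL' [[PA' QA'] _] eA' _ [rA' _]]]]] :=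
   closure_lift cX eA eA rA rA (filterI nP nQ) (@filterT _ _ _).
have [[[dL' _] _] [_ pL']] := XD XL'.
have [B [eB pB]] := proj1 (plucker_positiveP (dL' k)) (pL' k).
have [C uC AE] := colspan_eq rA' (etrans eA' (esym eB)).
move: PA' QA' => /=; rewrite AE !minor_mulr pmulr_rlt0; last exact: pB.
by rewrite pmulr_rgt0; [move=> /lt_trans h /h; rewrite ltxx|exact: pB].
Qed.

Hypothesis XiffD : X = isoFl J K `&` FlDpos K.
Variable w : seq 'I_n.
Hypothesis lw : longest_reduced_word w.
Let wn := map (@nat_of_ord n) w.

(** The conditions defining the right-hand side are closed. Conversely a
nonnegative flag is the limit of its images under the curve, which are
positive. *)
Lemma closure_Dpos : closure X = isoFl J K `&` FlDnonneg K.
Proof.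
apply/seteqP; split=> L.
  move=> cX; have h : Fl K L.
    by split=> [k|k l kl]; [exact: closure_dim | exact: closure_incl].
  split; split=> // k; last exact: closure_nonneg.
  by apply: closure_iso => // L' /XD[[_ iso] _]; exact: iso.
move=> [[FL isoL] [_ nL]]; have [dL iL] := FL.
have exB (k : I) : exists B : 'M[R]_(N, (val k).+1), colspan B = L k /\ nnmat B.
  exact: (proj1 (plucker_nonnegP (dL k)) (nL k)).
pose B k := sval (cid (exB k)).
have BP k : colspan (B k) = L k /\ nnmat (B k) := svalP (cid (exB k)).
pose f (t : R) : flag_space R N K := fun k => colspan (gcurve N n wn t *m B k).
have rB k : \rank (B k) = (val k).+1.
  by case: (BP k) => eB _; exact: colspan_dim_rank eB (dL k).
have Xf t : 0 < t -> X (f t).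
  move=> t0; rewrite XiffD.
  have sg := gcurve_sigma Nn t0 (wn_lt w).
  have [ug _] := mulmx1_unit (sigma_invP sg).
  have rg k : \rank (gcurve N n wn t *m B k) = (val k).+1.
    apply/rank_inj => c; rewrite -mulmxA => e.
    by apply: (proj1 (rank_inj _) (rB k)); rewrite -(mulKmx ug (_ *m c)) e mulmx0.
  have Ff : Fl K (f t).
    split=> [k|k l kl]; first exact: (proj1 (dim_colspan _) (rg k)).
    have [eBk _] := BP k; have [eBl _] := BP l.
    have := iL k l kl; rewrite -eBk -eBl => /colspan_sub[C eC].
    by rewrite /f eC mulmxA; exact: colspan_mul.
  split; split=> // k.
    apply/isotropic_colspan.
    have -> : (gcurve N n wn t *m B k)^T *m J *m (gcurve N n wn t *m B k) =
        (B k)^T *m ((gcurve N n wn t)^T *m J *m gcurve N n wn t) *m B k.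
      by rewrite trmx_mul !mulmxA.
    rewrite (sg : _ = J).
    by have [eB _] := BP k; have := isoL k; rewrite -eB => /isotropic_colspan.
  apply/(plucker_positiveP (proj1 Ff k)); exists (gcurve N n wn t *m B k); split => //.
  by have [_ nB] := BP k; exact: gcurve_pos.
have ff : f @ nbhs (0 : R) --> L.
  apply: cvg_flag => k; have [eB _] := BP k; rewrite -eB.
  apply: cvg_grass => //.
  rewrite -[X in tends _ _ X]mul1mx; apply: tends_mul; last exact: tends_cst.
  exact: tends_gcurve.
move=> U /ff /(proj1 (nbhs_ballP _ _))[e /= e0 be].
exists (f (e / 2)); split; first by apply: Xf; rewrite divr_gt0.
apply: be; rewrite /ball /= sub0r normrN gtr0_norm ?divr_gt0 //.
by rewrite ltr_pdivrMr // ltr_pMr // ltr1n.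
Qed.

End ClosureDpos.

(** * Lusztig positive flags *)

Section WordCell.
Variables (R : realType) (N n : nat).

Lemma word_cell_nil (y : 'I_n -> R -> 'M[R]_N) u : word_cell y [::] u <-> u = 1%:M.
Proof.
split=> [[a _ <-]|->]; first by rewrite big_ord0.
by exists (fun=> 1) => [j|]; rewrite ?ltr01 // big_ord0.
Qed.

Lemma word_cell_cons (y : 'I_n -> R -> 'M[R]_N) i w u : word_cell y (i :: w) u <->
  exists a u', [/\ 0 < a, word_cell y w u' & u = y i a *m u'].
Proof.
split=> [[a a0 <-]|[a [_ [a0 [b b0 <-] ->]]]].
  exists (a ord0), (\prod_(j < size w) y (tnth (in_tuple w) j) (a (lift ord0 j))).
  split; first exact: a0.
    by exists (fun j => a (lift ord0 j)) => // j; exact: a0.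
  rewrite big_ord_recl /=; congr (y _ _ *m _).
  by apply: eq_bigr => j _; congr (y _ _); rewrite !(tnth_nth i).
exists (fun j => if unlift ord0 j is Some j' then b j' else a).
  by move=> j /=; case: unliftP => [j'|] _ //; exact: b0.
rewrite big_ord_recl /= unlift_none; congr (y _ _ *m _).
by apply: eq_bigr => j _; rewrite liftK; congr (y _ _); rewrite !(tnth_nth i).
Qed.

End WordCell.

Section Interface.
Variables (R : realType) (N n : nat).
Hypothesis Nn : N = (2 * n)%N \/ N = (2 * n + 1)%N.
Hypothesis n0 : (0 < n)%N.
Local Notation J := (altform R N).
Variable J' : 'M[R]_N.
Hypothesis isoJ : forall L, isotropic J' L <-> isotropic J L.
Hypothesis JJ' : forall A : 'M[R]_N, A^T *m J' *m A = J' <-> sigma_rel A A.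
Variable y : 'I_n -> R -> 'M[R]_N.
Hypothesis yE : forall i a, y i a = Gy N n i a.
Variable w : seq 'I_n.
Hypothesis lw : longest_reduced_word w.
Let wn := map (@nat_of_ord n) w.
Variable K : {set 'I_n}.
Local Notation I := {k : 'I_n | k \in K}.

Definition flagpos := flag_of K @` (group_pos (isometries J') y w) : set (flag_space R N K).

Lemma word_cell_Gcell (v : seq 'I_n) u :
  word_cell y v u <-> Gcell n (map (@nat_of_ord n) v) u.
Proof.
elim: v u => [|i v IH] u; first exact: word_cell_nil.
rewrite word_cell_cons /=; split=> -[a [u' [a0 /IH c ->]]].
  by exists a, u'; split; rewrite ?yE.
by exists a, u'; split; rewrite ?yE.
Qed.

Lemma word_cellT_upper v u : word_cell (fun i m => (y i m)^T) v u -> unilower u^T.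
Proof.
elim: v u => [|i v IH] u.
  by move/word_cell_nil => ->; rewrite trmx1; exact: unilower1.
move/word_cell_cons => [a [u' [a0 /IH c ->]]].
rewrite trmx_mul trmxK; apply: unilower_mul => //; rewrite yE /Gy.
case: ifP => _; first by apply: unilower_mul; exact: unilower_Y.
case: ifP => _; first exact: unilower_Y.
by do ?[apply: unilower_mul]; exact: unilower_Y.
Qed.

Lemma word_cellT_ex v : exists u, word_cell (fun i m => (y i m)^T) v u.
Proof. by exists (\prod_(j < size v) (y (tnth (in_tuple v) j) 1)^T); exists (fun=> 1). Qed.

(** Right multiplication by an invertible upper triangular matrix does not
change the flag of columns; hence only the lower unipotent factor of a
positive element of the group matters for its flag. *)
Lemma colspan_upper (u M : 'M[R]_N) k : (k <= N)%N ->
  (forall i j : 'I_N, (j < i)%N -> M i j = 0) -> (forall i, M i i != 0) ->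
  colspan (lcols k (u *m M)) = colspan (lcols k u).
Proof.
move=> kN up di.
pose T : 'M[R]_k := \matrix_(i, j) M (widen_ord kN i) (widen_ord kN j).
have MT : M *m ucols R (widen_ord kN) = ucols R (widen_ord kN) *m T.
  apply/matrixP => i j; rewrite !mxE (bigD1 (widen_ord kN j)) //= !mxE eqxx mulr1.
  rewrite big1 ?addr0; last by move=> l /negPf lj; rewrite mxE lj mulr0.
  case: (ltnP i k) => ik.
    rewrite (bigD1 (Ordinal ik)) //= !mxE (_ : widen_ord kN (Ordinal ik) = i); last exact: ord_inj.
    rewrite eqxx mul1r big1 ?addr0 // => l li; rewrite !mxE (_ : (i == _) = false) ?mul0r //.
    by apply: contra_neqF li => /eqP e; apply: ord_inj; rewrite /= e.
  rewrite big1; first by rewrite up //=; apply: leq_trans ik.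
  move=> l _; rewrite !mxE (_ : (i == _) = false) ?mul0r //.
  by apply/eqP => e; move: ik; rewrite e /= leqNgt ltn_ord.
rewrite !(lcolsE kN) -mulmxA MT mulmxA; apply: colspan_unit.
rewrite unitmxE -det_tr det_trig; last first.
  by apply/is_trig_mxP => i j ij; rewrite !mxE up.
by rewrite unitfE; apply/prodf_neq0 => i _; rewrite !mxE.
Qed.

Lemma le_rank_dim : (n <= N)%N. Proof. lia. Qed.

Lemma flagpos_cell : flagpos = [set flag_of K u | u in Gcell n wn].
Proof.
apply/seteqP; split=> L.
  case=> A [u [t [v [cu [_ [td tp]] /word_cellT_upper[vlo vdi] ->]]]] <-.
  exists u; first by apply/word_cell_Gcell.
  apply: functional_extensionality_dep => k; rewrite !flag_colspan ?le_rank_dim // -mulmxA.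
  have kN : ((val k).+1 <= N)%N by have := ltn_ord (val k); lia.
  have tvE i j : (t *m v) i j = t i i * v i j.
    rewrite mxE (bigD1 i) //= big1 ?addr0 // => l li.
    by rewrite (is_diag_mxP td) ?mul0r // eq_sym.
  apply/esym; apply: colspan_upper => // [i j ji|i]; rewrite tvE.
    by have := vlo j i ji; rewrite mxE => ->; rewrite mulr0.
  by have := vdi i; rewrite mxE => ->; rewrite mulr1 gt_eqF.
case=> u cu <-; have [v cv] := word_cellT_ex w.
have [vlo vdi] := word_cellT_upper cv.
exists (u *m 1%:M *m v); last first.
  apply: functional_extensionality_dep => k; rewrite !flag_colspan ?le_rank_dim // mulmx1.
  have kN : ((val k).+1 <= N)%N by have := ltn_ord (val k); lia.
  apply: colspan_upper => // [i j ji|i]; first by have := vlo j i ji; rewrite mxE.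
  by have := vdi i; rewrite mxE => ->; rewrite oner_eq0.
exists u, 1%:M, v; split => //; first exact/word_cell_Gcell.
split; split.
- by rewrite det1.
- by apply/JJ'; exact: sigma1.
- by apply/is_diag_mxP => i j ij; rewrite mxE -(inj_eq (@ord_inj N)) (negPf ij).
- by move=> i; rewrite mxE eqxx ltr01.
Qed.

Lemma lcols_isotropic k (u : 'M[R]_N) : (k <= n)%N -> sigma_rel u u ->
  (lcols k u)^T *m J *m lcols k u = 0.
Proof.
move=> kn su; have kN : (k <= N)%N by lia.
have -> : (lcols k u)^T *m J *m lcols k u =
   (ucols R (widen_ord kN))^T *m (u^T *m J *m u) *m ucols R (widen_ord kN).
  by rewrite (lcolsE kN) trmx_mul !mulmxA.
rewrite (su : _ = J); apply/matrixP => i j; rewrite formE [RHS]mxE big1 // => l _.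
rewrite !mxE; case: eqP => [el|_]; last by rewrite mulr0 mul0r.
rewrite (_ : (rev_ord l == _) = false) ?mulr0 //.
apply/eqP => /(congr1 (@nat_of_ord N)) /=; rewrite el /=.
by have := ltn_ord i; have := ltn_ord j; lia.
Qed.

Lemma lcols_sub k l (u : 'M[R]_N) : (k <= l)%N -> (colspan (lcols k u) <= colspan (lcols l u))%VS.
Proof.
move=> kl; apply/span_subvP => v /mapP[j _ ->]; apply: memv_span; apply/mapP.
exists (widen_ord kl j); first by rewrite mem_enum.
by apply/colP => i; rewrite !mxE.
Qed.

Lemma init_posmat k (B : 'M[R]_(N, k)) : (k <= N)%N -> posmat B -> \rank B = k.
Proof. by move=> kN /(_ _ (@widen_incr N k kN))/posmat_rank. Qed.

(** Columns of elements of the cell are isotropic, and positive by total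
positivity. *)
Lemma flagpos_sub : flagpos `<=` isoFl J K `&` FlDpos K.
Proof.
rewrite flagpos_cell => _ [u cu <-].
have fE (k : I) : flag_of K u k = colspan (lcols (val k).+1 u) :> {vspace _}.
  by apply: flag_colspan; exact: le_rank_dim.
have kn (k : I) : ((val k).+1 <= n)%N by exact: ltn_ord.
have kN (k : I) : ((val k).+1 <= N)%N by have := kn k; lia.
have pk (k : I) : posmat (lcols (val k).+1 u) by apply: (Gcell_pos Nn lw).
have dk (k : I) : \dim (flag_of K u k : {vspace _}) = (val k).+1.
  by rewrite fE; apply/dim_colspan; exact: init_posmat.
have h : Fl K (flag_of K u).
  by split=> // k l kl; rewrite !fE; exact: lcols_sub.
split; split=> // k.
  rewrite fE; apply/isotropic_colspan; apply: lcols_isotropic => //.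
  by apply: Gcell_sigma cu => //; exact: wn_lt.
by apply/(plucker_positiveP (dk k)); exists (lcols (val k).+1 u); rewrite -fE.
Qed.

Definition posspan k (V : {vspace 'cV[R]_N}) :=
  exists B : 'M[R]_(N, k), colspan B = V /\ posmat B.

(** Iterating [positive_hyperplane] down to dimension 1. *)
Lemma positive_chain m (B : 'M[R]_(N, m.+1)) : (m.+1 <= N)%N -> posmat B ->
  exists F : nat -> {vspace 'cV[R]_N}, [/\ F m.+1 = colspan B,
    forall k, (0 < k <= m.+1)%N -> posspan k (F k) &
    forall k, (0 < k <= m)%N -> (F k <= F k.+1)%VS].
Proof.
elim: m B => [|m IH] B mN pB.
  exists (fun=> colspan B); split=> // k k1.
  have -> : k = 1%N by lia.
  by exists B.
have [C [pC CB]] := positive_hyperplane Nn lw mN pB.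
have [F [Fm pF iF]] := IH C (ltnW mN) pC.
exists (fun k => if k == m.+2 then colspan B else F k); split.
- by rewrite eqxx.
- move=> k km; case: eqVneq => [->|ne]; first by exists B.
  by apply: pF; lia.
- move=> k km; rewrite ltn_eqF; last by lia.
  case: eqVneq => [[->]|ne]; first by rewrite Fm.
  by apply: iF; lia.
Qed.

(** The members of the flag whose dimensions are in [K] are completed by a
positive chain below the smallest one; the largest one has dimension n, so
that the complete flag comes from an isometry. *)
Lemma flagpos_interval (k0 : 'I_n) : K = [set i : 'I_n | (k0 <= i)%N]%SET ->
  flagpos = isoFl J K `&` FlDpos K.
Proof.
move=> KE; apply/seteqP; split; first exact: flagpos_sub.
move=> L [[[dL iL] isoL] [_ pL]].
have inK (i : 'I_n) : (i \in K) = (k0 <= i)%N by rewrite KE inE.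
(* the members of L indexed by their dimension *)
pose Ln (k : nat) : {vspace 'cV[R]_N} :=
  if insub k.-1 is Some i then (if insub i is Some s then L s else 0%VS) else 0%VS.
have LnE (s : I) : Ln (val s).+1 = L s by rewrite /Ln /= !valK.
have Lex k : (k0 < k <= n)%N -> exists s : I, k = (val s).+1.
  move=> kk; have kn : (k.-1 < n)%N by lia.
  have kK : Ordinal kn \in K by rewrite inK /=; lia.
  by exists (exist _ (Ordinal kn) kK) => /=; lia.
have pLn k : (k0 < k <= n)%N -> posspan k (Ln k).
  by move=> /Lex[s ->]; rewrite LnE; apply/(plucker_positiveP (dL s)).
have [B [eB pB]] : posspan k0.+1 (Ln k0.+1) by apply: pLn; have := ltn_ord k0; lia.
have [|F [Fm pF iF]] := positive_chain _ pB; first by have := ltn_ord k0; lia.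
pose G k := if (k <= k0)%N then F k else Ln k.
have pG k : (0 < k <= n)%N -> posspan k (G k).
  by move=> kk; rewrite /G; case: leqP => h; [apply: pF; lia | apply: pLn; lia].
have iG k : (0 < k < n)%N -> (G k <= G k.+1)%VS.
  move=> kk; rewrite /G; case: (ltngtP k k0) => h.
  - by apply: iF; lia.
  - have [s es] : exists s : I, k = (val s).+1 by apply: Lex; lia.
    have [t et] : exists t : I, k.+1 = (val t).+1 by apply: Lex; lia.
    by rewrite {1}es et !LnE; apply: iL; rewrite -ltnS -es -ltnS -et.
  - have [t et] : exists t : I, k.+1 = (val t).+1 by apply: Lex; have := ltn_ord k0; lia.
    by rewrite h -eB -Fm; apply: iF; lia.
pose Bk k : 'M[R]_(N, k) := xget 0 [set C | colspan C = G k /\ posmat C].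
have BkP k : (0 < k <= n)%N -> colspan (Bk k) = G k /\ posmat (Bk k).
  by move=> /pG[C CP]; apply: (xgetPex 0 (P := [set C | colspan C = G k /\ posmat C])); exists C.
have [||| u cu uE] := flag_to_cell Nn n0 lw (B := Bk).
- by move=> k /BkP[].
- by move=> k kk; rewrite !(proj1 (BkP _ _)); [exact: iG| |]; lia.
- have nn : (0 < n <= n)%N by lia.
  have Gn : G n = Ln n by rewrite /G leqNgt ltn_ord.
  have [s es] : exists s : I, n = (val s).+1 by apply: Lex; rewrite ltn_ord leqnn.
  apply/isotropic_colspan; rewrite (proj1 (BkP n nn)) Gn {1}es LnE.
  by apply/isoJ; apply/isoJ; exact: isoL.
rewrite flagpos_cell; exists u => //.
apply: functional_extensionality_dep => s; rewrite flag_colspan ?le_rank_dim // uE; last first.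
  by rewrite ltn_ord.
rewrite (proj1 (BkP _ _)) ?ltn_ord // /G ltnNge -inK (valP s) /=.
exact: LnE.
Qed.

Lemma isoFlE : isoFl J' K = isoFl J K :> set (flag_space R N K).
Proof.
by rewrite /isoFl; congr (_ `&` _); apply/seteqP; split=> L h k; apply/isoJ; exact: h.
Qed.

Lemma flagpos_closure : flagpos = isoFl J K `&` FlDpos K ->
  closure flagpos = isoFl J K `&` FlDnonneg K.
Proof. by move=> e; apply: (closure_Dpos Nn _ e lw); rewrite e. Qed.

End Interface.

(** * Quadratic inequalities on the closure *)

Section Blocks.
Variables (R : realType) (N : nat).

(** On such rows the matrix is block lower triangular. *)
Lemma minor_block s t (A : 'M[R]_(N, s)) (Z : 'M[R]_(N, t)) (f : 'I_(s + t) -> 'I_N) :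
  (forall (i : 'I_N) j, (i < s)%N -> Z i j = 0) ->
  (forall j : 'I_s, f (lshift t j) = j :> nat) ->
  \det (rowsub f (row_mx A Z)) =
  \det (rowsub (f \o @lshift s t) A) * \det (rowsub (f \o @rshift s t) Z).
Proof.
move=> Z0 fs.
rewrite (_ : rowsub f (row_mx A Z) =
  block_mx (rowsub (f \o @lshift s t) A) 0 (rowsub (f \o @rshift s t) A)
   (rowsub (f \o @rshift s t) Z)); first exact: det_lblock.
apply/matrixP => i j.
case: (split_ordP i) => i' ->; case: (split_ordP j) => j' ->; rewrite rowsub_at.
- by rewrite block_mxEul row_mxEl [RHS]mxE.
- by rewrite block_mxEur row_mxEr Z0 ?mxE // fs ltn_ord.
- by rewrite block_mxEdl row_mxEl [RHS]mxE.
- by rewrite block_mxEdr row_mxEr [RHS]mxE.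
Qed.

Definition idcols s : 'M[R]_(N, s) := \matrix_(i, j) (i == j :> nat)%:R.

Lemma idcolsE s (sN : (s <= N)%N) : idcols s = ucols R (widen_ord sN).
Proof. by apply/matrixP => i j; rewrite !mxE. Qed.

Lemma lcols1 s : (s <= N)%N -> lcols s 1%:M = idcols s.
Proof. by move=> sN; rewrite (lcolsE sN) mul1mx -idcolsE. Qed.

Lemma lcols_mul s (g u : 'M[R]_N) : (s <= N)%N -> lcols s (g *m u) = g *m lcols s u.
Proof. by move=> sN; rewrite !(lcolsE sN) mulmxA. Qed.

(** A minor of a matrix starting with columns of the identity is reduced to a
minor of the rest, or has a vanishing column. *)
Lemma incr_start s t (f : 'I_(s + t) -> 'I_N) : incr f ->
  (forall j : 'I_s, f (lshift t j) = j :> nat) \/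
  exists j : 'I_s, forall i, f i != j :> nat.
Proof.
move=> fi.
case: (boolP [forall j : 'I_s, f (lshift t j) == j :> nat]) => [/forallP h|].
  by left=> j; apply/eqP.
rewrite negb_forall => /existsP[j1 /= ne1]; right.
have [j0 ne0 min0] := @arg_minnP _ j1 (fun j => f (lshift t j) != j :> nat)
   (fun j : 'I_s => j : nat) ne1.
exists j0 => i; apply/eqP => e.
have le0 := incr_ge fi (lshift t j0).
have gt0 : (j0 < f (lshift t j0))%N by move: ne0 le0 => /=; lia.
have ij : (i < lshift t j0)%N by rewrite ltnNge -(incr_leq fi) e -ltnNge.
have ilt : (i < s)%N by have := ltn_ord j0; move: ij => /=; lia.
have ei : i = lshift t (Ordinal ilt) by exact: ord_inj.
have : ~~ (f (lshift t (Ordinal ilt)) != (Ordinal ilt) :> nat).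
  by apply/negP => /min0 /=; move: ij => /=; lia.
by rewrite -ei e negbK => /eqP /= e2; move: ij => /=; lia.
Qed.

Lemma nnmat_block s t (Z : 'M[R]_(N, t)) : (s <= N)%N ->
  (forall (i : 'I_N) j, (i < s)%N -> Z i j = 0) -> nnmat Z ->
  nnmat (row_mx (idcols s) Z).
Proof.
move=> sN Z0 nZ f fi; case: (incr_start fi) => [f0|[j jf]].
  rewrite minor_block // (_ : rowsub _ (idcols s) = 1%:M); last first.
    by apply/matrixP => i j; rewrite !mxE /= f0.
  rewrite det1 mul1r; apply: nZ => i j ij; apply: fi; by rewrite /= ltn_add2l.
rewrite (expand_det_col _ (lshift t j)) big1 ?lexx // => i _.
by rewrite mxE row_mxEl mxE (negPf (jf i)) mul0r.
Qed.

End Blocks.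

Section Inequalities.
Variables (R : realType) (N n : nat).
Hypothesis Nn : N = (2 * n)%N \/ N = (2 * n + 1)%N.
Local Notation J := (altform R N).

(** The equation for the entry (k, N - 2 - k) of the form has only two nonzero
terms. This is the relation through which isotropy enters the inequalities. *)
Lemma subdiag_sym (u : 'M[R]_N) k : (k.+2 <= n)%N -> unilower u -> sigma_rel u u ->
  ent u (N - 1 - k) (N - 2 - k) = ent u k.+1 k.
Proof.
move=> kn uu su.
have k1 : (k < N)%N by lia.
have k2 : (k.+1 < N)%N by lia.
have k3 : (N - 2 - k < N)%N by lia.
have := congr1 (fun M : 'M[R]_N => M (Ordinal k1) (Ordinal k3)) su.
rewrite formE mxE /= (_ : (_ == N) = false) ?mulr0; last by lia.
rewrite (bigD1 (Ordinal k1)) //= (bigD1 (Ordinal k2)) /=; last first.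
  by apply/eqP => /(congr1 (@nat_of_ord N)) /=; lia.
rewrite big1 ?addr0; last first.
  move=> l /andP[l1 l2]; have lN := ltn_ord l.
  have n1 : l != k :> nat by apply: contra_neq l1 => e; apply: ord_inj.
  have n2 : l != k.+1 :> nat by apply: contra_neq l2 => e; apply: ord_inj.
  case: (ltnP l k) => lk.
    by rewrite -(entE u l (Ordinal k1)) ent_lower ?mulr0 ?mul0r.
  rewrite -(entE u (rev_ord l) (Ordinal k3)) /= (@ent_lower _ _ u (N - l.+1)) ?mulr0 //; lia.
rewrite -!entE /= ent_diag // (_ : N - k.+2 = N - 2 - k)%N; last by lia.
rewrite ent_diag // exprS !mulr1 (_ : N - k.+1 = N - 1 - k)%N; last by lia.
move/eqP; rewrite mulN1r mulNr subr_eq0 => /eqP /(mulfI _); apply.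
by rewrite signr_eq0.
Qed.

End Inequalities.

Section Det.
Variable R : comRingType.

Lemma det2 (M : 'M[R]_2) : \det M = M 0 0 * M 1 1 - M 0 1 * M 1 0.
Proof.
rewrite (expand_det_row _ 0) !big_ord_recl big_ord0 /cofactor !det_mx11 !mxE /= addr0.
rewrite (_ : lift 0 0 = 1 :> 'I_2); last exact: ord_inj.
rewrite (_ : lift 1 0 = 0 :> 'I_2); last exact: ord_inj.
by rewrite expr0 expr1 mul1r mulN1r mulrN.
Qed.

Lemma det3 (M : 'M[R]_3) (o := inord : nat -> 'I_3) : \det M =
  M (o 0) (o 2) * (M (o 1) (o 0) * M (o 2) (o 1) - M (o 1) (o 1) * M (o 2) (o 0))
  - M (o 1) (o 2) * (M (o 0) (o 0) * M (o 2) (o 1) - M (o 0) (o 1) * M (o 2) (o 0))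
  + M (o 2) (o 2) * (M (o 0) (o 0) * M (o 1) (o 1) - M (o 0) (o 1) * M (o 1) (o 0)).
Proof.
pose G (i j : nat) := M (o i) (o j).
have E (i j : 'I_3) : M i j = G i j.
  by congr (M _ _); apply: ord_inj; rewrite inordK.
rewrite (expand_det_col _ (o 2)) !big_ord_recl big_ord0 /cofactor !det2 !mxE !E -/(G _ _).
rewrite /= !inordK //= /bump /= /G; ring.
Qed.

End Det.

Lemma split_lshift s t (j : 'I_s) : fintype.split (lshift t j) = inl j.
Proof. exact: (unsplitK (inl j)). Qed.
Lemma split_rshift s t (j : 'I_t) : fintype.split (rshift s j) = inr j.
Proof. exact: (unsplitK (inr j)). Qed.

Section RowSets.
Variables (R : realType) (N s : nat).
Hypothesis sN : (s <= N)%N.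

Definition rows t (a : t.-tuple 'I_N) : 'I_(s + t) -> 'I_N :=
  fun j => match fintype.split j with inl i => widen_ord sN i | inr i => tnth a i end.

Definition minor t (a : t.-tuple 'I_N) (A : 'M[R]_(N, s + t)) := \det (rowsub (rows a) A).

Lemma minor_rows t (a : t.-tuple 'I_N) (A : 'M[R]_(N, s)) (Z : 'M[R]_(N, t)) :
  (forall (i : 'I_N) j, (i < s)%N -> Z i j = 0) ->
  \det (rowsub (widen_ord sN) A) = 1 ->
  minor a (row_mx A Z) = \det (rowsub (tnth a) Z).
Proof.
move=> Z0 A1; rewrite /minor minor_block //; last first.
  by move=> j; rewrite /rows split_lshift.
rewrite -[RHS]mul1r; congr (_ * _); [rewrite -A1|]; congr (\det _);
  by apply/matrixP => i j; rewrite !mxE /rows /= ?split_lshift ?split_rshift.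
Qed.

Lemma minor_idcols t (a : t.-tuple 'I_N) (Z : 'M[R]_(N, t)) :
  (forall (i : 'I_N) j, (i < s)%N -> Z i j = 0) ->
  minor a (row_mx (idcols R N s) Z) = \det (rowsub (tnth a) Z).
Proof.
move=> Z0; apply: minor_rows => //.
by rewrite (_ : rowsub _ _ = 1%:M) ?det1 //; apply/matrixP => i j; rewrite !mxE.
Qed.

(** The first columns of a lower unitriangular matrix contribute a
unitriangular block. *)
Lemma minor_lcols t (a : t.-tuple 'I_N) (u : 'M[R]_N) : unilower u ->
  minor a (lcols (s + t) u) = \det (\matrix_(i, j) ent u (tnth a i) (s + j)%N).
Proof.
move=> uu.
have -> : lcols (s + t) u = row_mx (lcols s u) (\matrix_(i, j) ent u i (s + j)%N).
  by apply/matrixP => i j; case: (split_ordP j) => j' ->; rewrite ?row_mxEl ?row_mxEr !mxE.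
rewrite minor_rows.
- by congr (\det _); apply/matrixP => i j; rewrite !mxE.
- by move=> i j si; rewrite mxE ent_lower //; lia.
- rewrite det_trig.
    by apply: big1 => i _; rewrite !mxE ent_diag //; apply: leq_trans (ltn_ord _) sN.
  by apply/is_trig_mxP => i j ij; rewrite !mxE ent_lower.
Qed.

Lemma minor_mul t (a : t.-tuple 'I_N) (A : 'M[R]_(N, s + t)) C :
  minor a (A *m C) = minor a A * \det C.
Proof. exact: minor_mulr. Qed.

(** The shape of both inequalities: an expression which scales by the square
of a determinant under change of basis, so that its sign depends on the
subspace only. *)
Definition quad t (a b c d : t.-tuple 'I_N) (A : 'M[R]_(N, s + t)) : R :=
  minor a A * minor b A - minor c A * minor d A.

Lemma quad_mul t (a b c d : t.-tuple 'I_N) (A : 'M[R]_(N, s + t)) C :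
  quad a b c d (A *m C) = \det C ^+ 2 * quad a b c d A.
Proof. by rewrite /quad !minor_mul; ring. Qed.

Lemma quad_near t (a b c d : t.-tuple 'I_N) (A : 'M[R]_(N, s + t)) :
  quad a b c d A < 0 -> \forall A' \near A, quad a b c d A' < 0.
Proof.
have M e : minor e A' @[A' --> A] --> minor e A.
  exact: (tends_minor (f := rows e) (@tends_id _ _ _ A)).
have H : quad a b c d A' @[A' --> A] --> quad a b c d A.
  exact: (cvgB (cvgM (M a) (M b)) (cvgM (M c) (M d))).
by move=> q0; exact: (cvgr_lt (quad a b c d A) H _ q0).
Qed.

End RowSets.

Lemma ent_minor_ge0 (R : realType) N k v (u : 'M[R]_N) (a b : k.-tuple 'I_N) :
  Ycell v u -> incr (tnth a) -> incr (tnth b) ->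
  0 <= \det (\matrix_(i, j) ent u (tnth a i) (tnth b j)).
Proof.
move=> cu ai bi.
have := Ycell_nn cu (ucols_nn R bi) ai; congr (0 <= \det _).
apply/matrixP => i j; rewrite !mxE (bigD1 (tnth b j)) //= !mxE eqxx mulr1 entE.
by rewrite big1 ?addr0 // => l /negPf lj; rewrite mxE lj mulr0.
Qed.

Lemma incr_tuple2 N (a b : 'I_N) : (a < b)%N -> incr (tnth [tuple a; b]).
Proof. by move=> ab; case=> -[|[|//]] ? [[|[|//]] ?]. Qed.

Lemma incr_tuple3 N (a b c : 'I_N) : (a < b)%N -> (b < c)%N -> incr (tnth [tuple a; b; c]).
Proof.
move=> ab bc; have ac := ltn_trans ab bc.
by case=> -[|[|[|//]]] ? [[|[|[|//]]] ?].
Qed.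

Section Inequality.
Variables (R : realType) (N n : nat).
Hypothesis Nn : N = (2 * n)%N \/ N = (2 * n + 1)%N.
Variable w : seq 'I_n.
Hypothesis lw : longest_reduced_word w.
Let wn := map (@nat_of_ord n) w.
Variable K : {set 'I_n}.
Local Notation I := {k : 'I_n | k \in K}.
Local Notation Gflags :=
  ([set flag_of K u | u in (Gcell n wn : set 'M[R]_N)] : set (flag_space R N K)).

(** Negativity would persist on bases of nearby points of the Lusztig positive
part, and would then contradict the inequality for columns of elements of the
cell. *)
Lemma closure_quad s t (sN : (s <= N)%N) (a b c d : t.-tuple 'I_N) (k : I) L (A : 'M[R]_(N, s + t)) :
  (val k).+1 = (s + t)%N ->
  (forall u : 'M[R]_N, Gcell n wn u -> 0 <= quad sN a b c d (lcols (s + t) u)) ->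
  closure Gflags L -> colspan A = L k -> \rank A = (s + t)%N ->
  0 <= quad sN a b c d A.
Proof.
move=> kst pos cL eA rA; rewrite leNgt; apply/negP => q0.
have [_ [A' [_ [[u cu <-] [q0' _] eA' _ [rA' _]]]]] :=
  closure_lift cL eA eA rA rA (quad_near q0) (quad_near q0).
move: eA'; rewrite flag_colspan; last by lia.
rewrite kst => /(colspan_eq rA')[C uC A'E].
move: q0'; rewrite A'E quad_mul ltNge mulr_ge0 ?sqr_ge0 //; exact: pos.
Qed.

(** By [subdiag_sym] the quadratic form is the 2 x 2 minor of [u] with rows N
- 2 - k0, N - 1 - k0 and columns k0, N - 2 - k0. *)
Lemma quad_gap_ge0 k0 (k0N : (k0 <= N)%N) (a b c d : 'I_N) (u : 'M[R]_N) : (k0.+2 <= n)%N ->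
  a = k0.+1 :> nat -> b = (N - 2 - k0)%N :> nat -> c = k0 :> nat ->
  d = (N - 1 - k0)%N :> nat -> Gcell n wn u ->
  0 <= quad k0N [tuple a] [tuple b] [tuple c] [tuple d] (lcols (k0 + 1) u).
Proof.
move=> kn ea eb ec ed cu.
have uu := Gcell_unilower cu.
have su := Gcell_sigma Nn (wn_lt w) cu.
rewrite /quad !minor_lcols // !det_mx11 !mxE !addn0 /= !(tnth_nth a) /=.
rewrite ec ent_diag //; last by lia.
have := ent_minor_ge0 (Gcell_Ycell (wn_lt w) cu) (a := [tuple b; d]) (b := [tuple c; b]).
rewrite det2 !mxE !(tnth_nth a) /= eb ed ec (subdiag_sym Nn kn uu su) ent_diag //; last by lia.
rewrite ea => H; have := H _ _; rewrite !mul1r mulrC; apply; apply: incr_tuple2; lia.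
Qed.

(** The case k0 = n - 2 of odd size. The quadratic form is the minor of [u]
with rows s + 3, s + 4, s + 5 and columns s, s + 1, s + 4, expanded along its
last column and rewritten with [subdiag_sym]. *)
Lemma quad_odd_ge0 s (sN : (s <= N)%N) (a0 a1 a2 a3 a4 a5 : 'I_N) (u : 'M[R]_N) : 
  N = (2 * s + 7)%N -> a0 = s :> nat -> a1 = s.+1 :> nat -> a2 = s.+2 :> nat ->
  a3 = (s + 3)%N :> nat -> a4 = (s + 4)%N :> nat -> a5 = (s + 5)%N :> nat -> Gcell n wn u ->
  0 <= quad sN [tuple a0; a2] [tuple a3; a4] [tuple a0; a1] [tuple a3; a5] (lcols (s + 2) u).
Proof.
move=> Ns e0 e1 e2 e3 e4 e5 cu.
have uu := Gcell_unilower cu.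
have su := Gcell_sigma Nn (wn_lt w) cu.
have ns : n = (s + 3)%N by lia.
have kn : (s.+1.+2 <= n)%N by lia.
have sym := subdiag_sym Nn kn uu su.
rewrite (_ : N - 1 - s.+1 = s + 5)%N in sym; last by lia.
rewrite (_ : N - 2 - s.+1 = s + 4)%N in sym; last by lia.
have := ent_minor_ge0 (Gcell_Ycell (wn_lt w) cu) (a := [tuple a3; a4; a5]) (b := [tuple a0; a1; a4]).
rewrite det3 !mxE !(tnth_nth a0) /= !inordK //= => H.
have {}H := H (incr_tuple3 _ _) (incr_tuple3 _ _).
move: H; rewrite /quad !minor_lcols // !det2 !mxE !(tnth_nth a0) /=.
rewrite e0 e1 e2 e3 e4 e5 sym !addn0 !addn1.
rewrite (ent_diag uu (r := (s + 4)%N)); last by lia.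
rewrite (ent_diag uu (r := s)); last by lia.
rewrite (ent_diag uu (r := s.+1)); last by lia.
rewrite (@ent_lower _ _ _ s s.+1) // (@ent_lower _ _ _ (s + 3) (s + 4)) //; last by lia.
move=> H.
have le0 (x y : R) : (x = y) -> 0 <= x -> 0 <= y by move=> ->.
apply: (le0 _ _ _ (H _ _ _ _)); [ring|lia..].
Qed.

End Inequality.

(** * Nonnegative flags violating the inequalities *)

Section Witness.
Variables (R : realType) (N n : nat).
Hypothesis Nn : N = (2 * n)%N \/ N = (2 * n + 1)%N.
Local Notation J := (altform R N).
Variable K : {set 'I_n}.
Local Notation I := {k : 'I_n | k \in K}.

Lemma isotropic_sub (L M : {vspace 'cV[R]_N}) : (L <= M)%VS -> isotropic J M -> isotropic J L.
Proof. by move=> LM h u v uL vL; apply: h; apply: (subvP LM). Qed.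

Lemma rank_lcols m (g : 'M[R]_N) : (m <= N)%N -> unilower g -> \rank (lcols m g) = m.
Proof.
move=> mN ug; apply: (posmat_rank (f := widen_ord mN)).
rewrite det_trig; first by rewrite big1 // => i _; rewrite !mxE ent_diag //=; have := ltn_ord i; lia.
by apply/is_trig_mxP => i j ij; rewrite !mxE ent_lower.
Qed.

(** Flags of columns that need not come from an isometry. *)
Lemma flag_of_nonneg (g : 'M[R]_N) :
  (forall k : I, \rank (lcols (val k).+1 g) = (val k).+1) ->
  (forall k : I, isotropic J (colspan (lcols (val k).+1 g))) ->
  (forall k : I, exists m (B : 'M[R]_(N, m)), [/\ m = (val k).+1, 
     colspan B = colspan (lcols (val k).+1 g) & nnmat B]) ->
  (isoFl J K `&` FlDnonneg K) (flag_of K g).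
Proof.
move=> rk iso nn.
have fE (k : I) : flag_of K g k = colspan (lcols (val k).+1 g) :> {vspace _}.
  by apply: flag_colspan; lia.
have dk (k : I) : \dim (flag_of K g k : {vspace _}) = (val k).+1.
  by rewrite fE; apply/dim_colspan.
have h : Fl K (flag_of K g) by split=> // k l kl; rewrite !fE; exact: lcols_sub.
split; split=> // k; first by rewrite fE.
have [m [B [em eB nB]]] := nn k.
by apply/(plucker_nonnegP (etrans (dk k) (esym em))); exists B; rewrite fE.
Qed.

Lemma nnmat_idcols m : (m <= N)%N -> nnmat (idcols R N m).
Proof. by move=> mN; rewrite (idcolsE R mN); apply: ucols_nn; exact: widen_incr. Qed.

(** The flag of columns of [g] in which column [k0] is replaced by [x]. It is
compatible with the members of larger dimension as soon as they contain [x],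
which allows [x] to leave the span of the first k0 + 2 columns of [g] when k0
+ 2 is not one of the dimensions. *)
Lemma vector_flag (k0 : I) (g : 'M[R]_N) (x : 'cV[R]_N) :
  unilower g -> sigma_rel g g -> (forall m, (m <= N)%N -> nnmat (lcols m g)) ->
  lcols (val k0) g = idcols R N (val k0) ->
  (forall r : 'I_N, (r < val k0)%N -> x r 0 = 0) ->
  (forall r : 'I_N, r = val k0 :> nat -> x r 0 = 1) -> (forall r, 0 <= x r 0) ->
  (forall k : I, (val k0 < val k)%N -> x \in colspan (lcols (val k).+1 g)) ->
  isotropic J (colspan (row_mx (idcols R N (val k0)) x)) ->
  exists L, [/\ (isoFl J K `&` FlDnonneg K) L,
    L k0 = colspan (row_mx (idcols R N (val k0)) x) &
    \rank (row_mx (idcols R N (val k0)) x) = (val k0 + 1)%N].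
Proof.
move=> ug sg ng idg x0 x1 xp xk iso.
have kN (k : I) : ((val k).+1 <= N)%N by have := ltn_ord (val k); lia.
pose g' : 'M[R]_N := \matrix_(i, j) if j == val k0 :> nat then x i 0 else g i j.
have ug' : unilower g'.
  split=> [r s rs|r]; rewrite mxE; case: eqP => e.
  - by apply: x0; rewrite -e.
  - by case: ug => lo _; apply: lo.
  - exact: x1.
  - by case: ug => _; apply.
have idg' m : (m <= val k0)%N -> lcols m g' = idcols R N m.
  move=> mk; apply/matrixP => i j; rewrite !mxE.
  have jk := leq_trans (ltn_ord j) mk.
  have jN : (j < N)%N by have := kN k0; lia.
  rewrite (ent_Ordinal _ (ltn_ord i) jN) mxE /= ltn_eqF //.
  have := congr1 (fun M : 'M_(N, _) => M i (Ordinal jk)) idg; rewrite !mxE /= => <-.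
  by rewrite (ent_Ordinal _ (ltn_ord i) jN).
have k0E : lcols (val k0 + 1) g' = row_mx (idcols R N (val k0)) x.
  rewrite -(idg' _ (leqnn _)); apply/matrixP => i j.
  case: (split_ordP j) => j' ->; rewrite ?row_mxEl ?row_mxEr !mxE //=.
  rewrite ord1 addn0 (ent_Ordinal _ (ltn_ord i) (kN k0)) mxE /= eqxx.
  by congr (x _ _); exact: ord_inj.
have gk (k : I) : (val k0 < val k)%N ->
    colspan (lcols (val k).+1 g') = colspan (lcols (val k).+1 g).
  move=> kk; apply/eqP; rewrite eqEdim; apply/andP; split; last first.
    by rewrite !(proj1 (dim_colspan _)) // rank_lcols.
  apply/span_subvP => _ /mapP[j _ ->].
  case: (eqVneq (j : nat) (val k0)) => [e|ne].
    rewrite (_ : col j _ = x); first exact: xk.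
    apply/colP => i; rewrite !mxE e (ent_Ordinal _ (ltn_ord i) (kN k0)) mxE /= eqxx.
    by congr (x _ _); exact: ord_inj.
  apply: memv_span; apply/mapP; exists j; first by rewrite mem_enum.
  have jN := leq_trans (ltn_ord j) (kN k).
  apply/colP => i; rewrite !mxE !(ent_Ordinal _ (ltn_ord i) jN) mxE /= (negPf ne).
  by [].
exists (flag_of K g'); split.
- apply: flag_of_nonneg => k; first by apply: rank_lcols.
  + case: (ltngtP (val k) (val k0)) => kk.
    * apply: isotropic_sub (_ : (_ <= colspan (lcols (val k0 + 1) g'))%VS) _.
        by apply: lcols_sub; lia.
      by rewrite k0E.
    * rewrite gk //; apply/isotropic_colspan; apply: (lcols_isotropic Nn) => //.
      by have := ltn_ord (val k); lia.
    * by rewrite kk -addn1 k0E.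
  + case: (ltngtP (val k) (val k0)) => kk.
    * exists (val k).+1, (idcols R N (val k).+1); split=> //; first by rewrite idg'.
      exact: nnmat_idcols.
    * by exists (val k).+1, (lcols (val k).+1 g); split; rewrite ?gk //; exact: ng.
    * exists (val k0 + 1)%N, (row_mx (idcols R N (val k0)) x).
      split; [by rewrite kk addn1 | by rewrite kk -[(val k0).+1]addn1 k0E|].
      apply: nnmat_block; [exact: ltnW | by move=> i j ik; rewrite ord1 x0|].
      by move=> f _; rewrite det_mx11 mxE.
- by rewrite flag_colspan; [rewrite -[(val k0).+1]addn1 k0E|lia].
- by rewrite -k0E rank_lcols // addn1.
Qed.

End Witness.

Section Push.
Variables (R : realType) (N n : nat).
Hypothesis Nn : N = (2 * n)%N \/ N = (2 * n + 1)%N.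

Definition vec (f : nat -> R) : 'cV[R]_N := \col_i f i.

Lemma rw_vec f r c : rw (vec f) r c = if (r < N)%N then f r else 0.
Proof.
case: ifP => rN; first by rewrite -[r]/(nat_of_ord (Ordinal rN)) rwE mxE.
by rewrite rw_ge // leqNgt rN.
Qed.

Lemma vec_colspan f m (g : 'M[R]_N) : (m <= N)%N -> (forall r, (m <= r)%N -> f r = 0) ->
  g *m vec f \in colspan (lcols m g).
Proof.
move=> mN f0; apply/colspanP; exists (\col_i f i); rewrite (lcolsE mN) -mulmxA; congr (_ *m _).
apply/colP => i; rewrite !mxE; case: (ltnP i m) => im.
  rewrite (bigD1 (Ordinal im)) //= !mxE (_ : i == _) ?mul1r; last by rewrite -val_eqE.
  by rewrite big1 ?addr0 // => l ll; rewrite !mxE; case: eqP => [e|]; rewrite ?mul0r //;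
    case/negP: ll; rewrite -val_eqE /= e.
rewrite f0 // big1 // => l _; rewrite !mxE; case: eqP => [e|]; rewrite ?mul0r //.
by move: im; rewrite e /= leqNgt ltn_ord.
Qed.

Lemma elem_fix k p q a (B : 'M[R]_(N, k)) : (forall c, rw B q c = 0) -> elem N p q a *m B = B.
Proof. by move=> B0; apply/matrixP => r c; rewrite elemE B0 !mulr0 addr0. Qed.

Lemma Gy_fix k a i t (B : 'M[R]_(N, k)) : (a <= i < n)%N ->
  (forall r c, (a <= r)%N -> rw B r c = 0) -> Gy N n i t *m B = B.
Proof.
move=> /andP[ai iln] B0; rewrite /Gy; case: ifP => h.
  by rewrite -mulmxA !elem_fix // => c; apply: B0; lia.
case: ifP => _; first by rewrite elem_fix // => c; exact: B0.
by rewrite -!mulmxA !elem_fix // => c; apply: B0; lia.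
Qed.

(** Letters from [a] on act trivially on vectors supported before [a]. *)
Lemma gY_fix k a v t (B : 'M[R]_(N, k)) : all (fun i => a <= i < n)%N v ->
  (forall r c, (a <= r)%N -> rw B r c = 0) -> gY N n v t *m B = B.
Proof.
move=> + B0; elim: v => [|i v IH] /=; first by rewrite mul1mx.
by move=> /andP[ai /IH e]; rewrite -mulmxA e (Gy_fix _ ai).
Qed.

Definition nnrows k (B : 'M[R]_(N, k)) := forall r c, 0 <= rw B r c.

Lemma rw_elem_ge k p q a (B : 'M[R]_(N, k)) r c : 0 <= a -> nnrows B ->
  rw B r c <= rw (elem N p q a *m B) r c.
Proof.
move=> a0 nB; case: (ltnP r N) => rN; last by rewrite !rw_ge.
by rewrite rw_elem // lerDl !mulr_ge0.
Qed.

Lemma rw_elem_gt k p q a (B : 'M[R]_(N, k)) c : 0 < a -> nnrows B -> (p < N)%N ->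
  0 < rw B q c -> 0 < rw (elem N p q a *m B) p c.
Proof.
move=> a0 nB pN q0; rewrite rw_elem // eqxx mul1r.
by apply: ltr_wpDl; [exact: nB | exact: mulr_gt0].
Qed.

Lemma nnrows_elem k p q a (B : 'M[R]_(N, k)) : 0 <= a -> nnrows B -> nnrows (elem N p q a *m B).
Proof. by move=> a0 nB r c; apply: le_trans (nB r c) (rw_elem_ge _ _ _ _ _ _). Qed.

Local Notation s2 := (Num.sqrt 2 : R).

Lemma nnrows_Gy k i a (B : 'M[R]_(N, k)) : 0 <= a -> nnrows B -> nnrows (Gy N n i a *m B).
Proof.
move=> a0 nB; have s0 := sq2_gt0 R.
have a1 : 0 <= a / s2 by rewrite divr_ge0 // ltW.
have a2 : 0 <= s2 * a by rewrite mulr_ge0 // ltW.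
rewrite /Gy; case: ifP => _; first by rewrite -mulmxA; do ?apply: nnrows_elem.
case: ifP => _; first exact: nnrows_elem.
by rewrite -!mulmxA; do ?apply: nnrows_elem.
Qed.

Lemma nnrows_gY k v (B : 'M[R]_(N, k)) : nnrows B -> nnrows (gY N n v 1 *m B).
Proof.
move=> nB; elim: v => [|i v IH] /=; first by rewrite mul1mx.
by rewrite -mulmxA; apply: nnrows_Gy.
Qed.

Section Reach.
Variables (k a : nat) (B : 'M[R]_(N, k)) (c : 'I_k).
Hypothesis nB : nnrows B.
Definition reach r := exists v, all (fun i => a <= i < n)%N v /\ 0 < rw (gY N n v 1 *m B) r c.

Lemma reach_down i : (a <= i)%N -> (i.+1 < n)%N -> reach i -> reach i.+1.
Proof.
move=> ai iln [v [av pv]]; exists (i :: v); split; first by rewrite /= av ai ltnW.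
have nv := nnrows_gY v nB.
rewrite /= -!mulmxA /Gy iln -mulmxA; apply: rw_elem_gt => //; [exact: nnrows_elem | lia|].
by apply: lt_le_trans pv _; exact: rw_elem_ge.
Qed.

Lemma reach_up i : (a <= i)%N -> (i.+1 < n)%N -> reach (N - 2 - i) -> reach (N - 1 - i).
Proof.
move=> ai iln [v [av pv]]; exists (i :: v); split; first by rewrite /= av ai ltnW.
have nv := nnrows_gY v nB.
rewrite /= -!mulmxA /Gy iln -mulmxA.
apply: lt_le_trans (rw_elem_ge _ _ _ _ _ _) => //; last exact: nnrows_elem.
by rewrite (_ : N - 1 - i = (N - 2 - i).+1)%N; [apply: rw_elem_gt => // |]; lia.
Qed.

Lemma reach_mid : (a < n)%N -> reach n.-1 -> reach (N - n).
Proof.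
move=> an [v [av pv]]; exists (n.-1 :: v); split; first by rewrite /= av; lia.
have nv := nnrows_gY v nB; have s0 := sq2_gt0 R.
have a1 : 0 < 1 / s2 by rewrite divr_gt0.
have a2 : 0 < s2 * 1 by rewrite mulr_gt0.
rewrite /= -!mulmxA /Gy (_ : (_ < n)%N = false); last by lia.
case: eqP => h.
  by rewrite (_ : N - n = n.-1.+1)%N; [apply: rw_elem_gt => //|]; lia.
have Ne : N = (2 * n + 1)%N by case: Nn.
rewrite -!mulmxA; apply: lt_le_trans (rw_elem_ge _ _ _ _ _ _); last 2 first.
- exact: ltW.
- by do ?[apply: nnrows_elem => //; try exact: ltW].
rewrite (_ : N - n = n.-1.+2)%N; last by lia.
apply: rw_elem_gt => //; [by apply: nnrows_elem => //; exact: ltW | lia|].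
by apply: rw_elem_gt => //; lia.
Qed.

(** From [a] one goes down to the middle and then, with the same letters in
the opposite order, to the mirror image of [a]. *)
Lemma reach_rev : (a < n)%N -> reach a -> reach (N - 1 - a).
Proof.
move=> an ra.
have down m : (a <= m < n)%N -> reach m.
  elim: m => [|m IH] /andP[am mn]; first by rewrite (_ : 0%N = a) //; lia.
  case: (leqP a m) => h; first by apply: reach_down => //; apply: IH; lia.
  by rewrite (_ : m.+1 = a) //; lia.
have up d : (d < n - a)%N -> reach (N - n + d).
  elim: d => [|d IH] dn; first by rewrite addn0; apply: reach_mid => //; apply: down; lia.
  have := IH (ltnW dn).
  rewrite (_ : N - n + d = N - 2 - (n - 2 - d))%N; last by lia.
  rewrite (_ : N - n + d.+1 = N - 1 - (n - 2 - d))%N; last by lia.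
  by apply: reach_up; lia.
by rewrite (_ : N - 1 - a = N - n + (n.-1 - a))%N; [apply: up|]; lia.
Qed.

End Reach.
End Push.

Section Gap.
Variables (R : realType) (N n : nat).
Hypothesis Nn : N = (2 * n)%N \/ N = (2 * n + 1)%N.
Local Notation J := (altform R N).
Variable w : seq 'I_n.
Hypothesis lw : longest_reduced_word w.
Let wn := map (@nat_of_ord n) w.
Variable K : {set 'I_n}.
Local Notation I := {k : 'I_n | k \in K}.
Local Notation Gflags :=
  ([set flag_of K u | u in (Gcell n wn : set 'M[R]_N)] : set (flag_space R N K)).

(** On the flag of [vector_flag] the quadratic form of [quad_gap_ge0] takes
the value x_{k0+1} x_{N-2-k0} - x_{k0} x_{N-1-k0}, which is negative. *)
Lemma gap_of_vector (k0 : I) (g : 'M[R]_N) (x : nat -> R) : ((val k0).+2 <= n)%N ->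
  unilower g -> sigma_rel g g -> (forall m, (m <= N)%N -> nnmat (lcols m g)) ->
  lcols (val k0) g = idcols R N (val k0) ->
  (forall r, (r < val k0)%N -> x r = 0) -> x (val k0) = 1 -> x (val k0).+1 = 0 ->
  (forall r, 0 <= x r) -> 0 < x (N - 1 - val k0)%N ->
  (forall k : I, (val k0 < val k)%N -> vec N x \in colspan (lcols (val k).+1 g)) ->
  isotropic J (colspan (row_mx (idcols R N (val k0)) (vec N x))) ->
  closure Gflags <> isoFl J K `&` FlDnonneg K.
Proof.
move=> kn ug sg ng idg x0 x1 x2 xp xe xk iso eqc.
have [|||L [LX LE rL]] := vector_flag Nn ug sg ng idg (x := vec N x) (k0 := k0) _ _ _ xk iso.
- by move=> r rk; rewrite mxE x0.
- by move=> r rk; rewrite mxE rk.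
- by move=> r; rewrite mxE.
have k0N : (val k0 <= N)%N by lia.
have aN : ((val k0).+1 < N)%N by lia.
have bN : (N - 2 - val k0 < N)%N by lia.
have cN : (val k0 < N)%N by lia.
have dN : (N - 1 - val k0 < N)%N by lia.
rewrite -eqc in LX.
have := closure_quad Nn (sN := k0N) (a := [tuple Ordinal aN]) (b := [tuple Ordinal bN])
  (c := [tuple Ordinal cN]) (d := [tuple Ordinal dN]) (esym (addn1 _)) _ LX (esym LE) rL.
have pos (u : 'M[R]_N) : Gcell n wn u -> 0 <= quad k0N [tuple Ordinal aN] [tuple Ordinal bN]
    [tuple Ordinal cN] [tuple Ordinal dN] (lcols (val k0 + 1) u).
  by move=> cu; exact: (quad_gap_ge0 Nn k0N kn _ _ _ _ cu).
move=> /(_ pos).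
have x0' (i : 'I_N) (j : 'I_1) : (i < val k0)%N -> vec N x i j = 0.
  by move=> ik; rewrite mxE x0.
rewrite /quad !minor_idcols // !det_mx11 !mxE.
by rewrite !(tnth_nth (Ordinal aN)) /= x1 x2 mul0r mul1r sub0r oppr_ge0 leNgt xe.
Qed.

(** A generator away from the middle moves entry [i] to [i.+1] and entry N - 2
- i to N - 1 - i. *)
Lemma rw_Gy k (B : 'M[R]_(N, k)) i r c : (i.+1 < n)%N -> (r < N)%N ->
  rw (Gy N n i 1 *m B) r c =
  rw B r c + (r == N - 1 - i)%N%:R * rw B (N - 2 - i) c + (r == i.+1)%:R * rw B i c.
Proof.
move=> iln rN; rewrite /Gy iln -mulmxA /Y rw_elem // rw_elem // !mul1r.
rewrite (_ : (N - 2 - i).+1 = N - 1 - i)%N; last by lia.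
rewrite [rw _ i c]rw_elem_ne //; apply/eqP; lia.
Qed.

(** With p = k0 and a = p + 2, the vector is g (e_p - e_{p+1} + e_a) where g =
y_p(1) y_{p+1}(1) h and h is a product of generators with letters from [a] on
that sends e_a to a nonnegative vector with a positive entry at N - 1 - a. The
negative coefficient at p + 1 is designed to cancel the entries that the two
generators create at p + 1 and [a], while they carry the positive entry at N -
1 - a on to N - 1 - p. Since the vector is in the span of the first p + 3
columns of the isometry [g], it fits in the flag of [g]. *)
Lemma gap_far (k0 : I) : ((val k0).+3 <= n)%N ->
  (forall k : I, val k <> (val k0).+1 :> nat) ->
  closure Gflags <> isoFl J K `&` FlDnonneg K.
Proof.
move=> kn gap; pose p := nat_of_ord (val k0); pose a := p.+2.
have [v [av pv]] : reach n a (vec N (fun r => (r == a)%:R) : 'cV[R]_N) 0 (N - 1 - a).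
  apply: (reach_rev Nn) => //.
    by move=> r c; rewrite rw_vec; case: ifP => _; rewrite ?ler0n.
  exists [::]; split=> //=; rewrite mul1mx rw_vec eqxx (_ : (a < N)%N) ?ltr01 //.
  by rewrite /a /p; lia.
pose h : 'M[R]_N := gY N n v 1.
pose z r := rw (h *m vec N (fun r => (r == a)%:R)) r 0.
pose g := gY N n (p :: p.+1 :: v) 1 : 'M[R]_N.
have av' : all (fun i => i < n)%N (p :: p.+1 :: v).
  apply/allP => i; rewrite !inE => /or3P[/eqP->|/eqP->|/(allP av)]; rewrite /p; lia.
have cg : Ycell (unfold N n (p :: p.+1 :: v)) g.
  by apply: Gcell_Ycell => //; apply: gY_cell; exact: ltr01.
pose e r : R := (r == p)%:R - (r == p.+1)%:R + (r == a)%:R.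
have uh : unilower h.
  apply: (Ycell_unilower (v := unfold N n v)); apply: Gcell_Ycell; last first.
    by apply: gY_cell; exact: ltr01.
  by apply/allP => i /(allP av) /andP[].
have zE r : (r < N)%N -> z r = ent h r a.
  move=> rN; have aN : (a < N)%N by rewrite /a /p; lia.
  rewrite (ent_Ordinal _ rN aN) /z -[r in rw _ r]/(nat_of_ord (Ordinal rN)) rwE mxE.
  rewrite (bigD1 (Ordinal aN)) //= mxE eqxx mulr1 big1 ?addr0 // => l.
  by rewrite -val_eqE mxE /= => /negPf->; rewrite mulr0.
have zl r : (r < a)%N -> z r = 0.
  by move=> ra; rewrite zE ?ent_lower //; move: ra; rewrite /a /p; lia.
have za : z a = 1 by rewrite zE ?ent_diag // /a /p; lia.
have zp r : 0 <= z r.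
  by apply: nnrows_gY => r' c; rewrite rw_vec; case: ifP => _; rewrite ?ler0n.
pose b r := rw (h *m vec N e) r 0.
have bE r : (r < N)%N -> b r = (r == p)%:R - (r == p.+1)%:R + z r.
  move=> rN; rewrite /b /z (_ : vec N e = vec N (fun r => (r == p)%:R - (r == p.+1)%:R) +
      vec N (fun r => (r == a)%:R)); last by apply/colP => l; rewrite !mxE.
  rewrite mulmxDr [h *m vec N (fun r => _ - _)](gY_fix Nn _ av); last first.
    move=> r' c ar; rewrite rw_vec; case: ifP => // _.
    by rewrite !gtn_eqF ?subr0 //; move: ar; rewrite /a; lia.
  by rewrite -[r in LHS]/(nat_of_ord (Ordinal rN)) rwE mxE -!rwE /= rw_vec rN.
pose x r := rw (g *m vec N e) r 0.
have xE r : (r < N)%N -> x r = b r + (r == N - 2 - p)%N%:R * b (N - 3 - p)%N +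
    (r == p.+2)%:R * b p.+1 + (r == N - 1 - p)%N%:R * (b (N - 2 - p)%N + b (N - 3 - p)%N)
    + (r == p.+1)%:R * b p.
  move=> rN; rewrite /x /g /= -!mulmxA rw_Gy ?rw_Gy //; try by rewrite /p; lia.
  rewrite -/h -!/(b _).
  rewrite (_ : N - 1 - p.+1 = N - 2 - p)%N; last by lia.
  rewrite (_ : N - 2 - p.+1 = N - 3 - p)%N; last by lia.
  rewrite eqxx (_ : (p == p.+2) = false) ?mul0r ?addr0; last by lia.
  rewrite (_ : (N - 2 - p == p.+2)%N = false) ?mul0r ?addr0 ?mul1r; last by rewrite /p; lia.
  by rewrite (_ : (p == N - 2 - p)%N = false) ?mul0r ?addr0 //; rewrite /p; lia.
have xV : vec N x = g *m vec N e by apply/colP => i; rewrite mxE -rwE.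
have xge r : (N <= r)%N -> x r = 0 by move=> rN; rewrite /x rw_ge.
have pz : 0 < z (N - 1 - a)%N by exact: pv.
have ek : forall r, (a < r)%N -> e r = 0.
  by move=> r; rewrite /e /a => ar; rewrite !gtn_eqF ?subrr ?addr0 //; lia.
have pk : p = val k0 by [].
clearbody x b z e.
have [pN p1N aN] : [/\ (p < N)%N, (p.+1 < N)%N & (a < N)%N] by rewrite /a /p; split; lia.
have [f1 f2 f3] : [/\ (p < a)%N, (p.+1 < a)%N & (a = p.+2)%N] by rewrite /a; split; lia.
have [q1 q2 q3] : [/\ (N - 1 - p < N)%N, (a < N - 2 - p)%N & (N - 1 - p = (N - 2 - p).+1)%N].
  by rewrite /a /p; split; lia.
have q4 : (N - 3 - p = N - 1 - a)%N by rewrite /a /p; lia.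
have q5 : (a <= N - 1 - a)%N by rewrite /a /p; lia.
have bz r : (a <= r)%N -> (r < N)%N -> b r = z r.
  by move=> ar rN; rewrite bE // !gtn_eqF ?subrr ?add0r //; lia.
have bp : b p = 1.
  by rewrite bE // eqxx (_ : (p == p.+1) = false) ?zl // ?subr0 ?addr0 //; lia.
have bp1 : b p.+1 = -1.
  by rewrite bE // eqxx (_ : (p.+1 == p) = false) ?zl // ?sub0r ?addr0 //; lia.
have bl r : (r < p)%N -> b r = 0.
  move=> rp; have [rN ra] : (r < N)%N /\ (r < a)%N by lia.
  rewrite bE // zl // !ltn_eqF ?subrr ?addr0 //; lia.
have b3 : b (N - 3 - p)%N = z (N - 1 - a)%N by rewrite q4 bz //; lia.
have b2 : 0 <= b (N - 2 - p)%N by rewrite bz ?zp //; lia.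
have xl r : (r < p)%N -> x r = 0.
  move=> rp; have rN : (r < N)%N by lia.
  rewrite xE // bl // (_ : (r == N - 2 - p)%N = false); last by lia.
  rewrite (_ : (r == p.+2) = false); last by lia.
  rewrite (_ : (r == N - 1 - p)%N = false); last by lia.
  rewrite (_ : (r == p.+1) = false); last by lia.
  by rewrite !mul0r !addr0.
have xp : x p = 1.
  rewrite xE // bp (_ : (p == N - 2 - p)%N = false); last by lia.
  rewrite (_ : (p == p.+2) = false); last by lia.
  rewrite (_ : (p == N - 1 - p)%N = false); last by lia.
  rewrite (_ : (p == p.+1) = false); last by lia.
  by rewrite !mul0r !addr0.
have xp1 : x p.+1 = 0.
  rewrite xE // bp bp1 eqxx mul1r (_ : (p.+1 == N - 2 - p)%N = false); last by lia.
  rewrite (_ : (p.+1 == p.+2) = false); last by lia.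
  rewrite (_ : (p.+1 == N - 1 - p)%N = false); last by lia.
  by rewrite !mul0r !addr0 addNr.
have xp2 : x a = 0.
  rewrite xE // bz // za bp1 f3 eqxx mul1r (_ : (p.+2 == N - 2 - p)%N = false); last by lia.
  rewrite (_ : (p.+2 == p.+1) = false); last by lia.
  rewrite (_ : (p.+2 == N - 1 - p)%N = false); last by lia.
  by rewrite !mul0r !addr0 subrr.
have xb r : (a < r)%N -> (r < N)%N -> z r <= x r.
  move=> ar rN; rewrite xE // (_ : (r == p.+2) = false); last by lia.
  rewrite (_ : (r == p.+1) = false); last by lia.
  rewrite bz // ?(ltnW ar) // !mul0r !addr0 -addrA lerDl b3.
  by rewrite addr_ge0 // mulr_ge0 ?ler0n ?addr_ge0.
have xnn r : 0 <= x r.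
  case: (ltnP r N) => rN; last by rewrite xge.
  case: (ltngtP r a) => [ra|ra|->]; last by rewrite xp2.
    case: (ltngtP r p) => [rp|rp|->]; [by rewrite xl| |by rewrite xp ler01].
    by rewrite (_ : r = p.+1) ?xp1 //; lia.
  exact: le_trans (zp r) (xb r ra rN).
have xe : 0 < x (N - 1 - p)%N.
  rewrite xE // eqxx mul1r b3 (_ : (N - 1 - p == N - 2 - p)%N = false); last by lia.
  rewrite (_ : (N - 1 - p == p.+2)%N = false); last by lia.
  rewrite (_ : (N - 1 - p == p.+1)%N = false); last by lia.
  rewrite !mul0r !addr0 bz //; last by lia.
  by apply: ltr_wpDl => //; apply: ltr_wpDl.
have ug : unilower g := Ycell_unilower cg.
have sg : sigma_rel g g.
  by apply: (Gcell_sigma Nn av'); apply: gY_cell; exact: ltr01.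
have xin m : (a < m <= N)%N -> vec N x \in colspan (lcols m g).
  by move=> am; rewrite xV; apply: vec_colspan; [lia|move=> r mr; apply: ek; lia].
have idg : lcols p g = idcols R N p.
  rewrite -[g]mulmx1 lcols_mul ?lcols1 ?(ltnW pN) //; apply: (gY_fix (a := p) Nn).
    by apply/allP => i; rewrite !inE => /or3P[/eqP->|/eqP->|/(allP av)]; rewrite /a /p; lia.
  move=> r c pr; rewrite /rw; case: insubP => // i _ ei; rewrite mxE.
  by rewrite gtn_eqF // (leq_trans (ltn_ord c)) // ei.
apply: (gap_of_vector (k0 := k0) (g := g) (x := x)) => //; first by lia.
- move=> m mN; rewrite (lcolsE mN); apply: (Ycell_nn cg); apply: ucols_nn; exact: widen_incr.
- move=> k kk; apply: xin; have := gap k; have := ltn_ord (val k); move: kk; rewrite /a /p; lia.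
- apply: (@isotropic_sub _ _ _ (colspan (lcols n g))); last first.
    by apply/isotropic_colspan; apply: (lcols_isotropic Nn) => //; lia.
  apply/span_subvP => _ /mapP[j _ ->]; case: (split_ordP j) => j' ->.
    rewrite colKl -idg; apply: (subvP (@lcols_sub _ _ p n g _)); first by rewrite /p; lia.
    by apply: memv_span; apply/mapP; exists j' => //; rewrite mem_enum.
  rewrite colKr (_ : col j' _ = vec N x); last by apply/colP => i; rewrite !mxE.
  by apply: xin; rewrite /a /p; lia.
Qed.

(** With p = k0 = n - 2, no member of the flag has dimension larger than p +
1, and e_p + e_{N-1-p} is isotropic for an alternating form. *)
Lemma gap_even (k0 : I) : N = (2 * n)%N -> (val k0).+2 = n ->
  (forall k : I, val k <> (val k0).+1 :> nat) ->
  closure Gflags <> isoFl J K `&` FlDnonneg K.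
Proof.
move=> Ne kn gap; pose p := nat_of_ord (val k0).
pose M : 'M[R]_N := elem N (N - 1 - p) p 1.
have pN : (p < N)%N by rewrite /p; lia.
have sM : sigma_rel M M.
  rewrite /sigma_rel {1}/M tr_elem -mulmxA.
  have qN : (N - 1 - p < N)%N by lia.
  apply/matrixP => r s; rewrite elemE.
  have rN := ltn_ord r; have sN := ltn_ord s.
  rewrite -[(N - 1 - p)%N]/(nat_of_ord (Ordinal qN)) rwE.
  rewrite (@altformE _ _ _ _ (Ordinal qN) (Ordinal pN)) /=; last by lia.
  rewrite (@altformE _ _ _ _ r (rev_ord r)) /=; last by lia.
  rewrite /M /elem !mxE -!val_eqE /= !eqSS.
  rewrite (_ : (N - r.+1 == s)%N = ((r + s).+1 == N)); last by lia.
  rewrite (_ : (N - r.+1 == N - 1 - p)%N = (r == p :> nat)); last by rewrite /p; lia.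
  rewrite (_ : (p == N - 1 - p)%N = false) ?mulr0 ?addr0 ?mulr1; last by rewrite /p; lia.
  case: (eqVneq (r : nat) p) => [->|_] /=; last by rewrite !mul0r addr0 mulr0 addr0.
  rewrite (eq_sym p) (_ : N - 1 - p = p + 3)%N; last by rewrite /p; lia.
  by rewrite exprD; ring.
apply: (gap_of_vector (k0 := k0) (g := 1%:M) (x := fun r => ((r == p) || (r == N - 1 - p)%N)%:R)).
- by lia.
- exact: unilower1.
- exact: sigma1.
- by move=> m mN; rewrite lcols1 //; exact: nnmat_idcols.
- by rewrite lcols1 //; lia.
- by move=> r; rewrite /p => rp; rewrite (_ : _ || _ = false) //; lia.
- by rewrite eqxx.
- by rewrite (_ : _ || _ = false) // /p; lia.
- by move=> r; rewrite ler0n.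
- by rewrite /p eqxx orbT ltr01.
- by move=> k; have := gap k; have := ltn_ord (val k); lia.
- apply/isotropic_colspan; rewrite (_ : row_mx _ _ = lcols (p + 1) M).
    by apply: (lcols_isotropic Nn) => //; rewrite /p; lia.
  apply/matrixP => i j; rewrite [RHS]mxE.
  have jN : (j < N)%N by have := ltn_ord j; lia.
  rewrite (ent_Ordinal _ (ltn_ord i) jN) /M /elem !mxE /= -val_eqE /= !eqSS.
  case: (split_ordP j) => j' ->; rewrite ?row_mxEl ?row_mxEr !mxE /=.
    rewrite (ltn_eqF (ltn_ord j')) andbF mulr0 addr0 //.
  rewrite ord1 addn0 eqxx andbT mul1r; case: (i == p :> nat) /eqP => [->|_] /=.
    by rewrite (_ : (p == _) = false) ?addr0 // /p; lia.
  by rewrite add0r.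
Qed.

End Gap.

Section GapOdd.
Variables (R : realType) (N n : nat).
Hypothesis Nn : N = (2 * n)%N \/ N = (2 * n + 1)%N.
Local Notation J := (altform R N).
Variable w : seq 'I_n.
Hypothesis lw : longest_reduced_word w.
Let wn := map (@nat_of_ord n) w.
Variable K : {set 'I_n}.
Local Notation I := {k : 'I_n | k \in K}.
Local Notation Gflags :=
  ([set flag_of K u | u in (Gcell n wn : set 'M[R]_N)] : set (flag_space R N K)).

(** Together with [pseq], a basis of an isotropic plane in the middle seven
coordinates all of whose 2 x 2 minors are nonnegative, and for which the
quadratic form of [quad_odd_ge0] is negative. *)
Definition qseq : seq R := [:: 0; 1; 1; 1; 1; 2^-1; 0].
Definition pseq : seq R := [:: -1; 0; 1; 1; 1; 1; 2^-1].

(** The two vectors placed on the rows s, ..., s + 6 of a matrix with 2 s + 7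
rows. *)
Definition zent s (l : nat) (j : nat) : R :=
  if (l < s)%N then 0 else nth 0 (if j == 0%N then qseq else pseq) (l - s)%N.

Lemma zent_lo s l j : (l < s)%N -> zent s l j = 0. Proof. by rewrite /zent => ->. Qed.
Lemma zent_hi s l j : (s + 7 <= l)%N -> zent s l j = 0.
Proof. by rewrite /zent => ls; case: ifP => // _; rewrite nth_default //; case: ifP => _ /=; lia. Qed.

Definition zmx s : 'M[R]_(N, 2) := \matrix_(i, j) zent s i j.

Lemma zmx_nn s : nnmat (zmx s).
Proof.
move=> f fi; rewrite det2 !mxE /=.
have : (f 0%R < f 1%R)%N by apply: fi.
move: (nat_of_ord (f 0%R)) (nat_of_ord (f 1%R)) => a b ab.
case: (ltnP a s) => sa; first by rewrite !(zent_lo _ sa) !mul0r subrr.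
case: (leqP (s + 7) b) => bs; first by rewrite !(zent_hi _ bs) !mulr0 subrr.
rewrite /zent !ltnNge sa (leq_trans sa (ltnW ab)) /=.
have : (a - s < b - s < 7)%N by lia.
move: (a - s)%N (b - s)%N => {ab sa bs}a {}b.
by case: b => [|[|[|[|[|[|[|b]]]]]]] //; case: a => [|[|[|[|[|[|a]]]]]] //; rewrite /= => h; first [by exfalso; lia | lra].
Qed.

Lemma zent_form s r c : (r < 2)%N -> (c < 2)%N -> N = (2 * s + 7)%N ->
  \sum_(l < N) (-1) ^+ l * zent s l r * zent s (N - l.+1) c = 0.
Proof.
move=> r2 c2 Ns.
rewrite -(big_mkord xpredT (fun l => (-1) ^+ l * zent s l r * zent s (N - l.+1) c)).
rewrite (@big_cat_nat _ _ _ s) //=; last by lia.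
rewrite [X in X + _](_ : _ = 0) ?add0r; last first.
  by rewrite big_nat big1 // => l ls; rewrite zent_lo ?mulr0 ?mul0r.
rewrite (@big_cat_nat _ _ _ (s + 7)) //=; [|lia..].
rewrite [X in _ + X](_ : _ = 0) ?addr0; last first.
  rewrite big_nat big1 // => l /andP[ls _].
  by rewrite zent_hi ?mulr0 ?mul0r.
rewrite -{1}[s]add0n [(s + 7)%N]addnC big_addn addnK big_mkord.
under eq_bigr => i _.
  rewrite /zent (_ : (i + s < s)%N = false); last by lia.
  rewrite (_ : (N - (i + s).+1 < s)%N = false); last by have := ltn_ord i; lia.
  rewrite (_ : i + s - s = i)%N; last by lia.
  rewrite (_ : N - (i + s).+1 - s = 6 - i)%N; last by have := ltn_ord i; lia.
  over.
rewrite !big_ord_recl big_ord0 /= /bump /= !exprD /=.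
by case: r r2 => [|[|r]] //; case: c c2 => [|[|c]] //= _ _; field.
Qed.

(** The flag spanned by the first [s] basis vectors followed by the two
vectors above; no member has dimension larger than s + 2. *)
Lemma gap_odd (k0 : I) : N = (2 * n + 1)%N -> (3 <= n)%N -> (val k0).+2 = n ->
  (forall k : I, val k <> (val k0).+1 :> nat) ->
  closure Gflags <> isoFl J K `&` FlDnonneg K.
Proof.
move=> Ne n3 kn gap eqc; pose s := (n - 3)%N.
have Ns : N = (2 * s + 7)%N by rewrite /s; lia.
have ks : val k0 = s.+1 :> nat by rewrite /s; lia.
have kK (k : I) : (val k <= s.+1)%N.
  by have := gap k; have := ltn_ord (val k); rewrite /s; lia.
clearbody s.
have sN : (s <= N)%N by lia.
pose g : 'M[R]_N := \matrix_(i, j) if (j < s)%N then (i == j)%:R else zent s i (j - s).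
pose A := row_mx (idcols R N s) (zmx s).
have gE (i : 'I_N) j : (j < N)%N ->
    ent g i j = if (j < s)%N then (i == j :> nat)%:R else zent s i (j - s).
  by move=> jN; rewrite (ent_Ordinal _ (ltn_ord i) jN) mxE /=.
have gA : lcols (s + 2) g = A.
  apply/matrixP => i j; rewrite [LHS]mxE /A.
  case: (split_ordP j) => j' ->; rewrite ?row_mxEl ?row_mxEr !mxE gE /=.
  - by rewrite ltn_ord.
  - by have := ltn_ord j'; lia.
  - by rewrite ltnNge leq_addr addKn.
  - by have := ltn_ord j'; lia.
have g1 : lcols (s + 1) g = row_mx (idcols R N s) (col 0 (zmx s)).
  apply/matrixP => i j; rewrite [LHS]mxE.
  case: (split_ordP j) => j' ->; rewrite ?row_mxEl ?row_mxEr !mxE gE /=.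
  - by rewrite ltn_ord.
  - by have := ltn_ord j'; lia.
  - by rewrite ltnNge leq_addr addKn ord1.
  - by have := ltn_ord j'; lia.
have g0 m : (m <= s)%N -> lcols m g = idcols R N m.
  move=> ms; apply/matrixP => i j; have jm := ltn_ord j.
  by rewrite !mxE gE ?(leq_trans jm ms) //; lia.
have Z0 (i : 'I_N) j : (i < s)%N -> zmx s i j = 0 by move=> si; rewrite mxE zent_lo.
have C0 (i : 'I_N) j : (i < s)%N -> col 0 (zmx s) i j = 0.
  by move=> si; rewrite !mxE zent_lo.
have o (i : nat) : (i < 6)%N -> (s + i < N)%N by lia.
pose a i (h : (i < 6)%N) : 'I_N := Ordinal (o i h).
have mA i j (hi : (i < 6)%N) (hj : (j < 6)%N) : minor sN [tuple a i hi; a j hj] A =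
    qseq`_i * pseq`_j - pseq`_i * qseq`_j.
  rewrite minor_idcols // det2 !mxE !(tnth_nth (a i hi)) /= /zent.
  by rewrite !(ltnNge (s + _)%N) !leq_addr !addKn.
have rA : \rank A = (s + 2)%N.
  apply: (posmat_rank (f := rows sN [tuple a 0%N isT; a 1%N isT])).
  by have := mA 0%N 1%N isT isT; rewrite /minor => -> /=; lra.
have r1 : \rank (row_mx (idcols R N s) (col 0 (zmx s))) = (s + 1)%N.
  apply: (posmat_rank (f := rows sN [tuple a 1%N isT])).
  rewrite -/(minor sN _ _) minor_idcols // det_mx11 !mxE (tnth_nth (a 1%N isT)) /= /zent.
  by rewrite ltnNge leq_addr addKn /= ltr01.
have isoA : A^T *m J *m A = 0.
  have lo (l r : nat) (rs : 'I_s) : (N - l.+1)%N = rs -> (l < N)%N -> zent s l r = 0.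
    by move=> e lN; rewrite zent_hi //; have := ltn_ord rs; lia.
  apply/matrixP => r c; rewrite formE [RHS]mxE.
  case: (split_ordP r) => r' ->; case: (split_ordP c) => c' ->.
  - rewrite big1 // => l _; rewrite /A !row_mxEl !mxE /=.
    case: eqP => e1; rewrite ?mulr0 ?mul0r //; case: eqP => e2; rewrite ?mulr0 //.
    by have := ltn_ord r'; have := ltn_ord c'; have := ltn_ord l; lia.
  - rewrite big1 // => l _; rewrite /A row_mxEl row_mxEr !mxE /=.
    case: eqP => e1; rewrite ?mulr0 ?mul0r // zent_hi ?mulr0 //.
    by have := ltn_ord r'; have := ltn_ord l; lia.
  - rewrite big1 // => l _; rewrite /A row_mxEl row_mxEr !mxE /=.
    by case: eqP => e1; rewrite ?mulr0 // (lo _ _ _ e1) ?ltn_ord // mulr0 mul0r.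
  - under eq_bigr do rewrite /A !row_mxEr !mxE /=.
    exact: zent_form.
have LX : (isoFl J K `&` FlDnonneg K) (flag_of K g).
  apply: (flag_of_nonneg Nn) => k; have := kK k; rewrite leq_eqVlt ltnS leq_eqVlt => kk.
  - case/or3P: kk => [/eqP->|/eqP->|kk].
    + by rewrite -[s.+2]addn2 gA.
    + by rewrite -[s.+1]addn1 g1.
    + have kN : ((val k).+1 <= N)%N by lia.
      by rewrite g0 // -(lcols1 _ kN) (rank_lcols Nn kN) //; exact: unilower1.
  - apply: (isotropic_sub (M := colspan (lcols (s + 2) g))); first by apply: lcols_sub; lia.
    by rewrite gA; apply/isotropic_colspan.
  - case/or3P: kk => [/eqP kk|/eqP kk|kk].
    + exists (s + 2)%N, A; split; [by rewrite kk addn2 | by rewrite kk -[s.+2]addn2 gA|].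
      by apply: nnmat_block => //; exact: zmx_nn.
    + exists (s + 1)%N, (row_mx (idcols R N s) (col 0 (zmx s))).
      split; [by rewrite kk addn1 | by rewrite kk -[s.+1]addn1 g1|].
      apply: nnmat_block => // f _; rewrite det_mx11 !mxE /zent; case: ifP => // _.
      by rewrite /qseq /=; move: (_ - _)%N => [|[|[|[|[|[|[|[|?]]]]]]]] //=; lra.
    + exists (val k).+1, (idcols R N (val k).+1); split; rewrite ?g0 //.
      by apply: nnmat_idcols; lia.
rewrite -eqc in LX.
have kE : (val k0).+1 = (s + 2)%N by rewrite ks addn2.
have fE : flag_of K g k0 = colspan A :> {vspace _}.
  by rewrite flag_colspan ?kE ?gA //; lia.
have pos (u : 'M[R]_N) : Gcell n wn u -> 0 <= quad sN [tuple a 0%N isT; a 2%N isT]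
    [tuple a 3%N isT; a 4%N isT] [tuple a 0%N isT; a 1%N isT]
    [tuple a 3%N isT; a 5%N isT] (lcols (s + 2) u).
  by move=> cu; apply: (quad_odd_ge0 Nn sN Ns _ _ _ _ _ _ cu); rewrite /= ?addn0 ?addn1 ?addn2.
have := closure_quad Nn kE pos LX (esym fE) rA.
by rewrite /quad !mA /=; lra.
Qed.

End GapOdd.

(** * The two classical groups *)

Section Forms.
Variables (R : realType) (n : nat).

Lemma Sp_formE : Sp_form R (n := n) = altform R (2 * n).
Proof.
apply/matrixP => r s; have rN := ltn_ord r; have sN := ltn_ord s.
rewrite summxE (bigD1_seq r.+1) ?iota_uniq ?mem_index_iota //= big1 ?addr0.
  by rewrite !mxE eqxx exprD exprS /= mulN1r mulrN1 opprK; congr (_ * _%:R); lia.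
by move=> i ir; rewrite !mxE (eq_sym r.+1) (negPf ir) mulr0.
Qed.

Lemma SO_formE : SO_form R (n := n) = - altform R (2 * n + 1).
Proof.
apply/matrixP => r s; have rN := ltn_ord r; have sN := ltn_ord s.
rewrite summxE (bigD1_seq r.+1) ?iota_uniq ?mem_index_iota //=.
rewrite big1 ?addr0; last by move=> i ir; rewrite !mxE (eq_sym r.+1) (negPf ir) mulr0.
rewrite !mxE eqxx exprS /= mulN1r mulNr; congr (- (_ * _%:R)); lia.
Qed.

Lemma Sp_yE (i : 'I_n) a : Sp_y R i a = Gy (2 * n) n i a.
Proof.
rewrite /Sp_y /Gy; have := ltn_ord i; case: ifP => h ilt.
  rewrite /Y /elem addn1; congr (_ *m (_ + _ *: munit R _ _ _)); lia.
rewrite eqxx /Y /elem; congr (_ + _ *: munit R _ _ _); lia.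
Qed.

(** The exponential of the short root vector as a product of three elementary
matrices. *)
Lemma SO_yE (i : 'I_n) a : SO_y R i a = Gy (2 * n + 1) n i a.
Proof.
rewrite /SO_y /Gy; have := ltn_ord i; case: ifP => h ilt.
  rewrite /Y /elem; congr ((_ + _ *: munit R _ _ _) *m (_ + _ *: munit R _ _ _)); lia.
rewrite (_ : (2 * n + 1 == 2 * n)%N = false); last by lia.
have iE : nat_of_ord i = n.-1 by lia.
have s0 := sq2_gt0 R; have s2 := sq2_sqr R.
apply/matrixP => r s; rewrite elemE -[i.+1]/(i.+1) elemE.
have p1 : (i < 2 * n + 1)%N by lia.
have p2 : (i.+1 < 2 * n + 1)%N by lia.
rewrite [rw _ i s]rw_elem_ne; last by apply/eqP; lia.
have rwi k (B : 'M[R]_(2 * n + 1, k)) c : rw B i c = B (Ordinal p1) c by rewrite -rwE.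
have rwi1 k (B : 'M[R]_(2 * n + 1, k)) c : rw B i.+1 c = B (Ordinal p2) c by rewrite -rwE.
rewrite rwi rwi1 /Y /elem !mxE -!val_eqE /=.
have ni : n = i.+1 by lia.
rewrite (_ : (r.+1 == n + 1)%N = (r == i.+1 :> nat)); last by lia.
rewrite (_ : (r.+1 == n + 2)%N = (r == i.+2 :> nat)); last by lia.
rewrite (_ : (s.+1 == n) = (s == i :> nat)); last by lia.
rewrite (_ : (s.+1 == n + 1)%N = (s == i.+1 :> nat)); last by lia.
rewrite !eqSS (_ : (i == i.+1 :> nat) = false) ?(eq_sym _ (nat_of_ord s)) ?eqxx; last by lia.
set q := Num.sqrt 2 in s0 s2 *; have qn : q != 0 by rewrite gt_eqF.
have c1 : a / q = q * a / 2 by rewrite -s2; field; rewrite qn.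
have c2 : q * a * (a / q) = a ^+ 2 by field; rewrite qn.
case: (eqVneq (r : nat) i.+1) => [->|_] /=.
  rewrite (_ : (i.+1 == i.+2 :> nat) = false); last by lia.
  case: (eqVneq (s : nat) i) => [->|_] /=; last by rewrite ?andbF /=; ring.
  by rewrite (_ : (i == i.+1 :> nat) = false) /=; [rewrite c1; field | lia].
case: (eqVneq (r : nat) i.+2) => [->|_] /=; last by rewrite ?andbF /=; ring.
case: (eqVneq (s : nat) i) => [->|_] /=; last by ring.
rewrite (_ : (i == i.+1 :> nat) = false) /=; last by lia.
by rewrite -c2; ring.
Qed.

Lemma SO_formP (A : 'M[R]_(2 * n + 1)) :
  A^T *m SO_form R (n := n) *m A = SO_form R (n := n) <-> sigma_rel A A.
Proof.
by rewrite SO_formE mulmxN mulNmx; split=> [/oppr_inj|h]; [|congr (- _)].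
Qed.

End Forms.

(** * The equivalences *)

(** The gap is just before the smallest missing index above the minimum of
[K]. *)
Lemma gap_ex n (K : {set 'I_n}) : K != finset.set0 -> (exists k : 'I_n, K = [set i : 'I_n | (k <= i)%N]%SET) \/
  exists k0 : {k : 'I_n | k \in K}, ((val k0).+2 <= n)%N /\ forall k : {k : 'I_n | k \in K}, val k <> (val k0).+1 :> nat.
Proof.
move=> /set0Pn[k kK].
have [m mK mmin] := arg_minnP (fun i : 'I_n => nat_of_ord i) kK.
have [/forallP up|] := boolP [forall i : 'I_n, (m <= i)%N ==> (i \in K)].
  left; exists m; apply/setP => i; rewrite inE; apply/idP/idP; first exact: mmin.
  by move=> mi; apply: (implyP (up i)).
rewrite negb_forall => /existsP[j0]; rewrite negb_imply => j0P; right.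
have [j /andP[mj jK] jmin] := @arg_minnP _ j0 (fun i => (m <= i)%N && (i \notin K))
  (fun i : 'I_n => nat_of_ord i) j0P.
have mj' : (m < j)%N.
  rewrite ltn_neqAle mj andbT; apply/eqP => e.
  by move/negP: jK; rewrite (ord_inj (esym e)) => h; exact: h mK.
have j1n : (j.-1 < n)%N by have := ltn_ord j; lia.
have j1K : Ordinal j1n \in K.
  apply/negPn/negP => nK; have := jmin (Ordinal j1n); rewrite nK andbT /=; lia.
exists (Sub (Ordinal j1n) j1K); split=> /=; first by have := ltn_ord j; lia.
move=> s es; move: (valP s); rewrite (_ : val s = j) ?(negPf jK) //.
by apply: ord_inj; rewrite es; lia.
Qed.

Section Equivalence.
Variables (R : realType) (N n : nat).
Hypothesis Nn : N = (2 * n)%N \/ N = (2 * n + 1)%N.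
Variable J' : 'M[R]_N.
Hypothesis isoJ : forall L, isotropic J' L <-> isotropic (altform R N) L.
Hypothesis JJ' : forall A : 'M[R]_N, A^T *m J' *m A = J' <-> sigma_rel A A.
Variable y : 'I_n -> R -> 'M[R]_N.
Hypothesis yE : forall i a, y i a = Gy N n i a.
Variable w : seq 'I_n.
Hypothesis lw : longest_reduced_word w.
Variable K : {set 'I_n}.
Local Notation I := {k : 'I_n | k \in K}.

Local Notation FP := (@flagpos R N n J' y w K).

Lemma tfae_flagpos : (2 <= n)%N -> (N = (2 * n + 1)%N -> (3 <= n)%N) -> K != finset.set0 ->
  [<-> FP = isoFl J' K `&` FlDpos K; closure FP = isoFl J' K `&` FlDnonneg K;
       exists k : 'I_n, K = [set i : 'I_n | (k <= i)%N]%SET].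
Proof.
move=> n2 n3 K0; have n0 : (0 < n)%N by lia.
rewrite (isoFlE isoJ).
split; last split; last first.
- case=> k KE; exact: (flagpos_interval Nn n0 isoJ JJ' yE lw KE).
- move=> eqc; case: (gap_ex K0) => // -[k0 [kn gap]]; exfalso.
  rewrite (flagpos_cell Nn n0 JJ' yE) in eqc.
  case: (ltnP (val k0).+2 n) => h; first exact: (gap_far Nn h gap eqc).
  have e : (val k0).+2 = n by lia.
  by case: (Nn) => Ne; [apply: (gap_even Nn Ne e gap eqc) | apply: (gap_odd Nn Ne _ e gap eqc); exact: n3].
- exact: (flagpos_closure Nn lw).
Qed.

End Equivalence.

Section RankTwo.
Variable R : realType.
Local Notation N := (2 * 2 + 1)%N.
Local Notation J := (altform R N).

(** Up to scaling, a positive isotropic vector is the first column of y_1(a)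
y_2(b') y_1(c) for positive parameters, here with b = sqrt 2 b'; they are
rational functions of the coordinates. The second column of this product times
y_2(b') then gives the required plane. *)
Lemma isotropic_pair (B : 'M[R]_(N, 1)) : posmat B -> B^T *m J *m B = 0 ->
  exists C : 'M[R]_(N, 2), [/\ posmat C, C^T *m J *m C = 0 & (colspan B <= colspan C)%VS].
Proof.
move=> pB iB.
pose v k : R := B (inord k : 'I_N.-1.+1) 0.
have vp k : 0 < v k.
  have := pB (fun=> inord k : 'I_N.-1.+1); rewrite det_mx11 mxE; apply.
  by move=> i j; rewrite !ord1 ltnn.
have BE (i : 'I_N) : B i 0 = v i by congr (B _ _); apply: ord_inj; rewrite inordK.
have eqv : 2 * v 0%N * v 4 + v 2 ^+ 2 = 2 * v 1%N * v 3.
  have := congr1 (fun M : 'M_1 => M 0 0) iB.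
  rewrite formE mxE !big_ord_recl big_ord0 !BE /= /bump /= => h.
  by move: h; rewrite !exprS expr0; lra.
pose t := v 0%N; pose a := v 4 / v 3; pose b := 2 * v 3 / v 2; pose c := v 2 ^+ 2 / (2 * t * v 3).
have v20 := vp 2; have v30 := vp 3; have v40 := vp 4.
have t0 : 0 < t by exact: vp.
have a0 : 0 < a by rewrite divr_gt0.
have b0 : 0 < b by rewrite divr_gt0 // mulr_gt0.
have c0 : 0 < c by rewrite divr_gt0 ?exprn_gt0 // !mulr_gt0.
have [n2 n3 nt] : [/\ v 2 != 0, v 3 != 0 & t != 0] by rewrite !gt_eqF.
pose vs : seq R := [:: t; t * (a + c); t * (b * c); t * (b ^+ 2 * c / 2);
  t * (a * b ^+ 2 * c / 2)].
pose ps : seq R := [:: 0; 1; 2 * b; 2 * b ^+ 2; b ^+ 2 * c / 2 + 2 * a * b ^+ 2].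
have vE (i : 'I_N) : B i 0 = vs`_i.
  rewrite BE; case: i => -[|[|[|[|[|//]]]]] /= _ //.
  - have e : v 1%N = (2 * t * v 4 + v 2 ^+ 2) / (2 * v 3) by rewrite eqv; field; rewrite n3.
    by rewrite e /a /c; field; rewrite ?n3 ?nt.
  - by rewrite /b /c; field; rewrite ?n2 ?n3 ?nt.
  - by rewrite /b /c; field; rewrite ?n2 ?n3 ?nt.
  - by rewrite /a /b /c; field; rewrite ?n2 ?n3 ?nt.
exists (\matrix_(i, j) (if j == 0 then vs else ps)`_i); split.
- move=> f fi; rewrite det2 !mxE /=.
  have : (f 0%R < f 1%R)%N by apply: fi.
  have : (f 1%R < 5)%N by apply: ltn_ord.
  move: (nat_of_ord (f 0%R)) (nat_of_ord (f 1%R)) => {}i {}j.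
  have pos (p q : R) : q = p -> 0 < p -> 0 < q by move=> ->.
  case: j => [|[|[|[|[|j]]]]] // _; case: i => [|[|[|[|i]]]] // _ /=.
  - apply: (pos (t)); [by field | by do ?[apply: addr_gt0 | apply: divr_gt0 | apply: mulr_gt0 | apply: exprn_gt0]].
  - apply: (pos (t * b * 2)); [by field | by do ?[apply: addr_gt0 | apply: divr_gt0 | apply: mulr_gt0 | apply: exprn_gt0]].
  - apply: (pos (t * b * (2 * a + c))); [by field | by do ?[apply: addr_gt0 | apply: divr_gt0 | apply: mulr_gt0 | apply: exprn_gt0]].
  - apply: (pos (t * b ^+ 2 * 2)); [by field | by do ?[apply: addr_gt0 | apply: divr_gt0 | apply: mulr_gt0 | apply: exprn_gt0]].
  - apply: (pos (t * b ^+ 2 * (2 * a + 3 / 2 * c))); [by field | by do ?[apply: addr_gt0 | apply: divr_gt0 | apply: mulr_gt0 | apply: exprn_gt0]].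
  - apply: (pos (t * b ^+ 3 * c)); [by field | by do ?[apply: addr_gt0 | apply: divr_gt0 | apply: mulr_gt0 | apply: exprn_gt0]].
  - apply: (pos (t * (b ^+ 2 * c / 2 + 2 * a * b ^+ 2))); [by field | by do ?[apply: addr_gt0 | apply: divr_gt0 | apply: mulr_gt0 | apply: exprn_gt0]].
  - apply: (pos (t * b ^+ 2 * (2 * a ^+ 2 + 2 * a * c + c ^+ 2 / 2))); [by field | by do ?[apply: addr_gt0 | apply: divr_gt0 | apply: mulr_gt0 | apply: exprn_gt0]].
  - apply: (pos (t * b ^+ 3 * c * (c / 2 + a))); [by field | by do ?[apply: addr_gt0 | apply: divr_gt0 | apply: mulr_gt0 | apply: exprn_gt0]].
  - apply: (pos (t * b ^+ 4 * c ^+ 2 / 4)); [by field | by do ?[apply: addr_gt0 | apply: divr_gt0 | apply: mulr_gt0 | apply: exprn_gt0]].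
- apply/matrixP => r s; rewrite formE [RHS]mxE !big_ord_recl big_ord0 !mxE /= /bump /= !exprS expr0.
  by case: r => -[|[|//]] ? /=; case: s => -[|[|//]] ? /=; field.
- apply/colspan_sub; exists (delta_mx 0 0); apply/matrixP => i j.
  rewrite mxE !big_ord_recl big_ord0 !mxE !ord1 /= vE mulr1 mulr0 !addr0; exact: erefl.
Qed.

Variables (J' : 'M[R]_N) (y : 'I_2 -> R -> 'M[R]_N).
Hypothesis isoJ : forall L, isotropic J' L <-> isotropic J L.
Hypothesis JJ' : forall A : 'M[R]_N, A^T *m J' *m A = J' <-> sigma_rel A A.
Hypothesis yE : forall i a, y i a = Gy N 2 i a.
Variable w : seq 'I_2.
Hypothesis lw : longest_reduced_word w.
Variable K : {set 'I_2}.
Local Notation FP := (@flagpos R N 2 J' y w K).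

(** The only set of dimensions that is not an upper interval consists of 1
alone. *)
Lemma flagpos_rank2 : K != finset.set0 -> FP = isoFl J' K `&` FlDpos K.
Proof.
move=> K0; rewrite (isoFlE isoJ).
have Nn : N = (2 * 2)%N \/ N = (2 * 2 + 1)%N by right.
have n0 : (0 < 2)%N by [].
have [[k KE]|[k0 [k02 gap]]] := gap_ex K0.
  exact: (flagpos_interval Nn n0 isoJ JJ' yE lw KE).
have kE (k : {k | k \in K}) : val k = 0%N :> nat.
  apply/eqP; have := ltn_ord (val k); have := gap k; case: (val k) => -[|[|m]] //= hm; rewrite (_ : nat_of_ord (val k0) = 0%N) //; lia.
apply/seteqP; split; first exact: (flagpos_sub Nn n0 JJ' yE lw).
move=> L [[[dL _] isoL] [_ pL]].
have d1 : \dim (L k0 : {vspace _}) = 1%N by rewrite dL kE.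
have [B [eB pB]] := proj1 (plucker_positiveP d1) (pL k0).
have iB : B^T *m J *m B = 0 by apply/isotropic_colspan; rewrite eB.
have [C [pC iC BC]] := isotropic_pair pB iB.
(* only the values at 1 and 2 matter *)
pose F k : 'M[R]_(N, k) := match k with 1 => B | 2 => C | _ => 0 end.
have [||| u cu uE] := flag_to_cell Nn n0 lw (B := F) => //.
- by case=> [|[|[|k]]].
- by case=> [|[|k]].
rewrite (flagpos_cell Nn n0 JJ' yE); exists u => //.
apply: functional_extensionality_dep => k.
rewrite flag_colspan // kE uE //= eB; congr (L _).
by apply: val_inj; apply: ord_inj; rewrite !kE.
Qed.

End RankTwo.

Local Close Scope ring_scope.
Local Close Scope classical_set_scope.

Theorem theorem1 (R : realType) :
  (forall (n : nat) (w : seq 'I_n) (K : {set 'I_n}),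
     (2 <= n)%N -> longest_reduced_word w -> K != finset.set0 ->
     [<-> SpFl_pos R K w = SpFlDpos R K;
          SpFl_nonneg R K w = SpFlDnonneg R K;
          exists k : 'I_n, K = [set i : 'I_n | (k <= i)%N]])
  /\
  (forall (n : nat) (w : seq 'I_n) (K : {set 'I_n}),
     (3 <= n)%N -> longest_reduced_word w -> K != finset.set0 ->
     [<-> SOFl_pos R K w = SOFlDpos R K;
          SOFl_nonneg R K w = SOFlDnonneg R K;
          exists k : 'I_n, K = [set i : 'I_n | (k <= i)%N]])
  /\
  (forall (w : seq 'I_2) (K : {set 'I_2}),
     longest_reduced_word w -> K != finset.set0 ->
     SOFl_pos R K w = SOFlDpos R K /\
     SOFl_nonneg R K w = SOFlDnonneg R K).
Proof.
have isoB n L : isotropic (SO_form R (n := n)) L <-> isotropic (altform R (2 * n + 1)) L.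
  by rewrite SO_formE; exact: isotropicN.
have isoC n L : isotropic (Sp_form R (n := n)) L <-> isotropic (altform R (2 * n)) L.
  by rewrite Sp_formE.
split; [|split].
- move=> n w K n2 lw K0.
  have Nn : (2 * n)%N = (2 * n)%N \/ (2 * n)%N = (2 * n + 1)%N by left.
  apply: (tfae_flagpos Nn (isoC n) _ (@Sp_yE R n) lw n2 _ K0); last by lia.
  by move=> A; rewrite Sp_formE.
- move=> n w K n3 lw K0.
  have Nn : (2 * n + 1)%N = (2 * n)%N \/ (2 * n + 1)%N = (2 * n + 1)%N by right.
  exact: (tfae_flagpos Nn (isoB n) (@SO_formP R n) (@SO_yE R n) lw (ltnW n3) (fun=> n3) K0).
- move=> w K lw K0.
  have Nn : (2 * 2 + 1)%N = (2 * 2)%N \/ (2 * 2 + 1)%N = (2 * 2 + 1)%N by right.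
  have e := flagpos_rank2 (isoB 2) (@SO_formP R 2) (@SO_yE R 2) lw K0.
  split; first exact: e.
  have isoE := isoFlE (isoB 2) K.
  apply: etrans (congr1 (fun X => setI X (FlDnonneg K)) (esym isoE)).
  by apply: (flagpos_closure Nn lw); rewrite -isoE.
Qed.
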